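(* The squared norm of the Nijenhuis tensor $N$ of the canonical almost complex structure $J$ on the adjoint orbit $(G/V,\omega)$ of $v=ih_\varphi$ is the constant $$|N|^2=\sum_{\alpha,\beta\in\Delta_n^+\setminus\varphi^\perp}\frac{(\varphi,\alpha+\beta)}{(\varphi,\alpha)(\varphi,\beta)}N_{\alpha,\beta}^2+\sum_{\alpha\in\Delta_c^+\setminus\varphi^\perp}\ \sum_{\beta\in\Delta_n^+\setminus\varphi^\perp}(1+s_{\alpha-\beta})\frac{(\varphi,\alpha-\beta)}{(\varphi,\alpha)(\varphi,\beta)}N_{\alpha,-\beta}^2,$$ where $\Delta_c^+$, $\Delta_n^+$ denote the sets of positive roots that are compact and non-compact respectively.
   Context: $G$ is a non-compact real semisimple Lie group with Lie algebra $\mathfrak g$ and Killing form $B$; $v\in\mathfrak g$ has compact stabilizer $V\subset G$ under the adjoint action, $\mathfrak v$ is the Lie algebra of $V$, and $\mathfrak m$ is the $B$-orthogonal complement of $\mathfrak v$, identified with the tangent space of $G/V$ at the identity coset $e$. The Kirillov-Kostant-Souriau form $\omega$ is the $G$-invariant symplectic form on $G/V$ given at $e$ by $\sigma(x,y)=B(v,[x,y])$. Let $\mathfrak k\supset\mathfrak v$ be a maximal compact subalgebra, $\mathfrak g=\mathfrak k\oplus\mathfrak p$ the Cartan decomposition, $\mathfrak h_0\subset\mathfrak k$ a maximal abelian subalgebra containing $v$; its complexification is a Cartan subalgebra of $\mathfrak g_c=\mathfrak g\otimes\mathbf C$. $\Delta$ is the set of roots, real on $\mathfrak h_{\mathbf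 R}=i\mathfrak h_0$, where $B$ is positive definite. For $\psi\in\mathfrak h_{\mathbf R}^*$, $h_\psi\in\mathfrak h_{\mathbf R}$ satisfies $\psi(h)=B(h_\psi,h)$, and $(\psi,\psi')=B(h_\psi,h_{\psi'})$. $\varphi$ is defined by $v=ih_\varphi$, and $\Delta^+$ is a positive root system with $(\varphi,\alpha)\ge0$ for all $\alpha\in\Delta^+$; $\varphi^\perp$ is the set of elements orthogonal to $\varphi$. A root $\alpha$ is compact ($\varepsilon_\alpha=-1$) if $\mathfrak g^\alpha\subset\mathfrak k_c$, non-compact ($\varepsilon_\alpha=1$) if $\mathfrak g^\alpha\subset\mathfrak p_c$; $s_\alpha=1$ if $\alpha\in\Delta^+$, $s_\alpha=-1$ otherwise. Let $\tau,\tau_0$ be the complex conjugations of $\mathfrak g_c$ fixing $\mathfrak g$ and $\mathfrak k\oplus i\mathfrak p$ respectively. Root vectors $e_\alpha\in\mathfrak g^\alpha$ are chosen so that $[e_\alpha,e_{-\alpha}]=h_\alpha$, $B(e_\alpha,e_\beta)=\delta_{\alpha,-\beta}$, $[e_\alpha,e_\beta]=N_{\alpha,\beta}e_{\alpha+\beta}$ if $\alpha+\beta\in\Delta$, $\tau_0(e_\alpha)=-e_{-\alpha}$, $\tau(e_\alpha)=\varepsilon_\alpha e_{-\alpha}$, with $N_{\alpha,\beta}$ real, non-zero and $N_{\beta,\alpha}=-N_{\alpha,\beta}=N_{-\alpha,-\beta}=N_{-\beta,\alpha+\beta}=N_{\alpha+\beta,-\alpha}$. By convention terms with $N_{\alpha,\beta}$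 (resp. $N_{\alpha,-\beta}$) vanish when $\alpha+\beta$ (resp. $\alpha-\beta$) is not a root. One has $\mathfrak m=\bigoplus_{\alpha\in\Delta^+\setminus\varphi^\perp}\mathfrak m_\alpha$ with $\mathfrak m_\alpha=(\mathfrak g^\alpha\oplus\mathfrak g^{-\alpha})\cap\mathfrak g$; $J$ is the $G$-invariant almost complex structure, compatible with $\omega$, given at $e$ by $Hx=\frac{\varepsilon_\alpha}{(\varphi,\alpha)}[v,x]$ for $x\in\mathfrak m_\alpha$. The Nijenhuis tensor is defined by $4N(X,Y)=[JX,JY]-J[JX,Y]-J[X,JY]-[X,Y]$. Its pointwise squared norm, with respect to the Riemannian metric $\omega(\cdot,J\cdot)$, is normalized as $|N|^2=2\sum_{i,j=1}^n|N(e_i,e_j)|^2$ for any symplectic orthonormal basis of the form $e_1,Je_1,\dots,e_n,Je_n$ of the tangent space. *)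

(* Defs.v *)
From HB Require Import structures.
From mathcomp Require Import all_boot all_order all_algebra.
From mathcomp Require Import all_classical all_reals all_analysis.
From mathcomp Require Import complex.

Set Implicit Arguments.
Unset Strict Implicit.
Unset Printing Implicit Defensive.

Import Order.TTheory GRing.Theory Num.Theory.
Import numFieldNormedType.Exports.

Local Open Scope classical_set_scope.
Local Open Scope ring_scope.

Fixpoint class_C (R : realType) (V W : normedModType R) (k : nat)
    (U : set V) (f : V -> W) : Prop :=
  if k is k'.+1 then
    (forall x, U x -> differentiable f x) /\
    (forall w, class_C k' U (fun x => 'D_w f x))
  else forall x, U x -> {for x, continuous f}.

Definition smooth_on (R : realType) (V W : normedModType R)
  (U : set V) (f : V -> W) : Prop := forall k, class_C k U f.

(* Both structures live on one carrier; their compatibility is part of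
   [lie_group]. *)
HB.structure Definition TopGroup := {G of Group G & Topological G}.

(* [chart_inv] is only meaningful on the open set [chart_img]. *)
Record chart (R : realType) (M : topologicalType) (d : nat) := Chart {
  chart_dom : set M ;
  chart_map :> M -> 'rV[R]_d ;
  chart_inv : 'rV[R]_d -> M ;
  chart_dom_open : open chart_dom ;
  chart_img_open : open (chart_map @` chart_dom) ;
  chart_mapK : forall x, chart_dom x -> chart_inv (chart_map x) = x ;
  chart_map_cont : forall x, chart_dom x -> {for x, continuous chart_map} ;
  chart_inv_cont : forall y, (chart_map @` chart_dom) y ->
    {for y, continuous chart_inv}
}.

Definition chart_img (R : realType) (M : topologicalType) (d : nat)
  (a : chart R M d) : set 'rV[R]_d := a @` chart_dom a.

Definition smooth_atlas (R : realType) (M : topologicalType) (d : nat)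
    (A : set (chart R M d)) : Prop :=
  (forall x, exists2 a, A a & chart_dom a x) /\
  (forall a b, A a -> A b ->
     smooth_on (a @` (chart_dom a `&` chart_dom b)) (b \o chart_inv a)).

Definition lie_group (R : realType) (G : TopGroup.type) (d : nat)
    (A : set (chart R G d)) : Prop :=
  [/\ hausdorff_space G, @second_countable G, smooth_atlas A,
      continuous (fun g : G * G => (g.1 * g.2)%g) /\
      (forall a b c, A a -> A b -> A c ->
         smooth_on
           [set z : 'rV[R]_d * 'rV[R]_d |
              [/\ chart_img a z.1, chart_img b z.2 &
                  chart_dom c (chart_inv a z.1 * chart_inv b z.2)%g]]
           (fun z => c (chart_inv a z.1 * chart_inv b z.2)%g)) &
      continuous (fun g : G => (g^-1)%g) /\
      (forall a c, A a -> A c ->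
         smooth_on
           [set z | chart_img a z /\ chart_dom c ((chart_inv a z)^-1)%g]
           (fun z => c ((chart_inv a z)^-1)%g))].

Section LieAlgebra.
Variables (R : realType) (G : TopGroup.type) (d : nat).
(* The chart [c] around 1 identifies the tangent space of G at 1 with R^d. *)
Variable c : chart R G d.

Definition Ad (g : G) (x : 'rV[R]_d) : 'rV[R]_d :=
  'D_x (fun z => c (g * chart_inv c z * g^-1)%g) (c 1%g).

(* ad is the differential of Ad at 1. *)
Definition lie_br (x y : 'rV[R]_d) : 'rV[R]_d :=
  'D_x (fun z => Ad (chart_inv c z) y) (c 1%g).

(* t |-> E (t x) is the one-parameter subgroup with velocity x; this
   determines E. *)
Definition is_exponential (E : 'rV[R]_d -> G) : Prop :=
  forall x, [/\ continuous (fun t : R => E (t *: x)),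
    (forall s t : R, E ((s + t) *: x) = (E (s *: x) * E (t *: x))%g) &
    is_derive (0 : R) (1 : R) (fun t : R => c (E (t *: x))) x].

Definition stabilizer (v : 'rV[R]_d) : set G := [set g | Ad g v = v].

Definition lie_algebra_of (E : 'rV[R]_d -> G) (H : set G) : set 'rV[R]_d :=
  [set x | forall t : R, H (E (t *: x))].

Definition orbit_of (v : 'rV[R]_d) : set 'rV[R]_d := [set Ad g v | g in setT].

Definition orbit_tangent (q : 'rV[R]_d) : set 'rV[R]_d :=
  [set lie_br x q | x in setT].

(* G/V is identified with the orbit of v by gV |-> Ad g v; its smooth structure
   is the one for which functions on it are smooth iff their pull-backs to G
   are. *)
Definition smooth_vector_field (A : set (chart R G d)) (v : 'rV[R]_d)
    (X : 'rV[R]_d -> 'rV[R]_d) : Prop :=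
  (forall q, orbit_of v q -> orbit_tangent q (X q)) /\
  (forall a, A a ->
     smooth_on (chart_img a) (fun z => X (Ad (chart_inv a z) v))).

(* Derivative at q, along the tangent vector w = [x, q], of a function F
   defined on the orbit: c^-1(z) q runs through the orbit, and z |-> c^-1(z) q
   maps the direction x at 1 to [x, q]. *)
Definition orbit_deriv (F : 'rV[R]_d -> 'rV[R]_d) (q w : 'rV[R]_d) :
    'rV[R]_d :=
  'D_(xget 0 [set x | lie_br x q = w])
     (fun z => F (Ad (chart_inv c z) q)) (c 1%g).

(* D_X Y - D_Y X, as for any submanifold of a vector space. *)
Definition vf_br (X Y : 'rV[R]_d -> 'rV[R]_d) (q : 'rV[R]_d) : 'rV[R]_d :=
  orbit_deriv Y q (X q) - orbit_deriv X q (Y q).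

Definition is_nijenhuis (A : set (chart R G d)) (v : 'rV[R]_d)
    (J : 'rV[R]_d -> 'rV[R]_d -> 'rV[R]_d)
    (N : 'rV[R]_d -> 'rV[R]_d -> 'rV[R]_d -> 'rV[R]_d) : Prop :=
  forall X Y, smooth_vector_field A v X -> smooth_vector_field A v Y ->
  forall q, orbit_of v q ->
    let JX := fun r => J r (X r) in
    let JY := fun r => J r (Y r) in
    4 *: N q (X q) (Y q) =
      vf_br JX JY q - J q (vf_br JX Y q) - J q (vf_br X JY q) - vf_br X Y q.

Section Metric.
Variables (omega : 'rV[R]_d -> 'rV[R]_d -> 'rV[R]_d -> R)
  (J : 'rV[R]_d -> 'rV[R]_d -> 'rV[R]_d).

Definition metric (q w w' : 'rV[R]_d) : R := omega q w (J q w').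

(* [e i] and [J (e i)] together form a symplectic orthonormal basis of the
   tangent space at q. *)
Definition symplectic_onb (q : 'rV[R]_d) (n : nat) (e : 'I_n -> 'rV[R]_d) :
    Prop :=
  [/\ (forall i, orbit_tangent q (e i) /\ orbit_tangent q (J q (e i))),
      (forall i j, metric q (e i) (e j) = (i == j)%:R /\
                   metric q (J q (e i)) (J q (e j)) = (i == j)%:R),
      (forall i j, metric q (e i) (J q (e j)) = 0 /\
                   metric q (J q (e i)) (e j) = 0) &
      (forall w, orbit_tangent q w -> exists a b : 'I_n -> R,
         w = \sum_(i < n) (a i *: e i + b i *: J q (e i)))].

(* The squared norm of N at q exists and equals r. *)
Definition nijenhuis_sqnorm (N : 'rV[R]_d -> 'rV[R]_d -> 'rV[R]_d -> 'rV[R]_d)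
    (q : 'rV[R]_d) (r : R) : Prop :=
  (exists n (e : 'I_n -> 'rV[R]_d), symplectic_onb q e) /\
  (forall n (e : 'I_n -> 'rV[R]_d), symplectic_onb q e ->
     2 * \sum_(i < n) \sum_(j < n) metric q (N q (e i) (e j)) (N q (e i) (e j))
     = r).

End Metric.
End LieAlgebra.

Definition killing (F : fieldType) (d : nat)
    (br : 'rV[F]_d -> 'rV[F]_d -> 'rV[F]_d) (x y : 'rV[F]_d) : F :=
  \tr (lin1_mx (br x) *m lin1_mx (br y)).

Definition semisimple (F : fieldType) (d : nat)
    (br : 'rV[F]_d -> 'rV[F]_d -> 'rV[F]_d) : Prop :=
  forall x, (forall y, killing br x y = 0) -> x = 0.

Section RealForm.
Variables (R : realType) (d : nat) (br : 'rV[R]_d -> 'rV[R]_d -> 'rV[R]_d).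

Local Notation B := (killing br).

(* Such a [k] is automatically a maximal compact subalgebra, and every maximal
   compact subalgebra arises in this way. *)
Definition cartan_decomposition (k p : {vspace 'rV[R]_d}) : Prop :=
  [/\ (k + p = fullv)%VS /\ (k :&: p = 0)%VS,
      forall x y, x \in k -> y \in k -> br x y \in k,
      forall x y, x \in k -> y \in p -> br x y \in p,
      forall x y, x \in p -> y \in p -> br x y \in k &
      (forall x, x \in k -> x != 0 -> B x x < 0) /\
      (forall x, x \in p -> x != 0 -> 0 < B x x)].

Definition abelian (a : {vspace 'rV[R]_d}) : Prop :=
  forall x y, x \in a -> y \in a -> br x y = 0.

Definition maximal_abelian_in (k a : {vspace 'rV[R]_d}) : Prop :=
  [/\ (a <= k)%VS, abelian a &
      forall b : {vspace 'rV[R]_d},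
        (b <= k)%VS -> abelian b -> (a <= b)%VS -> b = a].

Definition orthogonal_of (S : set 'rV[R]_d) : set 'rV[R]_d :=
  [set x | forall y, S y -> B x y = 0].

Local Notation C := R[i].

Definition cplx (x : 'rV[R]_d) : 'rV[C]_d := map_mx (real_complex R) x.
Definition re_mx (z : 'rV[C]_d) : 'rV[R]_d := map_mx (@complex.Re R) z.
Definition im_mx (z : 'rV[C]_d) : 'rV[R]_d := map_mx (@complex.Im R) z.

Definition cbr (z w : 'rV[C]_d) : 'rV[C]_d :=
  cplx (br (re_mx z) (re_mx w) - br (im_mx z) (im_mx w)) +
  'i%C *: cplx (br (re_mx z) (im_mx w) + br (im_mx z) (re_mx w)).

Definition complexified (S : {vspace 'rV[R]_d}) : set 'rV[C]_d :=
  [set z | re_mx z \in S /\ im_mx z \in S].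

(* The conjugate-linear map whose set of fixed points is the real form S. *)
Definition conjugation_fixing (S : set 'rV[C]_d)
    (tau : 'rV[C]_d -> 'rV[C]_d) : Prop :=
  (forall (a : C) z w, tau (a *: z + w) = conjc a *: tau z + tau w) /\
  [set z | tau z = z] = S.

Section Roots.
Variables (k p h0 : {vspace 'rV[R]_d}).

(* h_R = i h0, and a real linear form psi on h_R is encoded by the linear form
   t |-> psi (i t) on h0. *)
Definition hR_dual := 'Hom(subvs_of h0, R^o).

Definition hR_elt (t : subvs_of h0) : 'rV[C]_d := 'i%C *: cplx (vsval t).

(* h_psi *)
Definition hvec (psi : hR_dual) : 'rV[C]_d :=
  hR_elt (xget 0 [set s | forall t,
    (psi t : R)%:C%C = killing cbr (hR_elt s) (hR_elt t)]).

Definition dual_form (psi psi' : hR_dual) : R :=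
  complex.Re (killing cbr (hvec psi) (hvec psi')).

(* Since h_R spans the complexification of h0, it is enough to test against
   h_R; as the roots are real on h_R, this gives all of them. *)
Definition root_space (psi : hR_dual) : set 'rV[C]_d :=
  [set z | forall t, cbr (hR_elt t) z = (psi t : R)%:C%C *: z].

Definition is_root (psi : hR_dual) : Prop :=
  psi != 0 /\ exists2 z, root_space psi z & z != 0.

Definition compact_root (a : hR_dual) : Prop :=
  is_root a /\ root_space a `<=` complexified k.

Definition noncompact_root (a : hR_dual) : Prop :=
  is_root a /\ root_space a `<=` complexified p.

Definition eps (a : hR_dual) : R := if `[< compact_root a >] then -1 else 1.

Definition positive_system (P : set hR_dual) : Prop :=
  [/\ P `<=` is_root,
      forall a, is_root a -> P a \/ P (- a),
      forall a, ~ (P a /\ P (- a)) &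
      forall a b, P a -> P b -> is_root (a + b) -> P (a + b)].

Definition sgn_root (P : set hR_dual) (a : hR_dual) : R :=
  if `[< P a >] then 1 else -1.

Definition m_root (a : hR_dual) : set 'rV[R]_d :=
  [set x | exists z w, [/\ root_space a z, root_space (- a) w &
                           cplx x = z + w]].

Record root_vectors (tau tau0 : 'rV[C]_d -> 'rV[C]_d) (e : hR_dual -> 'rV[C]_d)
    (Nc : hR_dual -> hR_dual -> R) : Prop := RootVectors {
  rv_mem : forall a, is_root a -> root_space a (e a) ;
  rv_hvec : forall a, is_root a -> cbr (e a) (e (- a)) = hvec a ;
  rv_killing : forall a b, is_root a -> is_root b ->
    killing cbr (e a) (e b) = (a == - b)%:R ;
  rv_br : forall a b, is_root a -> is_root b -> is_root (a + b) ->
    cbr (e a) (e b) = (Nc a b)%:C%C *: e (a + b) ;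
  rv_tau0 : forall a, is_root a -> tau0 (e a) = - e (- a) ;
  rv_tau : forall a, is_root a -> tau (e a) = (eps a)%:C%C *: e (- a) ;
  rv_Nc : forall a b, is_root a -> is_root b -> is_root (a + b) ->
    [/\ Nc a b != 0, Nc b a = - Nc a b, Nc (- a) (- b) = - Nc a b,
        Nc (- b) (a + b) = - Nc a b & Nc (a + b) (- a) = - Nc a b] ;
  rv_Nc0 : forall a b, is_root a -> is_root b -> ~ is_root (a + b) ->
    Nc a b = 0
}.

End Roots.
End RealForm.

Section CanonicalStructures.
Variables (R : realType) (G : TopGroup.type) (d : nat) (c : chart R G d).
Variables (E : 'rV[R]_d -> G) (v : 'rV[R]_d).

Local Notation br := (lie_br c).

Definition v_alg : set 'rV[R]_d := lie_algebra_of E (stabilizer c v).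
Definition m_space : set 'rV[R]_d := orthogonal_of br v_alg.

(* A vector x of [m_space] is the tangent vector [x, v] of the orbit at v. *)
Definition is_KKS (omega : 'rV[R]_d -> 'rV[R]_d -> 'rV[R]_d -> R) : Prop :=
  (forall x y, m_space x -> m_space y ->
     omega v (br x v) (br y v) = killing br v (br x y)) /\
  (forall g w w', orbit_tangent c v w -> orbit_tangent c v w' ->
     omega (Ad c g v) (Ad c g w) (Ad c g w') = omega v w w').

Definition is_canonical_acs (k h0 : {vspace 'rV[R]_d}) (phi : hR_dual h0)
    (P : set (hR_dual h0)) (J : 'rV[R]_d -> 'rV[R]_d -> 'rV[R]_d) : Prop :=
  [/\ forall (a : R) w w', orbit_tangent c v w -> orbit_tangent c v w' ->
        J v (a *: w + w') = a *: J v w + J v w',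
      forall a x, P a -> dual_form br phi a != 0 -> m_root br a x ->
        J v (br x v) =
          br ((eps br k a / dual_form br phi a) *: br v x) v &
      forall g w, orbit_tangent c v w ->
        J (Ad c g v) (Ad c g w) = Ad c g (J v w)].

End CanonicalStructures.

(* Main.v *)
Require Import Defs.
From HB Require Import structures.
From mathcomp Require Import all_boot all_order all_algebra.
From mathcomp Require Import all_classical all_reals all_analysis.
From mathcomp Require Import complex ring lra.

Set Implicit Arguments.
Unset Strict Implicit.
Unset Printing Implicit Defensive.

Import Order.TTheory GRing.Theory Num.Theory.
Import numFieldNormedType.Exports.

Local Open Scope classical_set_scope.
Local Open Scope ring_scope.

(** The homogeneous almost complex structure reduces the computation to the base
    point [v] of the orbit, and the complexified tangent space there has a basis of
    root vectors [e a], [a] running through the roots with [(phi, a) != 0], on which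
    everything is explicit.

    On fundamental fields. For [x] in the Lie algebra the field [r |-> [x, r]] is
    tangent to the orbit, and the derivatives of [r |-> [x, r]] and of
    [r |-> J [x, r]] along such fields are obtained by differentiating the identity
    [J (Ad g q) (Ad g w) = Ad g (J q w)]. When [x'] and [y'] satisfy
    [[x', q] = J [x, q]] and [[y', q] = J [y, q]], this gives ([nijenhuis_fund])

      [4 N ([x, q], [y, q]) = [[x', y'] - [x, y], q] - J [[x', y] + [x, y'], q]].

    Every tangent vector at [q] is of the form [[x, q]], so the formula determines
    [N] and shows that it is equivariant under [Ad] ([N_equivariant]); the squared
    norm is then the same at all points of the orbit ([has_sqnorm_Ad]).

    In root coordinates. The operator [ad v] multiplies [e a] by [i (phi, a)], and
    [J] multiplies it by [i j_a], where [j_a] is [eps_a] times the sign of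
    [(phi, a)] ([cplx_J]). Therefore [N (e a) (e b)] is a multiple of [e (a + b)]
    ([NC_e]), and the metric pairs [e a] with [e (- a)] only ([gC_eN]). As the
    factor in [NC_e] contains [1 + j_a j_b - j_{a+b} (j_a + j_b)], it vanishes
    unless [j_a = j_b = - j_{a+b}]: the tensor [N] vanishes on pairs of vectors of
    different types and maps pairs of vectors of one type, (1,0) or (0,1), to
    vectors of the other type.

    Traces. The squared norm is a double trace, with respect to the metric, of a form
    that is bilinear in both pairs of arguments. Such a trace can be computed in
    any basis and its dual ([bilinear_trace]), hence with the [e a] and the
    multiples [(phi, a) j_a e (- a)] ([onb_norm_N]). The outcome is a sum over
    all ordered pairs of roots [a], [b]. Two facts turn it into the stated formula:
    [eps_{a+b} = - eps_a eps_b] ([epD]), and the symmetry [(a, b) |-> (- a, - b)].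
    Pairs of roots of equal sign give the sum over non-compact roots, where the
    condition on the [j]'s holds as soon as both roots are non-compact; pairs of
    opposite sign give the mixed sum, where the condition fixes the sign of
    [(phi, a - b)], whence the factor [1 + s_{a-b}] ([sum_nterm]).

    The structure theory behind this, that the root spaces are lines and that the
    roots are finitely many, comes from the positive definite form
    [- B (x, theta y)], for which [ad t], [t] in [h0], is skew. The Lie algebra of
    the stabilizer of [v] lies in [k], which makes the centralizer of [h0] equal to
    [h0] ([centralizer_h0]). *)

(** * Differential calculus on row vectors *)

Section FiniteDimCalculus.
Variable R : realType.
Implicit Types V W : normedModType R.

(** The differential is determined by a first order expansion, which only depends on
    the germ of the function. *)
Lemma near_eq_differentiable V W (f g : V -> W) (x : V) :
  {near x, f =1 g} -> differentiable f x -> differentiable g x.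
Proof.
move=> fg df; have [dfc /eqaddoP dfE] := (diff_locallyP x f).1 df.
have gE : g \o shift x = cst (g x) + 'd f x +o_ 0 id.
  apply/eqaddoP => e e0.
  have fg0 : \forall y \near (0 : V), f (y + x) = g (y + x).
    by move: fg; rewrite [X in X -> _](near_shift 0) subr0.
  apply: filterS2 fg0 (dfE e e0) => y /= fgy.
  by rewrite !fctE /= -fgy -(nbhs_singleton fg).
by apply/diff_locallyP; rewrite (diff_unique dfc gE).
Qed.

(** Continuity is read off the coordinate expression of the linear map. *)
Lemma is_diff_rV_linear (m : nat) W (L : {linear 'rV[R]_m -> W}) (x : 'rV[R]_m) :
  is_diff x L L.
Proof.
have LE : (L : _ -> W) = \sum_(k < m) (fun y : 'rV[R]_m => y 0 k *: L (delta_mx 0 k)).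
  apply/funext => y; rewrite fct_sumE {1}(row_sum_delta y) linear_sum.
  by apply: eq_bigr => k _; rewrite linearZ.
have Lc : continuous L.
  move=> y; apply: differentiable_continuous; rewrite LE.
  apply: differentiable_sum => k; apply: differentiableZl.
  exact: differentiable_coord.
by apply: DiffDef; [exact: linear_differentiable|exact: diff_lin].
Qed.

Lemma derive_rV_linear V (m : nat) W (L : {linear 'rV[R]_m -> W})
    (f : V -> 'rV[R]_m) (x u : V) :
  differentiable f x -> is_derive x u (fun y => L (f y)) (L ('D_u f x)).
Proof.
move=> df; have dL := is_diff_rV_linear L (f x).
have dLf : differentiable (L \o f) x by apply: differentiable_comp.
apply: DeriveDef; first exact: diff_derivable.
by rewrite !deriveE // diff_comp //= diff_val.
Qed.

(** The product rule: scaling is a continuous bilinear map. *)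
Lemma differentiable_scale V W (s : V -> R) (F : V -> W) (x : V) :
  differentiable s x -> differentiable F x ->
  differentiable (fun y => s y *: F y) x /\
  forall u, 'D_u (fun y => s y *: F y) x = 'D_u s x *: F x + s x *: 'D_u F x.
Proof.
move=> ds dF.
have bil : bilinear_for (GRing.Scale.Law.clone _ _ *:%R _)
    (GRing.Scale.Law.clone _ _ *:%R _) (fun (a : R) (w : W) => a *: w).
  split=> [u'|u] a y z /=; first by rewrite scalerDl scalerA.
  by rewrite scalerDr !scalerA mulrC.
pose B : {bilinear R -> W -> W} := HB.pack (fun (a : R) (w : W) => a *: w)
  (bilinear_isBilinear.Build R R W W _ _ _ bil).
have Bc : continuous (fun p : R * W => B p.1 p.2) by move=> p; exact: scale_continuous.
have dp := differentiable_pair ds dF.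
have dB := differentiable_bilin (s x, F x) Bc.
have dc : differentiable ((fun p => B p.1 p.2) \o (fun y => (s y, F y))) x.
  exact: differentiable_comp.
split; first exact: dc.
move=> u; rewrite (deriveE u ds) (deriveE u dF).
rewrite -[LHS]/('D_u ((fun p => B p.1 p.2) \o (fun y => (s y, F y))) x).
rewrite deriveE // diff_comp // (diff_bilin _ Bc) diff_pair //=.
by rewrite addrC.
Qed.

Implicit Types k : nat.

Lemma class_CW k V W (U : set V) (f : V -> W) : class_C k.+1 U f -> class_C k U f.
Proof.
elim: k f => [f [df _] x Ux|k IH f [df Df]]; first exact/differentiable_continuous/df.
by split=> // w; exact/IH/Df.
Qed.

(** The open set may shrink around each point: this is how a statement that depends
    on the choice of a chart around a point becomes one about the whole domain. *)
Lemma class_C_local k V W (U : set V) (f : V -> W) :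
  (forall x, U x -> exists U', [/\ open U', U' x & class_C k U' f]) ->
  class_C k U f.
Proof.
elim: k f => [f loc x /loc[U' [_ U'x Cf]]|k IH f loc].
  exact: Cf.
split=> [x /loc[U' [_ U'x [df _]]]|w]; first exact: df.
by apply: IH => x /loc[U' [oU' U'x [_ Df]]]; exists U'; split=> //; exact: Df.
Qed.

Lemma open_near_eq V W (U : set V) (f g : V -> W) x :
  open U -> {in U, f =1 g} -> U x -> {near x, f =1 g}.
Proof.
move=> oU fg Ux; have : \near x, U x by exact: open_nbhs_nbhs.
by apply: filterS => y Uy; apply: fg; rewrite inE.
Qed.

Lemma eq_class_C k V W (U : set V) (f g : V -> W) :
  open U -> {in U, f =1 g} -> class_C k U f -> class_C k U g.
Proof.
move=> oU; elim: k f g => [|k IH] f g fg.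
  move=> Cf x Ux; have := Cf x Ux.
  rewrite /prop_for /continuous_at -(fg x) ?inE //; apply: cvg_trans.
  by apply: near_eq_cvg; exact: open_near_eq fg Ux.
move=> [df Df]; split=> [x Ux|w].
  by apply: near_eq_differentiable (df x Ux); exact: open_near_eq fg Ux.
apply: IH (Df w) => x /set_mem Ux; apply: near_eq_derive.
exact: open_near_eq fg Ux.
Qed.

Lemma class_C_cst k V W (U : set V) (w : W) : class_C k U (fun=> w : W).
Proof.
elim: k w => [w x _|k IH w]; first exact: cst_continuous.
split=> [x _|u]; first exact: differentiable_cst.
have -> : 'D_u (fun=> w : W) = (fun=> 0 : W).
  by apply/funext => x; exact: derive_cst.
exact: IH.
Qed.

Lemma class_C_id k V (U : set V) : class_C k U (id : V -> V).
Proof.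
case: k => [x _|k]; first exact: cvg_id.
split=> [x _|u]; first exact: ex_diff.
have -> : 'D_u (id : V -> V) = fun=> u by apply/funext => x; exact: derive_id.
exact: class_C_cst.
Qed.

Lemma class_CD k V W (U : set V) (f g : V -> W) : open U ->
  class_C k U f -> class_C k U g -> class_C k U (fun x => f x + g x).
Proof.
move=> oU; elim: k f g => [f g Cf Cg x Ux|k IH f g [df Df] [dg Dg]].
  by apply: continuousD; [exact: Cf|exact: Cg].
split=> [x Ux|u]; first by apply: differentiableD; [exact: df|exact: dg].
apply: eq_class_C (IH _ _ (Df u) (Dg u)) => // x /set_mem Ux.
by rewrite -[RHS]/('D_u (f + g) x) deriveD //; apply: diff_derivable;
  [exact: df|exact: dg].
Qed.

Lemma class_C_sum k V W (U : set V) (n : nat) (f : 'I_n -> V -> W) : open U ->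
  (forall i, class_C k U (f i)) -> class_C k U (fun x => \sum_(i < n) f i x).
Proof.
move=> oU; elim: n f => [|n IH] f Cf.
  apply: eq_class_C (class_C_cst k U (0 : W)) => // x _.
  by rewrite big_ord0.
apply: eq_class_C (class_CD oU (IH (fun i => f (widen_ord (leqnSn n) i)) _)
  (Cf ord_max)) => // x _.
by rewrite big_ord_recr.
Qed.

Lemma class_CZ k V W (U : set V) (s : V -> R) (F : V -> W) : open U ->
  class_C k U s -> class_C k U F -> class_C k U (fun x => s x *: F x).
Proof.
move=> oU; elim: k s F => [s F Cs CF x Ux|k IH s F Cs CF].
  by apply: continuousZ; [exact: Cs|exact: CF].
have [[ds Ds] [dF DF]] := (Cs, CF).
split=> [x Ux|u].
  by have [] := differentiable_scale (ds x Ux) (dF x Ux).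
apply: eq_class_C (class_CD oU (IH _ _ (Ds u) (class_CW CF))
  (IH _ _ (class_CW Cs) (DF u))) => // x /set_mem Ux.
by have [_ ->] := differentiable_scale (ds x Ux) (dF x Ux).
Qed.

Lemma class_C_linear k V (m : nat) W (U : set V) (L : {linear 'rV[R]_m -> W})
    (f : V -> 'rV[R]_m) : open U ->
  class_C k U f -> class_C k U (fun x => L (f x)).
Proof.
move=> oU; elim: k f => [f Cf x Ux|k IH f [df Df]].
  have dL := is_diff_rV_linear L (f x).
  by apply: continuous_comp; [exact: Cf|exact: differentiable_continuous].
split=> [x Ux|u].
  have dL := is_diff_rV_linear L (f x).
  by apply: (@differentiable_comp _ _ _ _ f L) => //; exact: df.
apply: eq_class_C (IH _ (Df u)) => // x /set_mem Ux.
by have [_ ->] := derive_rV_linear L u (df x Ux).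
Qed.

Definition coord_rV (m : nat) (i : 'I_m) (x : 'rV[R]_m) : R := x 0 i.
Fact coord_rV_linear m i : linear (@coord_rV m i).
Proof. by move=> a x y; rewrite /coord_rV !mxE. Qed.
HB.instance Definition _ m i := GRing.isLinear.Build R 'rV[R]_m R _ (@coord_rV m i)
  (@coord_rV_linear m i).

(** The chain rule for a function of two row vectors, written with partial
    derivatives: in this form the factors are of the same kind as the function
    that is differentiated, which makes induction on the order possible. *)
Lemma derive_comp_pair V W (m n : nat) (g : 'rV[R]_m * 'rV[R]_n -> W)
    (f1 : V -> 'rV[R]_m) (f2 : V -> 'rV[R]_n) (x u : V) :
  differentiable f1 x -> differentiable f2 x -> differentiable g (f1 x, f2 x) ->
  'D_u (fun y => g (f1 y, f2 y)) x =
    \sum_(i < m) coord_rV i ('D_u f1 x) *: 'D_(delta_mx 0 i, 0) g (f1 x, f2 x) +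
    \sum_(i < n) coord_rV i ('D_u f2 x) *: 'D_(0, delta_mx 0 i) g (f1 x, f2 x).
Proof.
move=> d1 d2 dg; have d12 := differentiable_pair d1 d2.
rewrite -[LHS]/('D_u (g \o (fun y => (f1 y, f2 y))) x).
rewrite deriveE; last exact: differentiable_comp.
rewrite diff_comp //= diff_pair //= -!deriveE //.
set a := 'D_u f1 x; set b := 'D_u f2 x.
rewrite deriveE //.
have -> : (a, b) = \sum_(i < m) a 0 i *: (delta_mx 0 i, 0) +
    \sum_(i < n) b 0 i *: (0, delta_mx 0 i) :> 'rV[R]_m * 'rV[R]_n.
  rewrite [RHS]surjective_pairing /= !raddf_sum /=.
  congr pair.
    rewrite [X in _ + X]big1 ?addr0; first exact: row_sum_delta.
    by move=> i _; rewrite scaler0.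
  rewrite [X in X + _]big1 ?add0r; first exact: row_sum_delta.
  by move=> i _; rewrite scaler0.
rewrite linearD !linear_sum; congr (_ + _); apply: eq_bigr => i _;
  by rewrite linearZ deriveE.
Qed.

Lemma class_C_comp_pair k V W (m n : nat) (U : set V)
    (U' : set ('rV[R]_m * 'rV[R]_n)) (g : 'rV[R]_m * 'rV[R]_n -> W)
    (f1 : V -> 'rV[R]_m) (f2 : V -> 'rV[R]_n) : open U ->
  (forall x, U x -> U' (f1 x, f2 x)) ->
  class_C k U' g -> class_C k U f1 -> class_C k U f2 ->
  class_C k U (fun x => g (f1 x, f2 x)).
Proof.
move=> oU UU'; elim: k g f1 f2 UU' => [|k IH] g f1 f2 UU'.
  move=> Cg C1 C2 x Ux.
  apply: (@continuous2_cvg _ _ _ _ _ _ f1 f2 (fun a b => g (a, b)));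
    [|exact: C1|exact: C2].
  rewrite (_ : (fun z => _) = g); last by apply/funext => -[].
  exact: (Cg _ (UU' x Ux)).
move=> [dg Dg] C1 C2; have [[d1 D1] [d2 D2]] := (C1, C2).
split=> [x Ux|u].
  apply: (@differentiable_comp _ _ _ _ (fun y => (f1 y, f2 y)) g).
    by apply: differentiable_pair; [exact: d1|exact: d2].
  exact/dg/UU'.
pose F x := \sum_(i < m) coord_rV i ('D_u f1 x) *: 'D_(delta_mx 0 i, 0) g (f1 x, f2 x) +
    \sum_(i < n) coord_rV i ('D_u f2 x) *: 'D_(0, delta_mx 0 i) g (f1 x, f2 x).
apply: (@eq_class_C _ _ _ _ F) => // [x /set_mem Ux|].
  by rewrite derive_comp_pair //; [exact: d1|exact: d2|exact/dg/UU'].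
apply: class_CD => //; apply: class_C_sum => // i; apply: class_CZ => //.
- exact: (class_C_linear (@coord_rV m i) oU (D1 u)).
- exact: (IH _ f1 f2 UU' (Dg _) (class_CW C1) (class_CW C2)).
- exact: (class_C_linear (@coord_rV n i) oU (D2 u)).
- exact: (IH _ f1 f2 UU' (Dg _) (class_CW C1) (class_CW C2)).
Qed.

End FiniteDimCalculus.

(** * Charts, and smoothness of the adjoint action *)

Section ChartFacts.
Variables (R : realType) (M : topologicalType) (d : nat).
Implicit Types a : chart R M d.

Lemma chart_imgP a z : chart_img a z -> chart_dom a (chart_inv a z) /\ a (chart_inv a z) = z.
Proof. by case=> x ax <-; rewrite chart_mapK. Qed.

Lemma chart_img_map a x : chart_dom a x -> chart_img a (a x).
Proof. by move=> ax; exists x. Qed.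

Lemma near_chart_img a z : chart_img a z -> \near z, chart_img a z.
Proof. by move=> az; apply: open_nbhs_nbhs; split=> //; exact: chart_img_open. Qed.

Lemma near_chart_dom (T : topologicalType) a (f : T -> M) (t : T) :
  chart_dom a (f t) -> {for t, continuous f} -> \near t, chart_dom a (f t).
Proof.
move=> aft cf; apply: cf; apply: open_nbhs_nbhs; split=> //; exact: chart_dom_open.
Qed.
End ChartFacts.

Section LieGroupTheory.
Variables (R : realType) (G : TopGroup.type) (d : nat).
Variables (A : set (chart R G d)) (HG : lie_group A).
Variables (c : chart R G d) (Ac : A c) (c1 : chart_dom c 1%g).

Local Notation T := 'rV[R]_d.
Local Notation e0 := (c 1%g).
Local Notation br := (lie_br c).

Lemma group_mul_cont (S : topologicalType) (f g : S -> G) (s : S) :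
  {for s, continuous f} -> {for s, continuous g} ->
  {for s, continuous (fun t => (f t * g t)%g)}.
Proof.
move=> cf cg; have [_ _ _ [cm _] _] := HG.
apply: (@continuous2_cvg _ _ _ _ _ _ f g (fun x y => (x * y)%g)) => //.
exact: (cm (f s, g s)).
Qed.

Lemma group_inv_cont (S : topologicalType) (f : S -> G) (s : S) :
  {for s, continuous f} -> {for s, continuous (fun t => (f t)^-1%g)}.
Proof.
move=> cf; have [_ _ _ _ [ci _]] := HG.
by apply: continuous_comp => //; exact: ci.
Qed.

Lemma chart_inv_contP (a : chart R G d) z : chart_img a z -> {for z, continuous (chart_inv a)}.
Proof. exact: chart_inv_cont. Qed.

Lemma chart_img_e0 : chart_img c e0. Proof. exact: chart_img_map. Qed.
Lemma chart_inv_e0 : chart_inv c e0 = 1%g. Proof. exact: chart_mapK. Qed.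

Let mul_dom (a b k : chart R G d) := [set z : T * T |
  [/\ chart_img a z.1, chart_img b z.2 & chart_dom k (chart_inv a z.1 * chart_inv b z.2)%g]].
Let inv_dom (a b : chart R G d) := [set z : T | chart_img a z /\ chart_dom b ((chart_inv a z)^-1)%g].

Lemma mul_dom_open a b k : open (mul_dom a b k).
Proof.
rewrite openE => -[z w] /= [az bw kzw].
have ca := chart_inv_contP az; have cb := chart_inv_contP bw.
have cf : {for (z, w), continuous (fun p : T * T => chart_inv a p.1)}.
  exact: (@continuous_comp _ _ _ (@fst T T) (chart_inv a) (z, w) cvg_fst ca).
have cs : {for (z, w), continuous (fun p : T * T => chart_inv b p.2)}.
  exact: (@continuous_comp _ _ _ (@snd T T) (chart_inv b) (z, w) cvg_snd cb).
have nk := @near_chart_dom R G d _ k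
  (fun p : T * T => chart_inv a p.1 * chart_inv b p.2)%g (z, w) kzw
  (group_mul_cont cf cs).
have na : \forall p \near (z, w), chart_img a p.1.
  by apply: (@cvg_fst _ _ (nbhs z) (nbhs w)); exact: near_chart_img.
have nb : \forall p \near (z, w), chart_img b p.2.
  by apply: (@cvg_snd _ _ (nbhs z) (nbhs w)); exact: near_chart_img.
by apply: filterS3 nk na nb => p; split.
Qed.

Lemma inv_dom_open a b : open (inv_dom a b).
Proof.
rewrite openE => z [az bz].
have nb := @near_chart_dom R G d _ b (fun y => (chart_inv a y)^-1)%g z bz
  (group_inv_cont (chart_inv_contP az)).
by apply: filterS2 nb (near_chart_img az) => y; split.
Qed.

Lemma mul_smooth a b k : A a -> A b -> A k ->
  smooth_on (mul_dom a b k) (fun z => k (chart_inv a z.1 * chart_inv b z.2)%g).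
Proof. by have [_ _ _ [_ +] _] := HG; apply. Qed.

Lemma inv_smooth a b : A a -> A b ->
  smooth_on (inv_dom a b) (fun z => b ((chart_inv a z)^-1)%g).
Proof. by have [_ _ _ _ [_ +]] := HG; apply. Qed.

Lemma chart_at (g : G) : exists2 a, A a & chart_dom a g.
Proof. by have [_ _ [+ _] _ _] := HG; apply. Qed.

Definition conj_chart (g : G) (z : T) : T := c (g * chart_inv c z * g^-1)%g.

(** Fix charts [a] around [g] and [b] around [g^-1]. Conjugation by [g] is the
    composite of [mu1], a multiplication [(g, h) |-> g h] read in [a] and [c], with
    [mu2], the multiplication by [g^-1], and is thus a composite of maps whose
    smoothness is part of the definition of a Lie group. *)
Section AdInChart.
Variables (a b : chart R G d) (Aa : A a) (Ab : A b).
Let mu1 (p : T * T) := a (chart_inv a p.1 * chart_inv c p.2)%g.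
Let mu2 (p : T * T) := c (chart_inv a p.1 * chart_inv b p.2)%g.
Let nu (z : T) := b ((chart_inv a z)^-1)%g.

Lemma mul_dom_unit z : inv_dom a b z -> mul_dom a c a (z, e0).
Proof.
move=> [az bz]; have [az1 az2] := chart_imgP az.
by split; [|exact: chart_img_e0|rewrite /= chart_inv_e0 mulg1].
Qed.

Lemma mul_dom_inv z : inv_dom a b z -> mul_dom a b c (z, nu z).
Proof.
move=> [az bz]; split=> //=; first exact: chart_img_map.
by rewrite chart_mapK // mulgV.
Qed.

Lemma mu1_unit z : inv_dom a b z -> mu1 (z, e0) = z.
Proof. by move=> [/chart_imgP[_ az] _]; rewrite /mu1 /= chart_inv_e0 mulg1. Qed.

Lemma conj_chartE z : inv_dom a b z ->
  \forall w \near e0, mu2 (mu1 (z, w), nu z) = conj_chart (chart_inv a z) w.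
Proof.
move=> az.
have : \forall w \near e0, mul_dom a c a (z, w).
  have : nbhs (z, e0) (mul_dom a c a).
    by apply: open_nbhs_nbhs; split; [exact: mul_dom_open|exact: mul_dom_unit].
  have : {for e0, continuous (fun w : T => (z, w))}.
    exact/differentiable_continuous/differentiable_pair.
  by apply.
apply: filterS => w [_ _ aw]; have [_ bz] := az.
by rewrite /mu2 /mu1 /nu /conj_chart /= !chart_mapK.
Qed.

Lemma differentiable_conj_chart z : inv_dom a b z ->
  differentiable (conj_chart (chart_inv a z)) e0.
Proof.
move=> az; apply: near_eq_differentiable (conj_chartE az) _.
have [d1 _] := mul_smooth Aa Ac Aa 1%N.
have [d2 _] := mul_smooth Aa Ab Ac 1%N.
apply: (@differentiable_comp _ _ _ _ (fun w => (mu1 (z, w), nu z)) mu2).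
  apply: differentiable_pair; last exact: differentiable_cst.
  apply: (@differentiable_comp _ _ _ _ (fun w => (z, w)) mu1).
    by apply: differentiable_pair.
  by apply: d1; exact: mul_dom_unit.
by apply: d2; rewrite mu1_unit //; exact: mul_dom_inv.
Qed.

(** The chain rule expresses [Ad g x] by partial derivatives of [mu1] and [mu2], taken
    at points that depend smoothly on [g]. *)
Lemma Ad_chartE z x : inv_dom a b z ->
  Ad c (chart_inv a z) x =
  \sum_(i < d) coord_rV i (\sum_(j < d) coord_rV j x *: 'D_(0, delta_mx 0 j) mu1 (z, e0)) *:
     'D_(delta_mx 0 i, 0) mu2 (z, nu z).
Proof.
move=> az; have [d1 _] := mul_smooth Aa Ac Aa 1%N.
have [d2 _] := mul_smooth Aa Ab Ac 1%N.
have dm1 : differentiable mu1 (z, e0) by apply: d1; exact: mul_dom_unit.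
have dm2 : differentiable mu2 (z, nu z) by apply: d2; exact: mul_dom_inv.
have dcz : differentiable (fun w : T => (z, w)) e0 by apply: differentiable_pair.
have dmz : differentiable (fun w => mu1 (z, w)) e0.
  exact: (@differentiable_comp _ _ _ _ (fun w => (z, w)) mu1).
rewrite -[LHS]/('D_x (conj_chart (chart_inv a z)) e0).
rewrite -(near_eq_derive x (conj_chartE az)).
rewrite (@derive_comp_pair _ _ _ _ _ mu2 (fun w => mu1 (z, w)) (fun=> nu z)) //; last first.
  by rewrite mu1_unit.
rewrite mu1_unit // [X in _ + X]big1 ?addr0; last first.
  by move=> i _; rewrite derive_cst linear0 scale0r.
apply: eq_bigr => i _; congr (coord_rV i _ *: _).
rewrite (@derive_comp_pair _ _ _ _ _ mu1 (fun=> z) id) //.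
rewrite [X in X + _]big1 ?add0r; last first.
  by move=> j _; rewrite derive_cst linear0 scale0r.
by apply: eq_bigr => j _; rewrite derive_id.
Qed.

Lemma smooth_Ad_loc x : smooth_on (inv_dom a b) (fun z => Ad c (chart_inv a z) x).
Proof.
move=> k; have oU := @inv_dom_open a b.
have [_ D1] := mul_smooth Aa Ac Aa k.+1.
have [_ D2] := mul_smooth Aa Ab Ac k.+1.
pose F z := \sum_(i < d)
  coord_rV i (\sum_(j < d) coord_rV j x *: 'D_(0, delta_mx 0 j) mu1 (z, e0)) *:
     'D_(delta_mx 0 i, 0) mu2 (z, nu z).
apply: (@eq_class_C _ _ _ _ _ F) => // [z /set_mem az|]; first by rewrite Ad_chartE.
apply: class_C_sum => // i; apply: class_CZ => //.
  apply: (class_C_linear (@coord_rV R d i)) => //.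
  apply: class_C_sum => // j; apply: class_CZ => //; first exact: class_C_cst.
  apply: (@class_C_comp_pair _ _ _ _ _ _ _ (mul_dom a c a) ('D_(0, delta_mx 0 j) mu1)
    id (fun=> e0)) => //.
  - by move=> z az; exact: mul_dom_unit.
  - exact: D1.
  - exact: class_C_id.
  - exact: class_C_cst.
apply: (@class_C_comp_pair _ _ _ _ _ _ _ (mul_dom a b c) ('D_(delta_mx 0 i, 0) mu2)
    id nu) => //.
- by move=> z az; exact: mul_dom_inv.
- exact: D2.
- exact: class_C_id.
- exact: inv_smooth.
Qed.
End AdInChart.

Lemma inv_dom_at a z : chart_img a z -> exists2 b, A b & inv_dom a b z.
Proof.
by move=> az; have [b Ab bz] := chart_at (chart_inv a z)^-1%g; exists b.
Qed.

(** [Ad g] is the partial derivative in [h], at the unit, of the smooth map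
    [(g, h) |-> g h g^-1]. *)
Lemma smooth_Ad a x : A a -> smooth_on (chart_img a) (fun z => Ad c (chart_inv a z) x).
Proof.
move=> Aa k; apply: class_C_local => z /inv_dom_at[b Ab az].
by exists (inv_dom a b); split; [exact: inv_dom_open| |exact: smooth_Ad_loc].
Qed.

Lemma conj_chart_diff g : differentiable (conj_chart g) e0.
Proof.
have [a Aa ag] := chart_at g.
have [b Ab az] := inv_dom_at (chart_img_map ag).
by have := differentiable_conj_chart Aa Ab az; rewrite chart_mapK.
Qed.

Fact Ad_linear g : linear (Ad c g).
Proof.
have E x : Ad c g x = 'd (conj_chart g) e0 x by exact/deriveE/conj_chart_diff.
by move=> k x y; rewrite !E linearP.
Qed.

Lemma conj_chart_e0 g : conj_chart g e0 = e0.
Proof. by rewrite /conj_chart chart_inv_e0 mulg1 mulgV. Qed.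

Lemma near_conj_dom g : \forall z \near e0, chart_dom c (g * chart_inv c z * g^-1)%g.
Proof.
apply: (@near_chart_dom R G d _ c (fun z => (g * chart_inv c z * g^-1)%g)).
  by rewrite chart_inv_e0 mulg1 mulgV.
apply: group_mul_cont; last exact: cst_continuous.
apply: group_mul_cont; first exact: cst_continuous.
exact/chart_inv_contP/chart_img_e0.
Qed.

Lemma chart_inv_conj g :
  \forall z \near e0, chart_inv c (conj_chart g z) = (g * chart_inv c z * g^-1)%g.
Proof.
by apply: filterS (near_conj_dom g) => z gz; rewrite /conj_chart chart_mapK.
Qed.

(** The chain rule, for conjugation by [h] followed by conjugation by [g]. *)
Lemma AdM g h x : Ad c (g * h)%g x = Ad c g (Ad c h x).
Proof.
have gh : \forall z \near e0, (conj_chart g \o conj_chart h) z = conj_chart (g * h)%g z.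
  apply: filterS (chart_inv_conj h) => z hz /=.
  by rewrite {1}/conj_chart hz /conj_chart invgM !mulgA.
rewrite -[LHS]/('D_x (conj_chart (g * h)%g) e0) -(near_eq_derive x gh).
have dg := conj_chart_diff g; have dh := conj_chart_diff h.
rewrite deriveE; last by apply: differentiable_comp; rewrite ?conj_chart_e0.
rewrite diff_comp ?conj_chart_e0 //=.
by rewrite -!deriveE.
Qed.

Lemma Ad1 x : Ad c 1%g x = x.
Proof.
have h : \forall z \near e0, id z = conj_chart 1%g z.
  apply: filterS (near_chart_img chart_img_e0) => z /chart_imgP[_ cz].
  by rewrite /conj_chart invg1 mulg1 mul1g.
by rewrite -[LHS]/('D_x (conj_chart 1%g) e0) -(near_eq_derive x h) derive_id.
Qed.

Lemma AdK g x : Ad c g^-1%g (Ad c g x) = x.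
Proof. by rewrite -AdM mulVg Ad1. Qed.

Lemma AdVK g x : Ad c g (Ad c g^-1%g x) = x.
Proof. by rewrite -AdM mulgV Ad1. Qed.

End LieGroupTheory.

(** * The Lie algebra of a Lie group *)

Record lie_bracket (F : fieldType) (d : nat) (b : 'rV[F]_d -> 'rV[F]_d -> 'rV[F]_d) : Prop :=
  LieBracket {
    lbL : forall y, linear (b ^~ y) ;
    lbR : forall x, linear (b x) ;
    lbxx : forall x, b x x = 0 ;
    lbJ : forall x y z, b x (b y z) = b (b x y) z + b y (b x z)
  }.

Lemma linear_on0 (F : fieldType) (U V : lmodType F) (L : U -> V) : linear L -> L 0 = 0.
Proof. by move=> lL; have := lL (-1) 0 0; rewrite scaler0 addr0 scaleN1r addNr. Qed.

Lemma is_derive_recenter (R : realType) (W : normedModType R) (h : R -> W) (t : R) (w : W) :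
  is_derive (0 : R) 1 h w -> is_derive t 1 (fun s => h (s - t)) w.
Proof.
move=> [dh <-]; have ds : differentiable (fun s : R => s - t) t by apply: differentiableB.
have dh' : differentiable h (t - t) by rewrite subrr; apply/derivable1_diffP.
have dhs : differentiable (h \o (fun s => s - t)) t by exact: differentiable_comp.
apply: DeriveDef; first by apply: diff_derivable.
rewrite -[LHS]/('D_1 (h \o (fun s => s - t)) t) (deriveE (1 : R) dhs) diff_comp //=.
rewrite -(deriveE (1 : R) ds) subrr deriveB // derive_id derive_cst subr0.
by rewrite deriveE //; apply/derivable1_diffP.
Qed.

Section LieAlgebraOfGroup.
Variables (R : realType) (G : TopGroup.type) (d : nat).
Variables (A : set (chart R G d)) (HG : lie_group A).
Variables (c : chart R G d) (Ac : A c) (c1 : chart_dom c 1%g).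

Local Notation T := 'rV[R]_d.
Local Notation e0 := (c 1%g).
Local Notation br := (lie_br c).

Lemma derive_linear_post (V : normedModType R) (L : T -> T) (f : V -> T) (x u : V) :
  linear L -> differentiable f x ->
  is_derive x u (fun y => L (f y)) (L ('D_u f x)).
Proof.
move=> lL; pose L' : {linear T -> T} := HB.pack L (GRing.isLinear.Build R T T _ L lL).
exact: (derive_rV_linear L').
Qed.

Lemma Ad_diff x : differentiable (fun z => Ad c (chart_inv c z) x) e0.
Proof.
have [d1 _] := smooth_Ad HG Ac c1 x Ac 1%N.
by apply: d1; exact: chart_img_e0.
Qed.

Lemma lie_brR x : linear (br x).
Proof.
move=> k y y'; rewrite /lie_br.
have -> : (fun z => Ad c (chart_inv c z) (k *: y + y')) =
   k \*: (fun z => Ad c (chart_inv c z) y) + (fun z => Ad c (chart_inv c z) y').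
  by apply/funext => z; rewrite (Ad_linear HG Ac c1).
have dy := @diff_derivable _ _ _ _ _ x (Ad_diff y).
have dy' := @diff_derivable _ _ _ _ _ x (Ad_diff y').
by rewrite (deriveD (@derivableZ _ _ _ _ k _ _ dy) dy') (deriveZ k dy).
Qed.

Lemma lie_brL y : linear (br ^~ y).
Proof.
move=> k x x'; rewrite /lie_br !(deriveE _ (Ad_diff y)).
exact: linearP.
Qed.

(** The product rule for the application of [Ad g] to a vector that depends on [g]:
    the vector is expanded on the standard basis. *)
Lemma derive_Ad_app (w : T -> T) u : differentiable w e0 ->
  is_derive e0 u (fun z => Ad c (chart_inv c z) (w z)) (br u (w e0) + 'D_u w e0).
Proof.
move=> dw; pose Lc (k : 'I_d) := @coord_rV R d k.
have dLw k : is_derive e0 u (fun z => Lc k (w z)) (Lc k ('D_u w e0)).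
  exact: (derive_rV_linear (@coord_rV R d k)).
have dLw' k : differentiable (fun z => Lc k (w z)) e0.
  have dL := is_diff_rV_linear (@coord_rV R d k) (w e0).
  exact: (@differentiable_comp _ _ _ _ w (@coord_rV R d k)).
pose f k z := Lc k (w z) *: Ad c (chart_inv c z) (delta_mx 0 k).
have linE (L : T -> T) x : linear L -> L x = \sum_(k < d) Lc k x *: L (delta_mx 0 k).
  move=> lL; pose L' : {linear T -> T} := HB.pack L (GRing.isLinear.Build R T T _ L lL).
  rewrite -[L x]/(L' x) {1}(row_sum_delta x) linear_sum.
  by apply: eq_bigr => k _; rewrite linearZ.
have -> : (fun z => Ad c (chart_inv c z) (w z)) = \sum_(k < d) f k.
  apply/funext => z; rewrite fct_sumE (linE (Ad c (chart_inv c z))) //.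
  exact: (Ad_linear HG Ac c1).
apply: is_derive_eq (is_derive_sum (dh := fun k =>
   Lc k ('D_u w e0) *: delta_mx 0 k + Lc k (w e0) *: br u (delta_mx 0 k)) _) _.
  move=> k; have [df DE] := differentiable_scale (dLw' k) (Ad_diff (delta_mx 0 k)).
  apply: DeriveDef; first exact: diff_derivable.
  rewrite DE; have [_ ->] := dLw k.
  by rewrite chart_inv_e0 // (Ad1 c1).
rewrite big_split /= addrC -(linE (br u)) //; last exact: lie_brR.
by congr (_ + _); rewrite [RHS](row_sum_delta ('D_u w e0)).
Qed.

(** Differentiate [Ad (g h g^-1) (Ad g y) = Ad g (Ad h y)] with respect to [h] at the
    unit. *)
Lemma Ad_br g x y : br (Ad c g x) (Ad c g y) = Ad c g (br x y).
Proof.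
pose F z := Ad c (chart_inv c z) (Ad c g y).
have near_eq : \forall z \near e0, (F \o conj_chart c g) z = Ad c g (Ad c (chart_inv c z) y).
  apply: filterS (chart_inv_conj HG c1 g) => z cz.
  by rewrite /F /= cz !(AdM HG Ac c1) (AdK HG Ac c1).
have [_ <-] := derive_linear_post x (Ad_linear HG Ac c1 g) (Ad_diff y).
rewrite -(near_eq_derive x near_eq).
have dF : differentiable F e0 by exact: Ad_diff.
have dc := conj_chart_diff HG Ac c1 g.
have ce := conj_chart_e0 c1 g.
rewrite deriveE; last by apply: differentiable_comp; rewrite ?ce.
by rewrite diff_comp ?ce //= -!deriveE.
Qed.

(** Differentiate [Ad h (Ad h^-1 x) = x] with the product rule. *)
Lemma derive_Ad_inv x u :
  differentiable (fun z => Ad c ((chart_inv c z)^-1)%g x) e0 /\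
  'D_u (fun z => Ad c ((chart_inv c z)^-1)%g x) e0 = - br u x.
Proof.
pose iota z := c ((chart_inv c z)^-1)%g.
have ce0 : chart_img c e0 by exact: chart_img_e0.
have ie0 : chart_img c e0 /\ chart_dom c (chart_inv c e0)^-1%g.
  by split=> //; rewrite chart_inv_e0 // invg1.
have di : differentiable iota e0 by have [di _] := inv_smooth HG Ac Ac 1%N; exact: di.
have iE : iota e0 = e0 by rewrite /iota chart_inv_e0 // invg1.
have ne : \forall z \near e0,
    ((fun z => Ad c (chart_inv c z) x) \o iota) z = Ad c ((chart_inv c z)^-1)%g x.
  have : \forall z \near e0, chart_img c z /\ chart_dom c (chart_inv c z)^-1%g.
    by apply: open_nbhs_nbhs; split=> //; exact: (inv_dom_open HG).
  by apply: filterS => z [_ zc] /=; rewrite /iota chart_mapK.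
have dG : differentiable (fun z => Ad c ((chart_inv c z)^-1)%g x) e0.
  apply: near_eq_differentiable ne _; apply: differentiable_comp => //.
  by rewrite iE; exact: Ad_diff.
split=> //; have [_] := derive_Ad_app u dG.
have -> : (fun z => Ad c (chart_inv c z) (Ad c (chart_inv c z)^-1%g x)) = cst x.
  by apply/funext => z; rewrite (AdVK HG Ac c1).
rewrite derive_cst chart_inv_e0 // invg1 (Ad1 c1) => /esym/eqP.
by rewrite addrC addr_eq0 => /eqP.
Qed.

Lemma AdE g x : Ad c g x = 'D_x (conj_chart c g) e0.
Proof. by []. Qed.

Lemma lie_brE x y : br x y = 'D_x (fun z => Ad c (chart_inv c z) y) e0.
Proof. by []. Qed.

Local Opaque Ad lie_br.

(** Differentiate [Ad g [x, Ad g^-1 y] = [Ad g x, y]] at the unit. *)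
Lemma lie_br_jacobi u x y : br u (br x y) = br (br u x) y + br x (br u y).
Proof.
pose f z := br x (Ad c ((chart_inv c z)^-1)%g y).
have [di De] := derive_Ad_inv y u.
have [df Df] := derive_linear_post u (lie_brR x) di.
have lf : linear (br x) := lie_brR x.
have dff : differentiable f e0.
  pose L : {linear T -> T} := HB.pack (br x) (GRing.isLinear.Build R T T _ (br x) lf).
  have dL := is_diff_rV_linear L (Ad c ((chart_inv c e0)^-1)%g y).
  exact: (@differentiable_comp _ _ _ _ (fun z => Ad c ((chart_inv c z)^-1)%g y) L).
have [_] := derive_Ad_app u dff.
have -> : (fun z => Ad c (chart_inv c z) (f z)) = (fun z => br (Ad c (chart_inv c z) x) y).
  apply/funext => z; rewrite /f -(Ad_br (chart_inv c z) x).
  by congr (br _ _); rewrite (AdVK HG Ac c1).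
have [_ Dl] := @derive_linear_post _ (br ^~ y) _ _ u (lie_brL y) (Ad_diff x).
move=> h; have {h Dl} := etrans (esym Dl) h.
rewrite -(lie_brE u x).
rewrite Df De /f (chart_inv_e0 c1) invg1 (Ad1 c1).
have lN z : br x (- z) = - br x z.
  by have := lf (-1) z 0; rewrite !scaleN1r !addr0 (linear_on0 lf) addr0.
have solve (p q r : T) : p = q - r -> q = p + r by move=> ->; rewrite subrK.
by rewrite lN; exact: solve.
Qed.

Section Exponential.
Variables (E : T -> G) (HE : is_exponential c E).

Lemma exp0 x : E (0 *: x) = 1%g.
Proof.
have [_ /(_ 0 0) + _] := HE x; rewrite addr0 => h.
by apply: (@mulgI _ (E (0 *: x))); rewrite mulg1 -h.
Qed.

Lemma derive_chart_exp (W : normedModType R) (f : T -> W) x : differentiable f e0 ->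
  is_derive (0 : R) 1 (fun t => f (c (E (t *: x)))) ('D_x f e0).
Proof.
have [_ _ [dE DE]] := HE x => df.
have dcE : differentiable (fun t : R => c (E (t *: x))) 0 by apply/derivable1_diffP.
have cE0 : c (E (0 *: x)) = e0 by rewrite exp0.
have dc : differentiable (f \o (fun t : R => c (E (t *: x)))) 0.
  by apply: differentiable_comp => //; rewrite cE0.
apply: DeriveDef; first exact: diff_derivable.
rewrite (deriveE (1 : R) dc) diff_comp ?cE0 //= -(deriveE (1 : R) dcE) DE.
by rewrite -(deriveE x df).
Qed.

Lemma near_exp_dom x : \forall t \near (0 : R), chart_dom c (E (t *: x)).
Proof.
have [cE _ _] := HE x.
apply: (@near_chart_dom R G d _ c (fun t : R => E (t *: x))); last exact: cE.
by rewrite exp0.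
Qed.

Lemma derive_Ad_exp0 x y : is_derive (0 : R) 1 (fun t => Ad c (E (t *: x)) y) (br x y).
Proof.
apply: near_eq_is_derive (derive_chart_exp x (Ad_diff y)).
by apply: filterS (near_exp_dom x) => t tx; rewrite chart_mapK.
Qed.

(** The one-parameter group property moves the derivative at [t] to the one at [0]. *)
Lemma derive_Ad_exp x y (t : R) :
  is_derive t 1 (fun t => Ad c (E (t *: x)) y) (Ad c (E (t *: x)) (br x y)).
Proof.
have [d0 D0] := derive_Ad_exp0 x y.
have d0' : differentiable (fun t : R => Ad c (E (t *: x)) y) 0 by apply/derivable1_diffP.
pose h s := Ad c (E (t *: x)) (Ad c (E (s *: x)) y).
have dh : is_derive (0 : R) 1 h (Ad c (E (t *: x)) (br x y)).
  apply: is_derive_eq (derive_linear_post (1 : R) (Ad_linear HG Ac c1 _) d0') _.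
  exact: (f_equal (Ad c (E (t *: x))) D0).
have hE : (fun t => Ad c (E (t *: x)) y) = (fun s => h (s - t)).
  apply/funext => s; rewrite /h -(AdM HG Ac c1).
  by have [_ <- _] := HE x; rewrite addrC subrK.
by rewrite hE; exact: is_derive_recenter.
Qed.

(** The one-parameter group of [x] is commutative, so it fixes its own
    velocity [x]. *)
Lemma lie_brxx x : br x x = 0.
Proof.
have fix_x t : Ad c (E (t *: x)) x = x.
  have [_ EM [_ DE]] := HE x.
  rewrite AdE; have [_ <-] := derive_chart_exp x (conj_chart_diff HG Ac c1 (E (t *: x))).
  rewrite -[RHS]DE; apply: near_eq_derive.
  apply: filterS (near_exp_dom x) => s sx; rewrite /conj_chart chart_mapK //.
  by rewrite -EM addrC EM mulgK.
have [_ <-] := derive_Ad_exp0 x x.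
by under eq_fun do rewrite fix_x; rewrite derive_cst.
Qed.

(** The curve [t |-> Ad (E (t x)) v] has derivative [Ad (E (t x)) [x, v]], so it is
    constant exactly when [[x, v] = 0]. *)
Lemma v_algP v x : v_alg c E v x <-> br x v = 0.
Proof.
split=> [vx|xv t].
  have [_ <-] := derive_Ad_exp0 x v.
  rewrite (_ : (fun t => _) = cst v); first by rewrite derive_cst.
  by apply/funext => t; exact: vx.
have dz (s : R) : is_derive s 1 (fun t => Ad c (E (t *: x)) v) 0.
  apply: is_derive_eq (derive_Ad_exp x v s) _; rewrite xv.
  exact: (linear_on0 (Ad_linear HG Ac c1 (E (s *: x)))).
rewrite /stabilizer /=; apply/rowP => i.
pose f (t : R) := coord_rV i (Ad c (E (t *: x)) v).
have df (s : R) : is_derive s 1 f 0.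
  have [d0 D0] := dz s.
  have d0' : differentiable (fun t : R => Ad c (E (t *: x)) v) s by apply/derivable1_diffP.
  have := derive_rV_linear (@coord_rV R d i) (1 : R) d0'.
  by rewrite D0 linear0.
have := is_derive_0_is_cst t 0 df.
by rewrite /f exp0 (Ad1 c1).
Qed.

Lemma lie_br_lie : lie_bracket br.
Proof.
split; [exact: lie_brL|exact: lie_brR|exact: lie_brxx|exact: lie_br_jacobi].
Qed.

End Exponential.
End LieAlgebraOfGroup.

(** * Algebra of a Lie bracket *)

Section AbstractLie.
Variables (F : fieldType) (d : nat) (b : 'rV[F]_d -> 'rV[F]_d -> 'rV[F]_d).
Hypothesis lb : lie_bracket b.
Implicit Types x y z : 'rV[F]_d.

Lemma lb0r x : b x 0 = 0. Proof. exact/linear_on0/(lbR lb). Qed.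
Lemma lb0l x : b 0 x = 0. Proof. exact: (linear_on0 (lbL lb x)). Qed.
Lemma lbDr x y z : b x (y + z) = b x y + b x z.
Proof. by have := lbR lb x 1 y z; rewrite !scale1r. Qed.
Lemma lbDl x y z : b (x + y) z = b x z + b y z.
Proof. by have := lbL lb z 1 x y; rewrite !scale1r. Qed.
Lemma lbZr k x y : b x (k *: y) = k *: b x y.
Proof. by have := lbR lb x k y 0; rewrite !addr0 lb0r addr0. Qed.
Lemma lbZl k x y : b (k *: x) y = k *: b x y.
Proof. by have := lbL lb y k x 0; rewrite !addr0 /= lb0l addr0. Qed.
Lemma lbNr x y : b x (- y) = - b x y.
Proof. by rewrite -scaleN1r lbZr scaleN1r. Qed.
Lemma lbNl x y : b (- x) y = - b x y.
Proof. by rewrite -scaleN1r lbZl scaleN1r. Qed.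
Lemma lbBl x y z : b (x - y) z = b x z - b y z.
Proof. by rewrite lbDl lbNl. Qed.
Lemma lbC x y : b x y = - b y x.
Proof.
apply/eqP; rewrite -addr_eq0; apply/eqP.
by have := lbxx lb (x + y); rewrite lbDl !lbDr !(lbxx lb) add0r addr0.
Qed.
Lemma lb_sumr x I (r : seq I) (P : pred I) f :
  b x (\sum_(i <- r | P i) f i) = \sum_(i <- r | P i) b x (f i).
Proof. by elim/big_rec2: _ => [|i y z _ <-]; rewrite ?lb0r ?lbDr. Qed.
(** The derivative of [J] along the orbit does not depend on the vector [y0] that
    represents the direction: [y0 - y] stabilizes the point, and [M] commutes with
    it. *)
Lemma stab_algebra (M : 'rV[F]_d -> 'rV[F]_d) x y y0 : linear M ->
  b (y0 - y) (M x) = M (b (y0 - y) x) ->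
  b y0 (M x) + M (- b y0 x) = b y (M x) - M (b y x).
Proof.
move=> lM; have MB u w : M (u - w) = M u - M w.
  by rewrite addrC -scaleN1r lM scaleN1r addrC.
have MN u : M (- u) = - M u by rewrite -sub0r MB (linear_on0 lM) sub0r.
rewrite !lbBl MB MN => h; apply/rowP => i; move/rowP: h => /(_ i).
rewrite !mxE => /eqP; rewrite -subr_eq0 => /eqP h; apply/eqP; rewrite -subr_eq0 -h; apply/eqP; ring.
Qed.

(** The Nijenhuis bracket of the fundamental fields [r |-> [x, r]] and
    [r |-> [y, r]] at [q], from the derivatives of these fields and of their
    images under [J]. Here [x'] and [y'] represent [J [x, q]] and [J [y, q]]. *)
Lemma nijenhuis_algebra (J : 'rV[F]_d -> 'rV[F]_d) q x y x' y' :
  linear (fun u => J (b u q)) -> (forall u, J (J (b u q)) = - b u q) ->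
  b x' (b y' q) - J (b (b x' y) q) - (b y' (b x' q) - J (b (b y' x) q))
  - J (b y (b x' q) - (b y (b x' q) - J (b (b y x) q)))
  - J (b x (b y' q) - J (b (b x y) q) - b x (b y' q))
  - (b y (b x q) - b x (b y q)) =
  b (b x' y' - b x y) q - J (b (b x' y + b x y') q).
Proof.
move=> Jl JJ; pose M u := J (b u q).
have M0 : M 0 = 0 by exact: (linear_on0 Jl).
have MZ k u : M (k *: u) = k *: M u by have := Jl k u 0; rewrite -!/(M _) M0 !addr0.
have MN u : M (- u) = - M u by rewrite -scaleN1r MZ scaleN1r.
have MD u w : M (u + w) = M u + M w by have := Jl 1 u w; rewrite -!/(M _) !scale1r.
have JM : J (- M (b x y)) = b (b x y) q.
  by rewrite -MN JJ lbNl opprK.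
have Jac z w : b (b z w) q = b z (b w q) - b w (b z q) by rewrite (lbJ lb z) addrK.
rewrite subKr [b y x]lbC -[J (b (- b x y) q)]/(M _) MN JM.
rewrite [X in J (X - _)]addrC addrK JM [b y' x]lbC lbBl lbDl.
rewrite -[J (b (- _) q)]/(M _) -[J (b (b x' y) q)]/(M _) MN -lbDl -[J _]/(M _) MD !Jac.
by apply/rowP => i; rewrite !mxE; ring.
Qed.
End AbstractLie.

(** * The Nijenhuis tensor on fundamental fields *)

Section Nijenhuis.
Variables (R : realType) (G : TopGroup.type) (d : nat).
Variables (A : set (chart R G d)) (HG : lie_group A).
Variables (c : chart R G d) (Ac : A c) (c1 : chart_dom c 1%g).
Variables (E : 'rV[R]_d -> G) (HE : is_exponential c E).

Local Notation T := 'rV[R]_d.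
Local Notation e0 := (c 1%g).
Local Notation br := (lie_br c).
Local Opaque Ad lie_br.

Let lb : lie_bracket br := lie_br_lie HG Ac c1 HE.

Variables (v : T) (J : T -> T -> T).
Hypothesis Jinv : forall g q w, orbit_of c v q -> orbit_tangent c q w ->
  J (Ad c g q) (Ad c g w) = Ad c g (J q w).
Hypothesis Jlin : forall q (a : R) w w', orbit_of c v q ->
  orbit_tangent c q w -> orbit_tangent c q w' ->
  J q (a *: w + w') = a *: J q w + J q w'.
Hypothesis JJ : forall q w, orbit_of c v q -> orbit_tangent c q w ->
  J q (J q w) = - w.

Lemma orbit_tangent_br q x : orbit_tangent c q (br x q). Proof. by exists x. Qed.

Lemma Jbr_linear q : orbit_of c v q -> linear (fun x => J q (br x q)).
Proof.
move=> vq a x y; rewrite -Jlin //; try exact: orbit_tangent_br.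
by rewrite (lbDl lb) (lbZl lb).
Qed.

(** [J] commutes with the stabilizer of [q], hence with its Lie algebra. *)
Lemma J_stab q s x : orbit_of c v q -> br s q = 0 ->
  br s (J q (br x q)) = J q (br (br s x) q).
Proof.
move=> vq /(v_algP HG Ac c1 HE) sq.
have [_ D1] := derive_Ad_exp0 HG Ac c1 HE s (J q (br x q)).
have [d2 D2] := derive_Ad_exp0 HG Ac c1 HE s x.
have d2' : differentiable (fun t : R => Ad c (E (t *: s)) x) 0 by apply/derivable1_diffP.
have [_ D3] := derive_linear_post (1 : R) (Jbr_linear vq) d2'.
have stab t : Ad c (E (t *: s)) (J q (br x q)) = J q (br (Ad c (E (t *: s)) x) q).
  set g := E _; have gq : Ad c g q = q := sq t.
  apply: etrans (esym (Jinv g vq (orbit_tangent_br q x))) _.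
  apply: etrans (f_equal2 J gq (esym (Ad_br HG Ac c1 g x q))) _.
  exact: (f_equal (fun r => J q (br (Ad c g x) r)) gq).
apply: etrans (esym D1) _.
apply: etrans (f_equal (fun f : R -> T => 'D_1 f (0 : R)) (funext stab)) _.
move: D3 => /= D3.
refine (etrans D3 _).
exact (f_equal (fun z => J q (br z q)) D2).
Qed.

Definition fund_field (x r : T) : T := br x r.

Lemma fund_field_smooth x : smooth_vector_field c A v (fund_field x).
Proof.
split=> [q _|a Aa k]; first exact: orbit_tangent_br.
pose L : {linear T -> T} := HB.pack (br x) (GRing.isLinear.Build R T T _ (br x) (lbR lb x)).
apply: (class_C_linear L); first exact: chart_img_open.
exact: (smooth_Ad HG Ac c1).
Qed.

Lemma orbit_deriv_fund y q w : orbit_tangent c q w ->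
  orbit_deriv c (fund_field y) q w = br y w.
Proof.
move=> [x _ xw]; rewrite /orbit_deriv; set x0 := xget _ _.
have x0w : br x0 q = w by rewrite /x0; apply: (@xgetPex _ 0 [set x | br x q = w]); exists x.
have [_ D] := derive_linear_post x0 (lbR lb y) (Ad_diff HG Ac c1 q).
by rewrite -x0w; exact: D.
Qed.

(** By invariance the value of the field at [Ad g q] is [Ad g] applied to
    [J q [Ad g^-1 x, q]], to which the product rule applies. *)
Lemma orbit_deriv_Jfund x q y : orbit_of c v q ->
  orbit_deriv c (fun r => J r (fund_field x r)) q (br y q) =
  br y (J q (br x q)) - J q (br (br y x) q).
Proof.
move=> vq; rewrite /orbit_deriv; set y0 := xget _ _.
have y0E : br y0 q = br y q.
  by rewrite /y0; apply: (@xgetPex _ 0 [set x | br x q = br y q]); exists y.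
have [di Di] := derive_Ad_inv HG Ac c1 x y0.
pose M z := J q (br z q); have lM : linear M := Jbr_linear vq.
have [dM DM] := derive_linear_post y0 lM di.
have dMi : differentiable (fun z => M (Ad c (chart_inv c z)^-1%g x)) e0.
  pose L : {linear T -> T} := HB.pack M (GRing.isLinear.Build R T T _ M lM).
  have dL := is_diff_rV_linear L (Ad c ((chart_inv c e0)^-1)%g x).
  exact: (@differentiable_comp _ _ _ _ (fun z => Ad c ((chart_inv c z)^-1)%g x) L).
have [_ DA] := derive_Ad_app HG Ac c1 y0 dMi.
have FE : (fun z => J (Ad c (chart_inv c z) q) (fund_field x (Ad c (chart_inv c z) q))) =
    (fun z => Ad c (chart_inv c z) (M (Ad c (chart_inv c z)^-1%g x))).
  apply/funext => z; set g := chart_inv c z; set x1 := Ad c g^-1%g x.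
  refine (etrans (f_equal (J (Ad c g q)) _) (Jinv g vq (orbit_tangent_br q x1))).
  refine (etrans (f_equal (br ^~ (Ad c g q)) _) (Ad_br HG Ac c1 g x1 q)).
  exact: (esym (AdVK HG Ac c1 g x)).
refine (etrans (f_equal (fun f => 'D_y0 f e0) FE) (etrans DA _)).
have e1 : M (Ad c (chart_inv c e0)^-1%g x) = M x.
  by congr M; rewrite (chart_inv_e0 c1) invg1 (Ad1 c1).
have e2 := etrans DM (f_equal M Di).
refine (etrans (f_equal2 (fun u w => br y0 u + w) e1 e2) _).
apply: (stab_algebra lb lM); apply: J_stab vq _.
by rewrite (lbBl lb) y0E subrr.
Qed.

(** The definition of [N] is evaluated on fundamental fields; the directions of
    differentiation, [[x, q]] and [J [x, q]], are represented by [x] and [x']. *)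
Lemma nijenhuis_fund N q x y x' y' : is_nijenhuis c A v J N -> orbit_of c v q ->
  br x' q = J q (br x q) -> br y' q = J q (br y q) ->
  4 *: N q (br x q) (br y q) =
    br (br x' y' - br x y) q - J q (br (br x' y + br x y') q).
Proof.
move=> HN vq xE yE.
have oF z z1 w : br z1 q = w -> orbit_deriv c (fund_field z) q w = br z (br z1 q).
  by move=> <-; apply: orbit_deriv_fund; exact: orbit_tangent_br.
have oJ z z' z1 w : br z1 q = w -> br z' q = J q (br z q) ->
    orbit_deriv c (fun r => J r (fund_field z r)) q w =
    br z1 (br z' q) - J q (br (br z1 z) q).
  by move=> <- ->; exact: orbit_deriv_Jfund.
have JJq u : J q (J q (br u q)) = - br u q by apply: JJ => //; exact: orbit_tangent_br.
pose sub (u w : T) := u - w.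
have e1 := f_equal2 sub (oJ y y' x' _ xE yE) (oJ x x' y' _ yE xE).
have e2 := f_equal2 sub (oF y x' _ xE) (oJ x x' y _ erefl xE).
have e3 := f_equal2 sub (oJ y y' x _ erefl yE) (oF x y' _ yE).
have e4 := f_equal2 sub (oF y x _ erefl) (oF x y _ erefl).
refine (etrans (HN _ _ (fund_field_smooth x) (fund_field_smooth y) q vq) _).
refine (etrans _ (nijenhuis_algebra lb x y x' y' (Jbr_linear vq) JJq)).
exact (f_equal2 sub (f_equal2 sub (f_equal2 sub e1 (f_equal (J q) e2))
  (f_equal (J q) e3)) e4).
Qed.

End Nijenhuis.

(** * The Killing form *)

Section Killing.
Variables (F : fieldType) (d : nat) (b : 'rV[F]_d -> 'rV[F]_d -> 'rV[F]_d).
Hypothesis lb : lie_bracket b.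
Implicit Types x y z : 'rV[F]_d.

Definition admx x : 'M[F]_d := lin1_mx (b x).

Lemma mul_admx x y : y *m admx x = b x y.
Proof.
pose L : {linear 'rV[F]_d -> 'rV[F]_d} := HB.pack (b x)
  (GRing.isLinear.Build F _ _ _ (b x) (lbR lb x)).
exact: (mul_rV_lin1 L).
Qed.

Lemma admxP k x y : admx (k *: x + y) = k *: admx x + admx y.
Proof. by apply/matrixP => i j; rewrite !mxE (lbDl lb) (lbZl lb) !mxE. Qed.

Lemma admx_br x y : admx (b x y) = admx y *m admx x - admx x *m admx y.
Proof.
apply/row_matrixP => i; rewrite !rowE mulmxBr !mulmxA !mul_admx.
by rewrite (lbJ lb x) addrK.
Qed.

Lemma admx_commute x y : b x y = 0 -> admx y *m admx x = admx x *m admx y.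
Proof.
move=> xy; apply/eqP; rewrite -subr_eq0 -admx_br xy; apply/eqP/matrixP => i j.
by rewrite [LHS]mxE (lb0l lb) !mxE.
Qed.

Lemma killingC x y : killing b x y = killing b y x.
Proof. exact: mxtrace_mulC. Qed.

Lemma killingP k x y z : killing b (k *: x + y) z = k * killing b x z + killing b y z.
Proof. by rewrite /killing -!/(admx _) admxP mulmxDl mxtraceD -scalemxAl mxtraceZ. Qed.

Lemma killing0l z : killing b 0 z = 0.
Proof. by have := killingP (-1) 0 0 z; rewrite scaler0 addr0 mulN1r addNr. Qed.
Lemma killing0r z : killing b z 0 = 0. Proof. by rewrite killingC killing0l. Qed.
Lemma killingDl x y z : killing b (x + y) z = killing b x z + killing b y z.
Proof. by have := killingP 1 x y z; rewrite scale1r mul1r. Qed.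
Lemma killingZl k x z : killing b (k *: x) z = k * killing b x z.
Proof. by have := killingP k x 0 z; rewrite addr0 killing0l addr0. Qed.
Lemma killingZr k x z : killing b z (k *: x) = k * killing b z x.
Proof. by rewrite !(killingC z) killingZl. Qed.
Lemma killingNl x z : killing b (- x) z = - killing b x z.
Proof. by rewrite -scaleN1r killingZl mulN1r. Qed.
Lemma killingNr x z : killing b z (- x) = - killing b z x.
Proof. by rewrite !(killingC z) killingNl. Qed.
Lemma killing_suml z I (r : seq I) (P : pred I) f :
  killing b (\sum_(i <- r | P i) f i) z = \sum_(i <- r | P i) killing b (f i) z.
Proof. by elim/big_rec2: _ => [|i u w _ <-]; rewrite ?killing0l ?killingDl. Qed.

(** Invariance of the form: cyclicity of the trace and [ad [x, y] = [ad x, ad y]]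
    (with row vectors, products of matrices are composed from left to right). *)
Lemma killing_inv x y z : killing b (b x y) z = killing b x (b y z).
Proof.
rewrite /killing -!/(admx _) !admx_br mulmxBl mulmxBr !raddfB /=; congr (_ - _).
  by rewrite -mulmxA mxtrace_mulC mulmxA.
by rewrite mulmxA.
Qed.

Lemma killing_skew x y z : killing b (b x y) z = - killing b y (b x z).
Proof. by rewrite (lbC lb) killingNl killing_inv. Qed.

End Killing.

(** * Complexification *)

Section Complexification.
Variables (R : realType) (d : nat).
Local Notation C := R[i].
Local Notation T := 'rV[R]_d.
Local Notation TC := 'rV[C]_d.
Implicit Types (x y : T) (z w : TC).

Lemma complex_eq (a b : C) : complex.Re a = complex.Re b -> complex.Im a = complex.Im b -> a = b.
Proof. by case: a b => [ra ia] [rb ib] /= -> ->. Qed.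

Lemma ReM (a b : C) : complex.Re (a * b) = complex.Re a * complex.Re b - complex.Im a * complex.Im b.
Proof. by case: a b => [ra ia] [rb ib]. Qed.
Lemma ImM (a b : C) : complex.Im (a * b) = complex.Re a * complex.Im b + complex.Im a * complex.Re b.
Proof. by case: a b => [ra ia] [rb ib]. Qed.
Lemma ReD (a b : C) : complex.Re (a + b) = complex.Re a + complex.Re b.
Proof. by case: a b => [ra ia] [rb ib]. Qed.
Lemma ImD (a b : C) : complex.Im (a + b) = complex.Im a + complex.Im b.
Proof. by case: a b => [ra ia] [rb ib]. Qed.
Definition ReImE := (ReM, ImM, ReD, ImD).

Lemma cplx_is_additive : additive (@cplx R d).
Proof. by move=> x y; rewrite /cplx map_mxB. Qed.
HB.instance Definition _ := GRing.isAdditive.Build T TC (@cplx R d) cplx_is_additive.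

Lemma cplxZ k x : cplx (k *: x) = k%:C%C *: cplx x.
Proof. by apply/rowP => i; rewrite !mxE rmorphM. Qed.

Lemma re_cplx x : re_mx (cplx x) = x. Proof. by apply/rowP => i; rewrite !mxE. Qed.
Lemma im_cplx x : im_mx (cplx x) = 0. Proof. by apply/rowP => i; rewrite !mxE. Qed.
Lemma cplx_inj : injective (@cplx R d). Proof. exact: can_inj re_cplx. Qed.

Lemma re_mxP (a : C) z w : re_mx (a *: z + w) =
  complex.Re a *: re_mx z - complex.Im a *: im_mx z + re_mx w.
Proof. by apply/rowP => i; rewrite !mxE !ReImE. Qed.
Lemma im_mxP (a : C) z w : im_mx (a *: z + w) =
  complex.Re a *: im_mx z + complex.Im a *: re_mx z + im_mx w.
Proof. by apply/rowP => i; rewrite !mxE !ReImE. Qed.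
Lemma re_mx0 : re_mx (0 : TC) = 0. Proof. by apply/rowP => i; rewrite !mxE. Qed.
Lemma im_mx0 : im_mx (0 : TC) = 0. Proof. by apply/rowP => i; rewrite !mxE. Qed.
Lemma re_mxZ (a : C) z : re_mx (a *: z) = complex.Re a *: re_mx z - complex.Im a *: im_mx z.
Proof. by rewrite -[a *: z]addr0 re_mxP re_mx0 addr0. Qed.
Lemma im_mxZ (a : C) z : im_mx (a *: z) = complex.Re a *: im_mx z + complex.Im a *: re_mx z.
Proof. by rewrite -[a *: z]addr0 im_mxP im_mx0 addr0. Qed.
Lemma re_mxD z w : re_mx (z + w) = re_mx z + re_mx w.
Proof. by apply/rowP => i; rewrite !mxE !ReImE. Qed.
Lemma im_mxD z w : im_mx (z + w) = im_mx z + im_mx w.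
Proof. by apply/rowP => i; rewrite !mxE !ReImE. Qed.

Lemma re_mx_i z : re_mx ('i%C *: z) = - im_mx z.
Proof. by rewrite re_mxZ /= scale0r scale1r sub0r. Qed.
Lemma im_mx_i z : im_mx ('i%C *: z) = re_mx z.
Proof. by rewrite im_mxZ /= scale0r scale1r add0r. Qed.
Lemma re_mx_r (r : R) z : re_mx (r%:C%C *: z) = r *: re_mx z.
Proof. by rewrite re_mxZ /= scale0r subr0. Qed.
Lemma im_mx_r (r : R) z : im_mx (r%:C%C *: z) = r *: im_mx z.
Proof. by rewrite im_mxZ /= scale0r addr0. Qed.
Lemma re_mk x y : re_mx (cplx x + 'i%C *: cplx y) = x.
Proof. by rewrite re_mxD re_mx_i re_cplx im_cplx oppr0 addr0. Qed.
Lemma im_mk x y : im_mx (cplx x + 'i%C *: cplx y) = y.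
Proof. by rewrite im_mxD im_mx_i re_cplx im_cplx add0r. Qed.

Lemma cplxE z : z = cplx (re_mx z) + 'i%C *: cplx (im_mx z).
Proof. by apply/rowP => i; rewrite !mxE -complexE. Qed.

Lemma reim_eq z w : re_mx z = re_mx w -> im_mx z = im_mx w -> z = w.
Proof. by move=> rzw izw; rewrite [z]cplxE rzw izw -cplxE. Qed.

Lemma cplx_ext (V : lmodType C) (f g : TC -> V) : linear f -> linear g ->
  (forall x, f (cplx x) = g (cplx x)) -> f =1 g.
Proof. by move=> lf lg fg z; rewrite [z]cplxE addrC lf lg !fg. Qed.

Definition cconj z : TC := map_mx (@conjc R) z.

Lemma cconjK : involutive cconj.
Proof. by move=> z; apply/rowP => i; rewrite !mxE conjcK. Qed.
Lemma cconjD z w : cconj (z + w) = cconj z + cconj w.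
Proof. by apply/rowP => i; rewrite !mxE rmorphD. Qed.
Lemma cconjZ a z : cconj (a *: z) = a^*%C *: cconj z.
Proof. by apply/rowP => i; rewrite !mxE rmorphM. Qed.
Lemma cconj_cplx x : cconj (cplx x) = cplx x.
Proof. by apply/rowP => i; rewrite !mxE conjc_real. Qed.
Lemma cconj_sum I (r : seq I) (P : pred I) f :
  cconj (\sum_(i <- r | P i) f i) = \sum_(i <- r | P i) cconj (f i).
Proof.
elim/big_rec2: _ => [|i u w _ <-]; last by rewrite cconjD.
by apply/rowP => i; rewrite !mxE conjc0.
Qed.
Lemma cconj_real z : cconj z = z -> cplx (re_mx z) = z.
Proof.
move=> /rowP zr; apply/rowP => i; have := zr i; rewrite !mxE.
case: (z 0 i) => a b /= [] /eqP; rewrite eq_sym -subr_eq0 opprK -mulr2n mulrn_eq0 /=.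
by move=> /eqP ->.
Qed.
Lemma cconjE z : cconj z = cplx (re_mx z) - 'i%C *: cplx (im_mx z).
Proof.
rewrite {1}[z]cplxE cconjD cconjZ !cconj_cplx; congr (_ + _).
by rewrite -scaleNr; congr (_ *: _); apply: complex_eq => /=; rewrite ?oppr0.
Qed.

(** A conjugate-linear map is determined by its values on the real vectors, which
    [tau] fixes. *)
Lemma conjugation_fixing_real (tau : TC -> TC) :
  conjugation_fixing [set z | im_mx z = 0] tau -> tau =1 cconj.
Proof.
move=> [tl tfix]; have tr x : tau (cplx x) = cplx x.
  have : [set z : TC | im_mx z = 0] (cplx x) by exact: im_cplx.
  by rewrite -tfix.
move=> z; rewrite {1}[z]cplxE addrC tl !tr cconjE addrC; congr (_ + _).
by rewrite -scaleNr; congr (_ *: _); apply: complex_eq => /=; rewrite ?oppr0.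
Qed.

Variable br : T -> T -> T.
Hypothesis lb : lie_bracket br.

Lemma cbr_linr z : linear (cbr br z).
Proof.
move=> a w w'; rewrite /cbr !re_mxP !im_mxP.
rewrite !(lbDr lb) !(lbNr lb) !(lbZr lb).
by apply/rowP => i; apply: complex_eq; rewrite !mxE !ReImE /= ?mxE; ring.
Qed.

Lemma cbrN z w : cbr br z w = - cbr br w z.
Proof.
rewrite /cbr (lbC lb (re_mx z)) (lbC lb (im_mx z)) (lbC lb (re_mx z)) (lbC lb (im_mx z)).
by apply/rowP => i; apply: complex_eq; rewrite !mxE !ReImE /= ?mxE; ring.
Qed.

Lemma cbr_linl w : linear (cbr br ^~ w).
Proof. by move=> a z z'; rewrite /= !(cbrN _ w) cbr_linr opprD scalerN. Qed.

Lemma cbr_cplx x y : cbr br (cplx x) (cplx y) = cplx (br x y).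
Proof.
rewrite /cbr !re_cplx !im_cplx !(lb0r lb) (lb0l lb) subr0 addr0.
by rewrite raddf0 scaler0 addr0.
Qed.

Lemma cbr_lie : lie_bracket (cbr br).
Proof.
split; [exact: cbr_linl|exact: cbr_linr| |].
  by move=> z; rewrite /cbr !(lbxx lb) subr0 (lbC lb) addNr raddf0 scaler0 addr0.
have lin2 (f g : TC -> TC) : linear f -> linear g -> linear (fun z => f (g z)).
  by move=> lf lg a z w; rewrite lg lf.
have linD (f g : TC -> TC) : linear f -> linear g -> linear (fun z => f z + g z).
  by move=> lf lg a z w; rewrite lf lg scalerDr addrACA.
move=> z1 z2 z3.
move: z3; apply: cplx_ext => [||x3].
- exact: lin2 (cbr_linr z1) (cbr_linr z2).
- exact: linD (cbr_linr _) (lin2 _ _ (cbr_linr z2) (cbr_linr z1)).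
move: z2; apply: cplx_ext => [||x2].
- exact: lin2 (cbr_linr z1) (cbr_linl _).
- apply: linD; first exact: lin2 (cbr_linl _) (cbr_linr z1).
  exact: cbr_linl.
move: z1; apply: cplx_ext => [||x1].
- exact: cbr_linl.
- apply: linD; first exact: lin2 (cbr_linl _) (cbr_linl _).
  exact: lin2 (cbr_linr _) (cbr_linl _).
by rewrite !cbr_cplx -raddfD -(lbJ lb).
Qed.

Lemma killing_cplx x y : killing (cbr br) (cplx x) (cplx y) = (killing br x y)%:C%C.
Proof.
have E u : lin1_mx (cbr br (cplx u)) = map_mx (real_complex R) (lin1_mx (br u)).
  apply/matrixP => i j; rewrite [LHS]mxE [RHS]mxE [lin1_mx _ _ _]mxE.
  have -> : delta_mx 0 i = cplx (delta_mx 0 i : T).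
    by apply/rowP => k; rewrite !mxE; case: (_ && _).
  by rewrite cbr_cplx mxE.
rewrite /killing !E -map_mxM; exact: trace_map_mx.
Qed.

Lemma cconj_br z w : cconj (cbr br z w) = cbr br (cconj z) (cconj w).
Proof.
rewrite /cbr cconjD cconjZ !cconj_cplx.
have rc u : re_mx (cconj u) = re_mx u by apply/rowP => i; rewrite !mxE; case: (u 0 i).
have ic u : im_mx (cconj u) = - im_mx u by apply/rowP => i; rewrite !mxE; case: (u 0 i).
rewrite !rc !ic !(lbNl lb) !(lbNr lb) opprK; congr (_ + _).
rewrite -opprD raddfN scalerN -scaleNr; congr (_ *: _).
by apply: complex_eq; rewrite /= ?oppr0.
Qed.

Lemma cconj_killing z w :
  killing (cbr br) (cconj z) (cconj w) = (killing (cbr br) z w)^*%C.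
Proof.
have E u : lin1_mx (cbr br (cconj u)) = map_mx (@conjc R) (lin1_mx (cbr br u)).
  apply/matrixP => i j; rewrite [LHS]mxE [RHS]mxE [lin1_mx _ _ _]mxE.
  have dr : delta_mx 0 i = cconj (delta_mx 0 i : TC).
    by apply/rowP => k; rewrite !mxE; case: (_ && _); rewrite ?conjc0 ?conjc1.
  by rewrite [in LHS]dr -cconj_br mxE.
rewrite /killing !E -map_mxM; exact: trace_map_mx.
Qed.

End Complexification.

(** * A criterion for diagonalizability *)

Section Diagonalization.

(** The hypothesis allows repeated factors to be dropped from a product of linear
    polynomials that annihilates [A], such as the characteristic polynomial. *)
Lemma diagonalizable_of_ker (F : closedFieldType) (n : nat) (A : 'M[F]_n) :
  (forall l (z : 'rV_n), z *m (A - l%:M) *m (A - l%:M) = 0 -> z *m (A - l%:M) = 0) ->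
  diagonalizable A.
Proof.
case: n A => [|n] A kerA.
  exists 1%:M; first exact: unitmx1.
  by apply/is_diag_mxP => i; case: i.
pose lin (r : F) : {poly F} := 'X - r%:P.
have hl r : horner_mx A (lin r) = A - r%:M.
  by rewrite /lin rmorphB /= horner_mx_X horner_mx_C.
have hM (p q : {poly F}) : horner_mx A (p * q) = horner_mx A p *m horner_mx A q.
  exact: rmorphM.
have red rs (z : 'rV_n.+1) : z *m horner_mx A (\prod_(r <- rs) lin r) = 0 ->
    z *m horner_mx A (\prod_(r <- undup rs) lin r) = 0.
  elim: rs z => [//|r s IH] z /=; rewrite big_cons hM hl mulmxA.
  case: ifPn => [rs|_]; last by rewrite big_cons hM hl mulmxA => /IH.
  move=> zs; apply: IH; move: zs.
  have [q ->] : exists q, \prod_(j <- s) lin j = q * lin r.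
    exists (\prod_(j <- rem r s) lin j).
    by rewrite (perm_big _ (perm_to_rem rs)) /= big_cons mulrC.
  have qC : (A - r%:M) *m horner_mx A q = horner_mx A q *m (A - r%:M).
    by rewrite -hl -!hM mulrC.
  rewrite hM hl !mulmxA -(mulmxA z) qC mulmxA; exact: kerA.
apply/diagonalizableP.
have [rs rsE] := closed_field_poly_normal (char_poly A).
exists (undup rs); first exact: undup_uniq.
apply/mxminpoly_minP; apply/row_matrixP => i; rewrite rowE row0.
apply: red; have := Cayley_Hamilton A.
rewrite rsE (monicP (char_poly_monic A)) scale1r => ->.
by rewrite mulmx0.
Qed.

End Diagonalization.

(** * Cartan decompositions and weights *)

Section CartanDecomposition.
Variables (R : realType) (d : nat).
Local Notation C := R[i].
Local Notation T := 'rV[R]_d.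
Local Notation TC := 'rV[C]_d.
Variable br : T -> T -> T.
Hypothesis lb : lie_bracket br.
Variables (k p : {vspace T}).
Hypothesis Hkp : cartan_decomposition br k p.
Local Notation B := (killing br).

Lemma cartan_cap : (k :&: p = 0)%VS. Proof. by have [[_ ->]] := Hkp. Qed.
Lemma cartan_add x : (x \in k + p)%VS. Proof. by have [[-> _]] := Hkp; rewrite memvf. Qed.

Definition kpart (x : T) : T := daddv_pi k p x.
Definition ppart (x : T) : T := daddv_pi p k x.

Lemma kpart_in x : kpart x \in k. Proof. exact: memv_pi. Qed.
Lemma ppart_in x : ppart x \in p. Proof. exact: memv_pi. Qed.
Lemma kpart_add x : kpart x + ppart x = x.
Proof. by rewrite daddv_pi_add ?cartan_cap ?cartan_add. Qed.

Lemma parts_uniq a b : a \in k -> b \in p -> kpart (a + b) = a /\ ppart (a + b) = b.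
Proof.
move=> ak bp; have pk : (p :&: k = 0)%VS by rewrite capvC cartan_cap.
have kb : kpart b = 0.
  by have := kpart_add b; rewrite /ppart (daddv_pi_id pk bp) -[RHS]add0r => /addIr.
have pa : ppart a = 0.
  by have := kpart_add a; rewrite /kpart (daddv_pi_id cartan_cap ak) -[RHS]addr0 => /addrI.
split.
  by rewrite [LHS](linearD (daddv_pi k p) a b) [X in _ + X]kb addr0; exact: (daddv_pi_id cartan_cap ak).
by rewrite [LHS](linearD (daddv_pi p k) a b) [X in X + _]pa add0r; exact: (daddv_pi_id pk bp).
Qed.

Lemma br_kk x y : x \in k -> y \in k -> br x y \in k.
Proof. by have [_ + _ _ _] := Hkp; apply. Qed.
Lemma br_kp x y : x \in k -> y \in p -> br x y \in p.
Proof. by have [_ _ + _ _] := Hkp; apply. Qed.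
Lemma killing_k x : x \in k -> x != 0 -> B x x < 0.
Proof. by have [_ _ _ _ [+ _]] := Hkp; apply. Qed.
Lemma killing_p x : x \in p -> x != 0 -> 0 < B x x.
Proof. by have [_ _ _ _ [_ +]] := Hkp; apply. Qed.

Lemma parts_br t x : t \in k -> kpart (br t x) = br t (kpart x) /\ ppart (br t x) = br t (ppart x).
Proof.
move=> tk; rewrite -{1 3}(kpart_add x) (lbDr lb).
by apply: parts_uniq; [exact/br_kk/kpart_in|exact/br_kp/ppart_in].
Qed.

(** The positive definite form [- B (x, theta y)], [theta] being the Cartan
    involution. *)
Definition cartan_form x y := B (ppart x) (ppart y) - B (kpart x) (kpart y).
Local Notation ip := cartan_form.

Lemma ipC x y : ip x y = ip y x.
Proof. by rewrite /ip killingC [X in _ - X]killingC. Qed.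
Lemma ipDl x y z : ip (x + y) z = ip x z + ip y z.
Proof.
rewrite /ip /kpart /ppart !linearD /= !(killingDl lb); ring.
Qed.
Lemma ipZl a x z : ip (a *: x) z = a * ip x z.
Proof. rewrite /ip /kpart /ppart !linearZ /= !(killingZl lb); ring. Qed.
Lemma ipDr x y z : ip z (x + y) = ip z x + ip z y.
Proof. by rewrite !(ipC z) ipDl. Qed.
Lemma ipZr a x z : ip z (a *: x) = a * ip z x.
Proof. by rewrite !(ipC z) ipZl. Qed.
Lemma ipNl x z : ip (- x) z = - ip x z.
Proof. by rewrite -scaleN1r ipZl mulN1r. Qed.
Lemma ipNr x z : ip z (- x) = - ip z x.
Proof. by rewrite -scaleN1r ipZr mulN1r. Qed.

Lemma ip_ge0 x : 0 <= ip x x.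
Proof.
rewrite /ip subr_ge0; apply: (@le_trans _ _ 0).
  have [->|x0] := eqVneq (kpart x) 0; first by rewrite (killing0l lb).
  by apply/ltW/killing_k => //; exact: kpart_in.
have [->|x0] := eqVneq (ppart x) 0; first by rewrite (killing0l lb).
by apply/ltW/killing_p => //; exact: ppart_in.
Qed.

Lemma ip_eq0 x : ip x x = 0 -> x = 0.
Proof.
rewrite -{3}(kpart_add x) /ip.
have [->|k0] := eqVneq (kpart x) 0; have [->|p0] := eqVneq (ppart x) 0.
- by rewrite addr0.
- move=> h; exfalso; move: h; have := killing_p (ppart_in x) p0; rewrite (killing0l lb); lra.
- move=> h; exfalso; move: h; have := killing_k (kpart_in x) k0; rewrite (killing0l lb); lra.
- move=> h; exfalso; move: h; have := killing_p (ppart_in x) p0; have := killing_k (kpart_in x) k0; lra.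
Qed.

(** [ad t] preserves [k] and [p] and is skew for the Killing form. *)
Lemma ip_skew t x y : t \in k -> ip (br t x) y = - ip x (br t y).
Proof.
move=> tk; have [kx px] := parts_br x tk; have [ky py] := parts_br y tk.
rewrite /ip kx px ky py !(killing_skew lb t); ring.
Qed.

Lemma re_cbr z w : re_mx (cbr br z w) = br (re_mx z) (re_mx w) - br (im_mx z) (im_mx w).
Proof. by rewrite /cbr re_mxD re_cplx re_mxZ /= re_cplx im_cplx scale0r scaler0 subrr addr0. Qed.
Lemma im_cbr z w : im_mx (cbr br z w) = br (re_mx z) (im_mx w) + br (im_mx z) (re_mx w).
Proof. by rewrite /cbr im_mxD im_cplx im_mxZ /= re_cplx im_cplx scaler0 scale1r !add0r. Qed.

(** The eigenvalues of an operator that is skew for a positive definite form are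
    imaginary. *)
Lemma ad_k_eigen t l w : t \in k -> cbr br (cplx t) w = l *: w -> w != 0 ->
  complex.Re l = 0.
Proof.
move=> tk wl w0.
have := congr1 (@re_mx R d) wl; have := congr1 (@im_mx R d) wl.
rewrite re_cbr im_cbr re_mxZ im_mxZ re_cplx im_cplx !(lb0l lb) subr0 addr0.
case: l {wl} => a b /= wi wr.
have ir : ip (br t (re_mx w)) (re_mx w) = 0.
  by have := ip_skew (re_mx w) (re_mx w) tk; rewrite [X in - X]ipC; lra.
have ii : ip (br t (im_mx w)) (im_mx w) = 0.
  by have := ip_skew (im_mx w) (im_mx w) tk; rewrite [X in - X]ipC; lra.
move: ir ii; rewrite wr wi !ipDl ipNl !ipZl (ipC (im_mx w) (re_mx w)) => ir ii.
have sum0 : a * (ip (re_mx w) (re_mx w) + ip (im_mx w) (im_mx w)) = 0 by lra.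
move/eqP: sum0; rewrite mulf_eq0 => /orP[/eqP //|].
rewrite paddr_eq0 ?ip_ge0 // => /andP[/eqP/ip_eq0 r0 /eqP/ip_eq0 i0].
by move: w0; rewrite [w]cplxE r0 i0 !raddf0 ?scaler0 ?addr0 eqxx.
Qed.

(** For a skew operator [S] and an imaginary number [l], the image of [S - l] is
    orthogonal to its kernel; here [w = z (ad t - l)] lies in both. *)
Lemma ad_k_ker t l (z : TC) : t \in k ->
  let M := admx (cbr br) (cplx t) - l%:M in z *m M *m M = 0 -> z *m M = 0.
Proof.
move=> tk M; have clb := cbr_lie lb.
have ME u : u *m M = cbr br (cplx t) u - l *: u.
  by rewrite /M mulmxBr (mul_admx clb) mul_mx_scalar.
set w := z *m M => wM; apply/eqP; case: eqVneq => // w0; exfalso.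
have wl : cbr br (cplx t) w = l *: w by apply/eqP; rewrite -subr_eq0 -ME wM.
have l0 := ad_k_eigen tk wl w0.
have := congr1 (@re_mx R d) wl; have := congr1 (@im_mx R d) wl.
rewrite re_cbr im_cbr re_mxZ im_mxZ re_cplx im_cplx !(lb0l lb) subr0 addr0.
rewrite l0 !scale0r sub0r add0r => wi wr.
have wz : w = cbr br (cplx t) z - l *: z by rewrite -ME.
have := congr1 (@re_mx R d) wz; have := congr1 (@im_mx R d) wz.
rewrite -!scaleNr re_mxD im_mxD re_cbr im_cbr re_mxZ im_mxZ re_cplx im_cplx.
rewrite !(lb0l lb) subr0 addr0 !raddfN /= l0 oppr0 !scale0r sub0r add0r.
set b := complex.Im l in wi wr *; rewrite !scaleNr opprK => wzi wzr.
have e1 : ip (re_mx w) (re_mx w) + ip (im_mx w) (im_mx w) = 0.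
  rewrite {2}wzr {2}wzi !ipDr !ipNr !ipZr.
  have := ip_skew (re_mx w) (re_mx z) tk; have := ip_skew (im_mx w) (im_mx z) tk.
  rewrite wi wr ipNl !ipZl; lra.
move/eqP: e1; rewrite paddr_eq0 ?ip_ge0 // => /andP[/eqP/ip_eq0 r0 /eqP/ip_eq0 i0].
by move: w0; rewrite [w]cplxE r0 i0 !raddf0 ?scaler0 ?addr0 eqxx.
Qed.

Variable h0 : {vspace T}.
Hypothesis h0k : (h0 <= k)%VS.
Hypothesis h0ab : abelian br h0.

(** The operators [ad t], [t] in [h0], commute and are skew, so they have a common
    basis of eigenvectors; their eigenvalues are imaginary, which makes them real
    on [h_R]. *)
Lemma weight_basis : exists (P : 'M[C]_d) (psi : 'I_d -> hR_dual h0),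
  P \in unitmx /\ forall i, root_space br (psi i) (row i P).
Proof.
have clb := cbr_lie lb.
pose As := [seq admx (cbr br) (cplx t) | t <- vbasis h0 : seq T].
have memAs M : M \in As -> exists2 t, t \in h0 & M = admx (cbr br) (cplx t).
  by move=> /mapP[t tb ->]; exists t => //; exact: vbasis_mem.
have : codiagonalizable As.
  apply/codiagonalizableP; split=> [M M' /memAs[t th ->] /memAs[s sh ->]|M /memAs[t th ->]].
    apply: (admx_commute clb).
    by rewrite (cbr_cplx lb) (h0ab sh th) raddf0.
  apply: diagonalizable_of_ker => l z; apply: ad_k_ker.
  exact: (subvP h0k).
move=> [P Pu /allP Pd]; exists P.
have eig i t : t \in h0 -> exists l, cbr br (cplx t) (row i P) = l *: row i P.
  move=> /coord_vbasis ->.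
  pose good (t : T) := exists l, cbr br (cplx t) (row i P) = l *: row i P.
  have good0 : good 0 by exists 0; rewrite raddf0 (lb0l clb) scale0r.
  have goodD u w : good u -> good w -> good (u + w).
    by move=> [l ul] [m wm]; exists (l + m); rewrite raddfD (lbDl clb) ul wm scalerDl.
  apply: (big_ind good) => // j _.
  have : admx (cbr br) (cplx (vbasis h0)`_j) \in As.
    by apply: map_f; rewrite mem_nth // size_tuple.
  move=> /Pd /= /(similar_diagLR Pu)[D DE].
  exists ((coord (vbasis h0) j t)%:C%C * D 0 i).
  rewrite cplxZ (lbZl clb) -(mul_admx clb) DE -scalerA; congr (_ *: _).
  have rD : row i P *m invmx P = delta_mx 0 i by rewrite rowE mulmxK.
  by rewrite (conjVmx _ Pu) !mulmxA rD -(rowE i (diag_mx D)) row_diag_mx -scalemxAl -rowE.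
have rowP0 i : row i P != 0.
  apply: contraTneq Pu => Pi; rewrite -row_free_unit; apply/row_freePn; exists i.
  by rewrite Pi sub0mx.
have coordn0 i : exists j, row i P 0 j != 0 by apply/rV0Pn.
(* An eigenvalue is read off a nonzero coordinate of the eigenvector. *)
pose j i := xchoose (coordn0 i).
pose f i (t : subvs_of h0) : R^o :=
  complex.Re (cbr br (hR_elt t) (row i P) 0 (j i) / row i P 0 (j i)).
have fl i : linear (f i).
  move=> a s t; rewrite /f /hR_elt (_ : vsval (a *: s + t) = a *: vsval s + vsval t); last exact: linearP.
  rewrite [cplx _]raddfD /= cplxZ scalerDr scalerA.
  rewrite [_ * a%:C%C]mulrC -scalerA (lbDl clb) (lbZl clb).
  move: (cbr br ('i%C *: cplx (vsval s)) _) (cbr br ('i%C *: cplx (vsval t)) _) => u w.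
  rewrite mxE [(_ *: u) 0 _]mxE.
  rewrite mulrDl ReD -mulrA; congr (_ + _).
  by rewrite ReM /= mul0r subr0.
pose L i : {linear subvs_of h0 -> R^o} := HB.pack (f i) (GRing.isLinear.Build R (subvs_of h0) R^o _ (f i) (fl i)).
exists (fun i => linfun (L i)); split=> // i t; rewrite lfunE /=.
have [l lE] := eig i _ (subvsP t).
have tk : vsval t \in k by apply: (subvP h0k); exact: subvsP.
have l0 := ad_k_eigen tk lE (rowP0 i).
rewrite /f /hR_elt (lbZl clb) lE scalerA; congr (_ *: _).
rewrite [X in X / _]mxE mulfK; last exact: (xchooseP (coordn0 i)).
by apply: complex_eq; rewrite !ReImE /= l0; ring.
Qed.

End CartanDecomposition.

(** * Root spaces *)

Section RootSpaces.
Variables (R : realType) (d : nat).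
Local Notation C := R[i].
Local Notation T := 'rV[R]_d.
Local Notation TC := 'rV[C]_d.
Variable br : T -> T -> T.
Hypothesis lb : lie_bracket br.
Variables (k p h0 : {vspace T}).
Hypothesis Hkp : cartan_decomposition br k p.
Hypothesis Hh0 : maximal_abelian_in br k h0.
Variable v : T.
Hypothesis vh0 : v \in h0.
Hypothesis cent_v : forall x, br x v = 0 -> x \in k.

Local Notation B := (killing (cbr br)).
Local Notation root := (is_root br).
Implicit Types (a b : hR_dual h0) (z w : TC) (t s : subvs_of h0).

Let clb : lie_bracket (cbr br) := cbr_lie lb.
Let h0k : (h0 <= k)%VS. Proof. by have [] := Hh0. Qed.
Let h0ab : abelian br h0. Proof. by have [] := Hh0. Qed.

Lemma root_space_lin a (l : C) z w :
  root_space br a z -> root_space br a w -> root_space br a (l *: z + w).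
Proof.
move=> az aw t; rewrite (lbDr clb) (lbZr clb) az aw scalerDr !scalerA.
by rewrite [_ * l]mulrC.
Qed.

Lemma root_space0 a : root_space br a 0.
Proof. by move=> t; rewrite (lb0r clb) scaler0. Qed.

Lemma root_spaceZ a (l : C) z : root_space br a z -> root_space br a (l *: z).
Proof. by move=> az; rewrite -[l *: z]addr0; apply: root_space_lin az _; exact: root_space0. Qed.

Lemma root_space_br a b z w : root_space br a z -> root_space br b w ->
  root_space br (a + b) (cbr br z w).
Proof.
move=> az bw t; rewrite (lbJ clb) az bw (lbZl clb) (lbZr clb) -scalerDl -rmorphD.
by rewrite lfunE.
Qed.

Lemma hR_conj t : cconj (hR_elt t) = - hR_elt t.
Proof.
rewrite /hR_elt cconjZ cconj_cplx -scaleNr; congr (_ *: _).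
by apply: complex_eq; rewrite /= ?oppr0.
Qed.

Lemma root_space_conj a z : root_space br a z -> root_space br (- a) (cconj z).
Proof.
move=> az t; have := congr1 (@cconj R d) (az t).
rewrite (cconj_br lb) hR_conj cconjZ conjc_real (lbNl clb) => /eqP.
by rewrite eqr_oppLR => /eqP ->; rewrite lfunE /= rmorphN scaleNr.
Qed.

Lemma is_rootN a : root a -> root (- a).
Proof.
move=> [a0 [z az z0]]; split; first by rewrite oppr_eq0.
exists (cconj z); first exact: root_space_conj.
by apply: contra_neq z0 => zz; rewrite -[z]cconjK zz; apply/rowP => i; rewrite !mxE conjc0.
Qed.

(** [ad t] is skew for the Killing form and acts on the two spaces by [a t] and
    [b t]. *)
Lemma root_space_orth a b z w : root_space br a z -> root_space br b w ->
  a + b != 0 -> B z w = 0.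
Proof.
move=> az bw ab0; apply/eqP; apply: contraNT ab0 => zw0.
apply/eqP/lfunP => t; rewrite !lfunE /=.
have := killing_skew clb (hR_elt t) z w.
rewrite az bw (killingZl clb) (killingZr clb) => /eqP.
rewrite -subr_eq0 opprK -mulrDl mulf_eq0 (negbTE zw0) orbF -rmorphD.
by move=> /eqP/complexI.
Qed.

Lemma killing_hR t s : B (hR_elt t) (hR_elt s) = (- killing br (vsval t) (vsval s))%:C%C.
Proof.
rewrite /hR_elt (killingZl clb) (killingZr clb) (killing_cplx lb) mulrA.
by apply: complex_eq; rewrite !ReImE /=; ring.
Qed.

Lemma killing_hR_gt0 t : t != 0 -> 0 < - killing br (vsval t) (vsval t).
Proof.
move=> t0; rewrite oppr_gt0; apply: (killing_k Hkp).
  by apply: (subvP h0k); exact: subvsP.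
by apply: contra_neq t0 => t0; apply: val_inj.
Qed.

(** The component of [x] in [p] centralizes [v], so it lies in [k] and vanishes; the
    component in [k] lies in [h0] by maximality. *)
Lemma centralizer_h0 x : (forall t : T, t \in h0 -> br t x = 0) -> x \in h0.
Proof.
move=> xc.
have kc (t : T) : t \in h0 -> br t (kpart k p x) = 0.
  move=> th; have [<- _] := parts_br lb Hkp x (subvP h0k _ th).
  by rewrite xc // /kpart linear0.
have px0 : ppart k p x = 0.
  have pv : br (ppart k p x) v = 0.
    rewrite (lbC lb); have [_ <-] := parts_br lb Hkp x (subvP h0k _ vh0).
    by rewrite xc // /ppart linear0 oppr0.
  have : ppart k p x \in (k :&: p)%VS by rewrite memv_cap cent_v // ppart_in.
  by rewrite (cartan_cap Hkp) memv0 => /eqP.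
have [_ _ hmax] := Hh0.
have <- : (h0 + <[kpart k p x]>)%VS = h0.
  apply: hmax; last exact: addvSl.
  - by rewrite subv_add h0k -memvE kpart_in.
  - move=> u w /memv_addP[u1 u1h [u2 /vlineP[r ->] ->]].
    move=> /memv_addP[w1 w1h [w2 /vlineP[r' ->] ->]].
    rewrite !(lbDl lb) !(lbDr lb) !(lbZl lb) !(lbZr lb) (lbxx lb) h0ab // kc //.
    by rewrite (lbC lb) kc // oppr0 !scaler0 !addr0.
have xE : x = kpart k p x by rewrite -[LHS](kpart_add Hkp) px0 addr0.
by apply: (subvP (addvSr _ _)); rewrite {1}xE memv_line.
Qed.

Lemma root_space_zero z : root_space br (0 : hR_dual h0) z -> re_mx z \in h0 /\ im_mx z \in h0.
Proof.
move=> z0.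
have h (t : T) : t \in h0 -> cbr br (cplx t) z = 0.
  move=> th; have := z0 (vsproj h0 t).
  rewrite /hR_elt vsprojK // lfunE scale0r (lbZl clb) => /eqP.
  by rewrite scaler_eq0 => /orP[/eqP[/eqP]|/eqP //]; rewrite oner_eq0.
split; apply: centralizer_h0 => t /h h1.
  by have := congr1 (@re_mx R d) h1; rewrite re_cbr re_cplx im_cplx (lb0l lb) subr0 re_mx0.
by have := congr1 (@im_mx R d) h1; rewrite im_cbr re_cplx im_cplx (lb0l lb) addr0 im_mx0.
Qed.

Lemma root_space_zeroE z : root_space br (0 : hR_dual h0) z ->
  exists t s, z = 'i%C *: hR_elt t + hR_elt s.
Proof.
move=> /root_space_zero[rz iz]; exists (- vsproj h0 (re_mx z)), (vsproj h0 (im_mx z)).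
rewrite {1}[z]cplxE /hR_elt; congr (_ + _); last by rewrite vsprojK.
rewrite scalerA linearN /= vsprojK //.
by apply/rowP => i; apply: complex_eq; rewrite !mxE !ReImE /= ?mxE; ring.
Qed.

(** The weights of a basis of weight vectors exhaust the roots. The last clause, which
    says that the weight spaces span, is used to compare linear maps. *)
Lemma roots_finite : exists rts : seq (hR_dual h0), [/\ uniq rts,
  forall a, a \in rts <-> root a &
  forall f : TC -> TC, linear f ->
    (forall z, root_space br (0 : hR_dual h0) z -> f z = 0) ->
    (forall a z, root a -> root_space br a z -> f z = 0) -> forall z, f z = 0].
Proof.
have [P [psi [Pu Ppsi]]] := weight_basis lb Hkp h0k h0ab.
have row0 i : row i P != 0.
  apply: contraTneq Pu => Pi; rewrite -row_free_unit; apply/row_freePn; exists i.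
  by rewrite Pi sub0mx.
exists (undup [seq psi i | i <- enum 'I_d & psi i != 0]); split.
- exact: undup_uniq.
- move=> a; rewrite mem_undup; split=> [/mapP[j]|[a0 [z az z0]]].
    by rewrite mem_filter => /andP[pi0 _] ->; split=> //; exists (row j P).
  have zE : z = \sum_i (z *m invmx P) 0 i *: row i P.
    by rewrite -mulmx_sum_row mulmxKV.
  have /rV0Pn[i ci] : z *m invmx P != 0.
    by apply: contra_neq z0 => zP; rewrite -[z](mulmxKV Pu) zP mul0mx.
  have psia : psi i = a.
    apply/lfunP => t; apply: complexI.
    have : \sum_j ((z *m invmx P) 0 j * ((psi j t)%:C%C - (a t)%:C%C)) *: row j P = 0.
      have := az t; rewrite {1 2}zE (lb_sumr clb) scaler_sumr => /eqP.
      rewrite -subr_eq0 -sumrB => /eqP h.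
      apply: etrans h; apply: eq_bigr => j _; rewrite (lbZr clb) Ppsi !scalerA -scalerBl; congr (_ *: _); ring.
    pose u : TC := \row_j ((z *m invmx P) 0 j * ((psi j t)%:C%C - (a t)%:C%C)).
    have -> : \sum_j ((z *m invmx P) 0 j * ((psi j t)%:C%C - (a t)%:C%C)) *: row j P = u *m P.
      by rewrite [RHS]mulmx_sum_row; apply: eq_bigr => j _; rewrite [u 0 j]mxE.
    move=> uP; have : u = 0 by rewrite -[u](mulmxK Pu) uP mul0mx.
    move=> /rowP/(_ i); rewrite [u 0 i]mxE [X in _ = X]mxE => /eqP.
    by rewrite mulf_eq0 subr_eq0 (negbTE ci) => /eqP.
  by apply/mapP; exists i => //; rewrite mem_filter psia a0 mem_enum.
move=> f lf f0 fa z; rewrite -[z](mulmxKV Pu) mulmx_sum_row.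
set u := z *m invmx P.
pose F : {linear TC -> TC} := HB.pack f (GRing.isLinear.Build C TC TC _ f lf).
rewrite -[f _]/(F _) linear_sum big1 // => i _; rewrite linearZ /=.
suff -> : f (row i P) = 0 by rewrite scaler0.
have [p0|p0] := eqVneq (psi i) 0; first by apply: f0; rewrite -p0.
by apply: (fa (psi i)) => //; split=> //; exists (row i P).
Qed.

End RootSpaces.

(** * Root vectors *)

Section RootVectors.
Variables (R : realType) (d : nat).
Local Notation C := R[i].
Local Notation T := 'rV[R]_d.
Local Notation TC := 'rV[C]_d.
Variable br : T -> T -> T.
Hypothesis lb : lie_bracket br.
Variables (k p h0 : {vspace T}).
Hypothesis Hkp : cartan_decomposition br k p.
Hypothesis Hh0 : maximal_abelian_in br k h0.
Variable v : T.
Hypothesis vh0 : v \in h0.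
Hypothesis cent_v : forall x, br x v = 0 -> x \in k.
Variable phi : hR_dual h0.
Hypothesis Hphi : cplx v = 'i%C *: hvec br phi.
Variables (tau tau0 : TC -> TC).
Hypothesis Htau : conjugation_fixing [set z | im_mx z = 0] tau.
Variables (e : hR_dual h0 -> TC) (Nc : hR_dual h0 -> hR_dual h0 -> R).
Hypothesis He : root_vectors br k tau tau0 e Nc.

Local Notation B := (killing (cbr br)).
Local Notation root := (is_root br).
Local Notation ep := (eps br k).
Implicit Types (a b : hR_dual h0) (z w : TC) (t s : subvs_of h0).

Let clb : lie_bracket (cbr br) := cbr_lie lb.
Let h0k : (h0 <= k)%VS. Proof. by have [] := Hh0. Qed.

Lemma hvec_elt a : exists s, hvec br a = hR_elt s.
Proof. by eexists. Qed.

Lemma killing_e a b : root a -> root b -> B (e a) (e (- b)) = (a == b)%:R.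
Proof. by move=> ra rb; rewrite (rv_killing He ra (is_rootN lb rb)) opprK. Qed.

Lemma e_neq0 a : root a -> e a != 0.
Proof.
move=> ra; apply/eqP => ea; have := killing_e ra ra.
by rewrite ea (killing0l clb) eqxx => /eqP; rewrite eq_sym oner_eq0.
Qed.

Lemma killing_hvec a t : root a -> B (hvec br a) (hR_elt t) = (a t)%:C%C.
Proof.
move=> ra; rewrite -(rv_hvec He ra) (killing_inv clb) (lbC clb) (killingNr clb).
rewrite (rv_mem He (is_rootN lb ra)) (killingZr clb) killing_e // eqxx mulr1.
by rewrite lfunE /= rmorphN opprK.
Qed.

(** At a root [a] this is the pairing [(phi, a)]; the present form is visibly linear
    in [a]. *)
Definition phival a : R := a (- vsproj h0 v).

Lemma phivalD a b : phival (a + b) = phival a + phival b.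
Proof. by rewrite /phival lfunE. Qed.
Lemma phivalN a : phival (- a) = - phival a.
Proof. by rewrite /phival lfunE. Qed.

Lemma hvec_phi : hvec br phi = hR_elt (- vsproj h0 v).
Proof.
have i2 : 'i%C * 'i%C = -1 :> C by rewrite -expr2 sqr_i.
have -> : hR_elt (- vsproj h0 v) = - ('i%C *: cplx v).
  by rewrite /hR_elt linearN /= vsprojK // [cplx _]raddfN scalerN.
by rewrite Hphi scalerA i2 scaleN1r opprK.
Qed.

Lemma dual_form_phi a : root a -> dual_form br phi a = phival a.
Proof. by move=> ra; rewrite /dual_form hvec_phi killingC killing_hvec. Qed.

Lemma ad_v_root a z : root_space br a z ->
  cbr br (cplx v) z = ('i%C * (phival a)%:C%C) *: z.
Proof.
move=> az; have := az (- vsproj h0 v); rewrite -/(phival a) -hvec_phi => h.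
by rewrite Hphi (lbZl clb) h scalerA.
Qed.

Lemma ad_v_zero z : root_space br (0 : hR_dual h0) z -> cbr br (cplx v) z = 0.
Proof. by move=> /ad_v_root ->; rewrite /phival lfunE mulr0 scale0r. Qed.

(** [a (h_a) = (a, a)], and the Killing form is positive definite on [h_R]. *)
Lemma hvec_pos a : root a -> exists2 s, hvec br a = hR_elt s & 0 < a s.
Proof.
move=> ra; have [s hs] := hvec_elt a; exists s => //.
have as_ : (a s)%:C%C = (- killing br (vsval s) (vsval s))%:C%C.
  by rewrite -(killing_hR lb) -{1}hs killing_hvec.
rewrite (complexI as_); apply: (killing_hR_gt0 Hkp Hh0).
have [a0 _] := ra; apply: contra_neq a0 => s0; apply/lfunP => t; apply: complexI.
by rewrite -killing_hvec // hs s0 /hR_elt linear0 raddf0 scaler0 (killing0l clb) lfunE.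
Qed.

(** Otherwise [g^a] contains [z != 0] orthogonal to
    [e (- a)]; then [e (- a)] kills [z], and the sl2-relations show that no
    iterate [ad (e a) ^ n z] vanishes, which gives infinitely many roots. *)
Lemma root_space_line a z : root a -> root_space br a z -> z = B z (e (- a)) *: e a.
Proof.
move=> ra az; apply/eqP; rewrite -subr_eq0; apply/eqP.
set y0 := z - _; apply: contrapT => /eqP y0n.
have ay0 : root_space br a y0.
  rewrite /y0 addrC -scaleNr; apply: root_space_lin => //; exact: (rv_mem He).
have y0e : B y0 (e (- a)) = 0.
  by rewrite /y0 (killingDl clb) (killingNl clb) (killingZl clb) killing_e // eqxx mulr1 subrr.
pose E := cbr br (e a); pose f := cbr br (e (- a)).
have ma : root (- a) := is_rootN lb ra.
have fy0 : f y0 = 0.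
  have f0 : root_space br (0 : hR_dual h0) (f y0).
    by rewrite -(addNr a); apply: root_space_br => //; exact: (rv_mem He).
  have fh t : B (f y0) (hR_elt t) = 0.
    rewrite /f (lbC clb) (killingNl clb) (killing_inv clb) (lbC clb (e (- a))).
    by rewrite (rv_mem He ma) (killingNr clb) (killingZr clb) y0e mulr0 !oppr0.
  have [t [s fE]] := root_space_zeroE lb Hkp Hh0 vh0 cent_v f0.
  have nd (u : subvs_of h0) : B (hR_elt u) (hR_elt u) = 0 -> u = 0.
    move=> Bu; apply/eqP; apply: contraT => u0.
    have := killing_hR_gt0 Hkp Hh0 u0; move: Bu; rewrite (killing_hR lb) => /complexI ->.
    by rewrite ltxx.
  have ts (r : subvs_of h0) : 'i%C * B (hR_elt t) (hR_elt r) + B (hR_elt s) (hR_elt r) = 0.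
    by have := fh r; rewrite fE (killingDl clb) (killingZl clb).
  have re0 (r : subvs_of h0) : killing br (vsval t) (vsval r) = 0 /\ killing br (vsval s) (vsval r) = 0.
    have := ts r; rewrite !(killing_hR lb) => h.
    have := congr1 (@complex.Re R) h; have := congr1 (@complex.Im R) h.
    by rewrite !ReImE /= => h1 h2; split; lra.
  have t0 : t = 0 by apply: nd; rewrite (killing_hR lb); have [-> _] := re0 t; rewrite oppr0.
  have s0 : s = 0 by apply: nd; rewrite (killing_hR lb); have [_ ->] := re0 s; rewrite oppr0.
  by rewrite fE t0 s0 /hR_elt !linear0 !raddf0 ?scaler0 ?addr0.
have [s hs as_] := hvec_pos ra.
(* [c (n + 1)] is the factor in [ad (e (- a)) (y (n + 1)) = - c (n + 1) y n]. *)
pose y n := iter n E y0; pose c n : R := \sum_(i < n) i.+1%:R * a s.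
have yroot n : root_space br (a *+ n.+1) (y n).
  elim: n => [//|n IH]; rewrite mulrS; apply: root_space_br => //; exact: (rv_mem He).
have hy n : cbr br (hvec br a) (y n) = (n.+1%:R * a s)%:C%C *: y n.
  by rewrite hs (yroot n) -scaler_nat lfunE.
have fE w : f (E w) = - cbr br (hvec br a) w + E (f w).
  by rewrite /f /E (lbJ clb) (lbC clb (e (- a))) (rv_hvec He ra) (lbNl clb).
have fy n : f (y n.+1) = - (c n.+1)%:C%C *: y n.
  elim: n => [|n IH].
    rewrite /y /= fE fy0 /E (lb0r clb) addr0 (hy 0%N) /c big_ord1 scaleNr //.
  rewrite -[y n.+2]/(E (y n.+1)) fE hy IH.
  have -> : E (- (c n.+1)%:C%C *: y n) = - (c n.+1)%:C%C *: y n.+1 by rewrite /E (lbZr clb).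
  rewrite -scaleNr -scalerDl; congr (_ *: _).
  by rewrite [c n.+2]/c big_ord_recr /= -/(c n.+1) rmorphD opprD addrC.
have cpos n : c n.+1 != 0.
  rewrite gt_eqF // /c; apply: (@lt_le_trans _ _ (a s)) => //.
  rewrite big_ord_recl mul1r lerDl; apply: sumr_ge0 => i _.
  by rewrite mulr_ge0 ?ler0n // ltW.
have yn0 n : y n != 0.
  elim: n => [//|n IH]; apply: contra_neq IH => yn.
  have := fy n; rewrite yn /f (lb0r clb) => /esym/eqP.
  rewrite scaler_eq0 oppr_eq0 => /orP[/eqP/complexI/eqP|/eqP //].
  by rewrite (negbTE (cpos n)).
have [a0 _] := ra.
have aroot n : root (a *+ n.+1).
  split; last by exists (y n).
  by rewrite -scaler_nat scaler_eq0 pnatr_eq0 (negbTE a0).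
have [rts [urts rtsP _]] := roots_finite lb Hkp Hh0.
pose l := [seq a *+ n.+1 | n <- iota 0 (size rts).+1].
have lu : uniq l.
  rewrite map_inj_uniq ?iota_uniq // => m n.
  have aE i : a *+ i.+1 = i.+1%:R *: a by rewrite scaler_nat.
  rewrite !aE => /eqP; rewrite -subr_eq0 -scalerBl scaler_eq0 (negbTE a0) orbF subr_eq0.
  by rewrite eqr_nat => /eqP[].
have : (size l <= size rts)%N.
  apply: uniq_leq_size => // b /mapP[n _ ->]; exact/rtsP.
by rewrite size_map size_iota ltnn.
Qed.

Lemma cconj_e a : root a -> cconj (e a) = (ep a)%:C%C *: e (- a).
Proof. by move=> ra; rewrite -(conjugation_fixing_real Htau) (rv_tau He). Qed.

Lemma ep_sqr a : ep a * ep a = 1.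
Proof. by rewrite /eps; case: ifP => _; rewrite ?mulrNN mulr1. Qed.

Lemma epP a : ep a = 1 \/ ep a = -1.
Proof. by rewrite /eps; case: ifP => _; [right|left]. Qed.

(** Apply conjugation twice to [e a]. *)
Lemma epN a : root a -> ep (- a) = ep a.
Proof.
move=> ra; have := congr1 (@cconj R d) (cconj_e ra).
rewrite cconjK cconjZ conjc_real (cconj_e (is_rootN lb ra)) opprK scalerA -rmorphM => h.
have : ((ep a * ep (- a))%:C%C - 1) *: e a = 0 by rewrite scalerBl scale1r -h subrr.
move/eqP; rewrite scaler_eq0 (negbTE (e_neq0 ra)) orbF subr_eq0 => /eqP/complexI h1.
by rewrite -[RHS]mulr1 -h1 mulrA ep_sqr mul1r.
Qed.

(** Conjugating the relation [[e a, e b] = N e (a + b)] compares the types of [a],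
    [b] and [a + b]. *)
Lemma epD a b : root a -> root b -> root (a + b) -> ep (a + b) = - (ep a * ep b).
Proof.
move=> ra rb rab; have [Nn0 _ NN _ _] := rv_Nc He ra rb rab.
have ra' := is_rootN lb ra; have rb' := is_rootN lb rb.
have rab' := is_rootN lb rab; rewrite opprD in rab'.
have := congr1 (@cconj R d) (rv_br He ra rb rab).
rewrite (cconj_br lb) !cconj_e // cconjZ conjc_real cconj_e //.
rewrite (lbZl clb) (lbZr clb) (rv_br He ra' rb' rab') opprD NN !scalerA -!rmorphM.
move/eqP; rewrite -subr_eq0 -scalerBl scaler_eq0 (negbTE (e_neq0 rab')) orbF -rmorphB.
move=> /eqP/complexI h.
have : Nc a b * (ep (a + b) + ep a * ep b) = 0 by rewrite -oppr0 -[in RHS]h; ring.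
by move/eqP; rewrite mulf_eq0 (negbTE Nn0) /= addr_eq0 => /eqP.
Qed.

Lemma root_spaceP a z : root_space br a z <->
  forall t, br (vsval t) (re_mx z) = a t *: im_mx z /\ br (vsval t) (im_mx z) = - a t *: re_mx z.
Proof.
have E t : cbr br (hR_elt t) z = 'i%C *: (cplx (br (vsval t) (re_mx z)) + 'i%C *: cplx (br (vsval t) (im_mx z))).
  by rewrite /hR_elt (lbZl clb) {1}[z]cplxE (lbDr clb) (lbZr clb) !(cbr_cplx lb).
split=> az t.
  have := az t; rewrite E; set X := br _ _; set Y := br _ _ => h.
  have := congr1 (@re_mx R d) h; have := congr1 (@im_mx R d) h.
  rewrite re_mx_i im_mx_i re_mk im_mk re_mx_r im_mx_r => -> /eqP.
  by rewrite eqr_oppLR scaleNr => /eqP.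
have [h1 h2] := az t; rewrite E h1 h2; apply: reim_eq.
  by rewrite re_mx_i im_mk re_mx_r scaleNr opprK.
by rewrite im_mx_i re_mk im_mx_r.
Qed.

Lemma complexifiedZ (S : {vspace T}) (l : C) z : complexified S z -> complexified S (l *: z).
Proof.
by move=> [rz iz]; split; rewrite ?re_mxZ ?im_mxZ; [apply: rpredB|apply: rpredD]; apply: rpredZ.
Qed.

(** The components of [e a] in the complexifications of [k] and [p] both lie in the
    root space, which is a line, so one of them vanishes. *)
Lemma root_compactness a : root a -> compact_root br k a \/ noncompact_root br p a.
Proof.
move=> ra; have ea := rv_mem He ra.
pose kz : TC := cplx (kpart k p (re_mx (e a))) + 'i%C *: cplx (kpart k p (im_mx (e a))).
pose pz : TC := cplx (ppart k p (re_mx (e a))) + 'i%C *: cplx (ppart k p (im_mx (e a))).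
have kpE : e a = kz + pz.
  rewrite [LHS]cplxE -{1}(kpart_add Hkp (re_mx _)) -{1}(kpart_add Hkp (im_mx _)).
  by rewrite !raddfD /= ?scalerDr addrACA.
have kza : root_space br a kz.
  apply/root_spaceP => t; rewrite re_mk im_mk; have [h1 h2] := (root_spaceP a (e a)).1 ea t.
  have tk : vsval t \in k by apply: (subvP h0k); exact: subvsP.
  have [<- _] := parts_br lb Hkp (re_mx (e a)) tk.
  have [<- _] := parts_br lb Hkp (im_mx (e a)) tk.
  by rewrite h1 h2 /kpart !linearZ.
have kc : complexified k kz by split; rewrite ?re_mk ?im_mk; exact: kpart_in.
have pc : complexified p pz by split; rewrite ?re_mk ?im_mk; exact: ppart_in.
have kzE := root_space_line ra kza.
set l := B kz _ in kzE; have [l0|l0] := eqVneq l 0.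
  right; split=> // z az; rewrite (root_space_line ra az); apply: complexifiedZ.
  by rewrite kpE kzE l0 scale0r add0r.
left; split=> // z az; rewrite (root_space_line ra az); apply: complexifiedZ.
rewrite -[e a]scale1r -(mulVf l0) -scalerA -kzE; exact: complexifiedZ.
Qed.

Lemma compact_rootP a : root a -> compact_root br k a <-> ep a = -1.
Proof.
move=> ra; rewrite /eps; case: asboolP => // nc; split=> // /eqP.
by rewrite eq_sym -subr_eq0 -opprD oppr_eq0 -mulr2n pnatr_eq0.
Qed.

Lemma noncompact_rootP a : root a -> noncompact_root br p a <-> ep a = 1.
Proof.
move=> ra; split=> [[_ np]|e1].
  rewrite /eps; case: asboolP => // -[_ nk]; exfalso.
  have [rk ik] := nk _ (rv_mem He ra); have [rp ip] := np _ (rv_mem He ra).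
  have z0 x : x \in k -> x \in p -> x = 0.
    move=> xk xp; apply/eqP; rewrite -memv0 -(cartan_cap Hkp) memv_cap xk; exact: xp.
  have := e_neq0 ra; rewrite [e a]cplxE (z0 _ rk rp) (z0 _ ik ip) !raddf0 ?scaler0 ?addr0.
  by rewrite eqxx.
have [/(compact_rootP ra)|//] := root_compactness ra; rewrite e1 => /eqP.
by rewrite -subr_eq0 opprK -mulr2n pnatr_eq0.
Qed.

End RootVectors.

(** * Traces of bilinear forms *)

Section BilinearTrace.
Variables (C : comNzRingType) (V : lmodType C).
Variable G : V -> V -> C.
Hypothesis Gl : forall z' l z1 z2, G (l *: z1 + z2) z' = l * G z1 z' + G z2 z'.

Lemma scalar_sum (h : V -> C) :
  (forall l z z', h (l *: z + z') = l * h z + h z') ->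
  forall I (r : seq I) (ka : I -> C) (F : I -> V),
  h (\sum_(i <- r) ka i *: F i) = \sum_(i <- r) ka i * h (F i).
Proof.
move=> hl I r ka F.
have hz : h 0 = 0 by have := hl (-1) 0 0; rewrite scaler0 addr0 mulN1r addNr.
elim: r => [|i r IH]; first by rewrite !big_nil.
by rewrite !big_cons hl IH.
Qed.

Variables (n : nat) (F F' : 'I_n -> V).

(** The orthogonal projection onto the span of the vectors [F i] and [F' i], when
    these are orthonormal. *)
Definition onb_proj (z : V) : V := \sum_i (G z (F i) *: F i + G z (F' i) *: F' i).

Lemma onb_proj_linear l z z' : onb_proj (l *: z + z') = l *: onb_proj z + onb_proj z'.
Proof.
rewrite /onb_proj scaler_sumr -big_split; apply: eq_bigr => i _ /=.
by rewrite !Gl !scalerDl scalerDr !scalerA; exact: addrACA.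
Qed.

Lemma eq_onb_proj z u : G z =1 G u -> onb_proj z = onb_proj u.
Proof. by move=> zu; apply: eq_bigr => i _; rewrite !zu. Qed.

Lemma onb_proj_span (s t : 'I_n -> C) (z : V) :
  (forall i j, G (F i) (F j) = (i == j)%:R) ->
  (forall i j, G (F' i) (F' j) = (i == j)%:R) ->
  (forall i j, G (F i) (F' j) = 0) -> (forall i j, G (F' i) (F j) = 0) ->
  z = \sum_i (s i *: F i + t i *: F' i) -> z = onb_proj z.
Proof.
move=> FF F'F' FF' F'F zE.
have gz z' : G z z' = \sum_i (s i * G (F i) z' + t i * G (F' i) z').
  rewrite zE !big_split /= -[\sum_i s i *: F i]scale1r Gl mul1r.
  by rewrite !(@scalar_sum (G^~ z') (Gl z')).
rewrite {1}zE; apply: eq_bigr => i _; congr (_ *: _ + _ *: _).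
  rewrite gz (bigD1 i) //= FF F'F eqxx mulr1 mulr0 addr0 big1 ?addr0 // => j ji.
  by rewrite FF F'F (negbTE ji) !mulr0 addr0.
rewrite gz (bigD1 i) //= FF' F'F' eqxx mulr1 mulr0 add0r big1 ?addr0 // => j ji.
by rewrite FF' F'F' (negbTE ji) !mulr0 addr0.
Qed.

(** A trace does not depend on the basis: expanding the first argument in the basis
    [e], whose dual basis consists of the [k a *: e' a], leaves in the second
    argument the orthonormal expansion of [e' a]. The operator [p1] is the
    projection onto the subspace spanned by these bases. *)
Lemma bilinear_trace (I : eqType) (r : seq I) (e e' : I -> V) (k : I -> C)
    (p1 : V -> V) (Q : V -> V -> C) :
  (forall z, p1 z = onb_proj z) ->
  (forall z, p1 z = \sum_(a <- r) (k a * G (e' a) z) *: e a) ->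
  (forall i, p1 (F i) = F i) -> (forall i, p1 (F' i) = F' i) ->
  {in r, forall a, p1 (e' a) = e' a} ->
  (forall z' l z1 z2, Q (l *: z1 + z2) z' = l * Q z1 z' + Q z2 z') ->
  (forall z l z1 z2, Q z (l *: z1 + z2) = l * Q z z1 + Q z z2) ->
  \sum_i (Q (F i) (F i) + Q (F' i) (F' i)) = \sum_(a <- r) k a * Q (e a) (e' a).
Proof.
move=> p1E p1e pF pF' pe' Ql Qr.
have Q1 z z' : p1 z = z -> Q z z' = \sum_(a <- r) k a * (G (e' a) z * Q (e a) z').
  move=> pz; rewrite -{1}pz p1e (@scalar_sum (Q^~ z') (Ql z')).
  by apply: eq_bigr => a _; rewrite mulrA.
rewrite (eq_bigr (fun i => \sum_(a <- r) k a *
  (G (e' a) (F i) * Q (e a) (F i) + G (e' a) (F' i) * Q (e a) (F' i)))).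
  rewrite exchange_big; apply: eq_big_seq => a ar /=.
  rewrite -mulr_sumr; congr (_ * _); rewrite -[in RHS](pe' a ar) p1E /onb_proj.
  rewrite !big_split /= -[\sum_i _ *: F i]scale1r Qr mul1r.
  by rewrite !(@scalar_sum (Q (e a)) (Qr (e a))).
move=> i _; rewrite (Q1 _ _ (pF i)) (Q1 _ _ (pF' i)) -big_split.
by apply: eq_bigr => a _ /=; rewrite mulrDr.
Qed.

End BilinearTrace.

(** * Reduction to the base point of the orbit *)

Section Equivariance.
Variables (R : realType) (d : nat).
Local Notation T := 'rV[R]_d.

(** [symplectic_onb] and [nijenhuis_sqnorm] at one point, for an arbitrary
    tangent space [t], form [om], complex structure [J] and tensor [N]. *)
Definition is_onb (t : set T) (om : T -> T -> R) (J : T -> T) (n : nat)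
    (f : 'I_n -> T) : Prop :=
  [/\ (forall i, t (f i) /\ t (J (f i))),
      (forall i j, om (f i) (J (f j)) = (i == j)%:R /\
                   om (J (f i)) (J (J (f j))) = (i == j)%:R),
      (forall i j, om (f i) (J (J (f j))) = 0 /\ om (J (f i)) (J (f j)) = 0) &
      (forall w, t w -> exists a b : 'I_n -> R,
         w = \sum_(i < n) (a i *: f i + b i *: J (f i)))].

Definition has_sqnorm (t : set T) (om : T -> T -> R) (J : T -> T)
    (N : T -> T -> T) (r : R) : Prop :=
  (exists n (f : 'I_n -> T), is_onb t om J f) /\
  (forall n (f : 'I_n -> T), is_onb t om J f ->
     2 * \sum_(i < n) \sum_(j < n) om (N (f i) (f j)) (J (N (f i) (f j))) = r).

Variable br : T -> T -> T.
Hypothesis lb : lie_bracket br.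
Variables (K : groupType) (Ad : K -> T -> T).
Hypothesis AdL : forall g, linear (Ad g).
Hypothesis AdM : forall g h x, Ad (g * h)%g x = Ad g (Ad h x).
Hypothesis AdK : forall g x, Ad g^-1%g (Ad g x) = x.
Hypothesis AdVK : forall g x, Ad g (Ad g^-1%g x) = x.
Hypothesis Adbr : forall g x y, br (Ad g x) (Ad g y) = Ad g (br x y).

Variables (v : T) (J : T -> T -> T).
Let tan (q : T) : set T := [set br x q | x in setT].
Hypothesis Jlin0 : forall (a : R) w w', tan v w -> tan v w' ->
  J v (a *: w + w') = a *: J v w + J v w'.
Hypothesis Jinv0 : forall g w, tan v w -> J (Ad g v) (Ad g w) = Ad g (J v w).
Hypothesis JJ0 : forall w, tan v w -> J v (J v w) = - w.
Hypothesis Jtan0 : forall w, tan v w -> tan v (J v w).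

Lemma tan_Ad g q w : tan q w -> tan (Ad g q) (Ad g w).
Proof. by move=> [x _ <-]; exists (Ad g x). Qed.

Lemma tan_AdV h q w : tan (Ad h q) w -> exists2 w0, tan q w0 & w = Ad h w0.
Proof.
move=> tw; exists (Ad h^-1%g w); last by rewrite AdVK.
by rewrite -(AdK h q); exact: tan_Ad.
Qed.

Lemma tan_lin q (a : R) w w' : tan q w -> tan q w' -> tan q (a *: w + w').
Proof. by move=> [x _ <-] [y _ <-]; exists (a *: x + y) => //; exact: (lbL lb). Qed.

Lemma J_equivariant g q w : [set Ad h v | h in setT] q -> tan q w ->
  J (Ad g q) (Ad g w) = Ad g (J q w).
Proof.
move=> [h _ <-] /tan_AdV[w0 tw0 ->].
by rewrite -!AdM !Jinv0 // AdM.
Qed.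

Lemma J_linear q (a : R) w w' : [set Ad h v | h in setT] q -> tan q w -> tan q w' ->
  J q (a *: w + w') = a *: J q w + J q w'.
Proof.
move=> [h _ <-] /tan_AdV[w0 tw0 ->] /tan_AdV[w1 tw1 ->].
by rewrite -AdL !Jinv0 // ?Jlin0 ?AdL //; exact: tan_lin.
Qed.

Lemma J_squared q w : [set Ad h v | h in setT] q -> tan q w -> J q (J q w) = - w.
Proof.
move=> [h _ <-] /tan_AdV[w0 tw0 ->].
rewrite Jinv0 // Jinv0; last exact: Jtan0.
by rewrite JJ0 // -scaleN1r -[_ *: w0]addr0 AdL (linear_on0 (AdL h)) addr0 scaleN1r.
Qed.

Variable N : T -> T -> T -> T.
Hypothesis N_fund : forall q x y x' y', [set Ad h v | h in setT] q ->
  br x' q = J q (br x q) -> br y' q = J q (br y q) ->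
  4 *: N q (br x q) (br y q) =
    br (br x' y' - br x y) q - J q (br (br x' y + br x y') q).

Let four0 : (4 : R) != 0. Proof. by rewrite pnatr_eq0. Qed.
Let vv : [set Ad h v | h in setT] v.
Proof. by exists 1%g => //; rewrite -{1}(AdK 1%g v) invg1 -AdM mulg1 -[X in Ad X _]invg1 AdK. Qed.
Let AdZ g (a : R) w : Ad g (a *: w) = a *: Ad g w.
Proof. by rewrite -[_ *: w]addr0 AdL (linear_on0 (AdL g)) addr0. Qed.
Let AdD g w w' : Ad g (w + w') = Ad g w + Ad g w'.
Proof. by rewrite -[w]scale1r AdL !scale1r. Qed.
Let AdB g w w' : Ad g (w - w') = Ad g w - Ad g w'.
Proof. by rewrite AdD -scaleN1r AdZ scaleN1r. Qed.

Lemma N_tan w w' : tan v w -> tan v w' -> tan v (N v w w').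
Proof.
move=> [x _ <-] [y _ <-].
have [x' _ xE] : tan v (J v (br x v)) by apply: Jtan0; exists x.
have [y' _ yE] : tan v (J v (br y v)) by apply: Jtan0; exists y.
have h := N_fund vv xE yE.
rewrite -[N _ _ _](scalerK four0) h -[_ *: _]addr0; apply: tan_lin; last first.
  by exists 0 => //; exact: (lb0l lb).
rewrite addrC -scaleN1r; apply: tan_lin; last by exists (br x' y' - br x y).
by apply: Jtan0; exists (br x' y + br x y').
Qed.

(** On fundamental fields [N] is expressed by the bracket and by [J], both of which
    are equivariant. *)
Lemma N_equivariant g w w' : tan v w -> tan v w' ->
  N (Ad g v) (Ad g w) (Ad g w') = Ad g (N v w w').
Proof.
move=> [x _ <-] [y _ <-].
have tx u : tan v (br u v) by exists u.
have [x' _ xE] : tan v (J v (br x v)) by apply: Jtan0; exists x.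
have [y' _ yE] : tan v (J v (br y v)) by apply: Jtan0; exists y.
have gv : [set Ad h v | h in setT] (Ad g v) by exists g.
have xE' : br (Ad g x') (Ad g v) = J (Ad g v) (br (Ad g x) (Ad g v)).
  by rewrite !Adbr xE Jinv0.
have yE' : br (Ad g y') (Ad g v) = J (Ad g v) (br (Ad g y) (Ad g v)).
  by rewrite !Adbr yE Jinv0.
have h := N_fund vv xE yE; have h' := N_fund gv xE' yE'.
apply: (scalerI four0); rewrite -AdZ h -!Adbr h' !Adbr -AdB -AdD !Adbr.
by rewrite Jinv0 // AdB.
Qed.

Variable om : T -> T -> T -> R.
Hypothesis om0 : forall g w w', tan v w -> tan v w' ->
  om (Ad g v) (Ad g w) (Ad g w') = om v w w'.

Let Ad_sum g n (F : 'I_n -> T) : Ad g (\sum_i F i) = \sum_i Ad g (F i).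
Proof.
apply: (big_morph (Ad g)); first exact: AdD.
exact: linear_on0.
Qed.

Lemma is_onb_Ad g n (f : 'I_n -> T) :
  is_onb (tan v) (om v) (J v) f <->
  is_onb (tan (Ad g v)) (om (Ad g v)) (J (Ad g v)) (fun i => Ad g (f i)).
Proof.
have tJ w : tan v w -> tan v (J v w) := @Jtan0 w.
split=> [[tf f1 f0 fs]|[tf f1 f0 fs]].
  have t1 i : tan v (f i) by have [] := tf i.
  split=> [i|i j|i j|w /tan_AdV[w0 /fs[a [b w0E]] ->]].
  - by rewrite Jinv0 //; split; apply: tan_Ad; auto.
  - by rewrite !Jinv0 ?om0; auto.
  - by rewrite !Jinv0 ?om0; auto.
  - exists a, b; rewrite w0E Ad_sum; apply: eq_bigr => i _.
    by rewrite AdD !AdZ Jinv0.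
have t1 i : tan v (f i).
  have [w0 tw0 fE] := tan_AdV (tf i).1.
  by rewrite -(AdK g (f i)) fE AdK.
have E1 i j : om (Ad g v) (Ad g (f i)) (J (Ad g v) (Ad g (f j))) = om v (f i) (J v (f j)).
  by rewrite !Jinv0 ?om0; auto.
have E2 i j : om (Ad g v) (J (Ad g v) (Ad g (f i))) (J (Ad g v) (J (Ad g v) (Ad g (f j)))) =
    om v (J v (f i)) (J v (J v (f j))).
  by rewrite !Jinv0 ?om0; auto.
have E3 i j : om (Ad g v) (Ad g (f i)) (J (Ad g v) (J (Ad g v) (Ad g (f j)))) =
    om v (f i) (J v (J v (f j))).
  by rewrite !Jinv0 ?om0; auto.
have E4 i j : om (Ad g v) (J (Ad g v) (Ad g (f i))) (J (Ad g v) (Ad g (f j))) =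
    om v (J v (f i)) (J v (f j)).
  by rewrite !Jinv0 ?om0; auto.
split=> [i|i j|i j|w tw].
- by split; auto.
- by have := f1 i j; rewrite E1 E2.
- by have := f0 i j; rewrite E3 E4.
- have [a [b wE]] := fs _ (tan_Ad g tw); exists a, b.
  rewrite -[LHS](AdK g) wE Ad_sum; apply: eq_bigr => i _.
  by rewrite Jinv0 // AdD !AdZ !AdK.
Qed.

Lemma has_sqnorm_Ad g r : has_sqnorm (tan v) (om v) (J v) (N v) r ->
  has_sqnorm (tan (Ad g v)) (om (Ad g v)) (J (Ad g v)) (N (Ad g v)) r.
Proof.
move=> [[n [f fo]] nr]; split.
  by exists n, (fun i => Ad g (f i)); apply/is_onb_Ad.
move=> m f1 f1o; pose f0 i := Ad g^-1%g (f1 i).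
have fE : f1 = (fun i => Ad g (f0 i)) by apply/funext => i; rewrite /f0 AdVK.
rewrite fE in f1o *; have f0o := (is_onb_Ad g f0).2 f1o.
rewrite -(nr _ _ f0o); congr (_ * _); apply: eq_bigr => i _; apply: eq_bigr => j _.
have t0 l : tan v (f0 l) by have [t _ _ _] := f0o; have [] := t l.
have tN := N_tan (t0 i) (t0 j).
rewrite N_equivariant // Jinv0 // om0 //; exact: Jtan0.
Qed.

End Equivariance.

(** * Root coordinates on the tangent space *)

Section RootCoordinates.
Variables (R : realType) (d : nat).
Local Notation C := R[i].
Local Notation T := 'rV[R]_d.
Local Notation TC := 'rV[C]_d.
Variable br : T -> T -> T.
Hypothesis lb : lie_bracket br.
Variables (k p h0 : {vspace T}).
Hypothesis Hkp : cartan_decomposition br k p.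
Hypothesis Hh0 : maximal_abelian_in br k h0.
Variable v : T.
Hypothesis vh0 : v \in h0.
Hypothesis cent_v : forall x, br x v = 0 -> x \in k.
Variable phi : hR_dual h0.
Hypothesis Hphi : cplx v = 'i%C *: hvec br phi.
Variables (tau tau0 : TC -> TC).
Hypothesis Htau : conjugation_fixing [set z | im_mx z = 0] tau.
Variables (e : hR_dual h0 -> TC) (Nc : hR_dual h0 -> hR_dual h0 -> R).
Hypothesis He : root_vectors br k tau tau0 e Nc.
Variable rts : seq (hR_dual h0).
Hypothesis urts : uniq rts.
Hypothesis rtsP : forall a, a \in rts <-> is_root br a.
Hypothesis rts_ext : forall f : TC -> TC, linear f ->
    (forall z, root_space br (0 : hR_dual h0) z -> f z = 0) ->
    (forall (a : hR_dual h0) z, is_root br a -> root_space br a z -> f z = 0) -> forall z, f z = 0.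

Local Notation B := (killing (cbr br)).
Local Notation root := (is_root br).
Local Notation ep := (eps br k).
Local Notation phiv := (phival v).
Implicit Types (a b : hR_dual h0) (z : TC) (x y : T).

Let clb : lie_bracket (cbr br) := cbr_lie lb.

(** The root vectors [e a], [a] in this list, form a basis of the complexified
    tangent space of the orbit at [v]. *)
Definition mroots : seq (hR_dual h0) := [seq a <- rts | phiv a != 0].

Lemma mrootsP a : a \in mroots <-> root a /\ phiv a != 0.
Proof. by rewrite mem_filter; split=> [/andP[? /rtsP]|[/rtsP -> ->]]. Qed.

Lemma mroot_root a : a \in mroots -> root a. Proof. by move=> /mrootsP[]. Qed.
Lemma mroot_neq0 a : a \in mroots -> phiv a != 0. Proof. by move=> /mrootsP[]. Qed.
Lemma mroots_uniq : uniq mroots. Proof. exact: filter_uniq. Qed.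

Lemma mrootN a : a \in mroots -> - a \in mroots.
Proof.
by move=> /mrootsP[ra pa]; apply/mrootsP; split; [exact: is_rootN|rewrite phivalN oppr_eq0].
Qed.

Lemma mrootNE a : (- a \in mroots) = (a \in mroots).
Proof. by apply/idP/idP => /mrootN //; rewrite opprK. Qed.

Lemma sum_mrootsN (V : nmodType) (F : hR_dual h0 -> V) :
  \sum_(a <- mroots) F (- a) = \sum_(a <- mroots) F a.
Proof.
rewrite -(big_map (fun a => - a) xpredT F); apply: perm_big.
apply: uniq_perm; rewrite ?mroots_uniq // ?(map_inj_uniq oppr_inj) ?mroots_uniq // => a.
apply/mapP/idP => [[b bm ->]|am]; first by rewrite mrootNE.
by exists (- a); rewrite ?mrootNE // opprK.
Qed.

(** The coordinate of [z] on [e a], as [e a] and [e (- a)] are dual for the Killing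
    form. *)
Definition coef a z : C := B z (e (- a)).

Lemma coefP a (l : C) z w : coef a (l *: z + w) = l * coef a z + coef a w.
Proof. by rewrite /coef (killingP clb). Qed.
Lemma coefZ a (l : C) z : coef a (l *: z) = l * coef a z.
Proof. by rewrite /coef (killingZl clb). Qed.
Lemma coef_sum a I (r : seq I) (Q : pred I) (F : I -> TC) :
  coef a (\sum_(i <- r | Q i) F i) = \sum_(i <- r | Q i) coef a (F i).
Proof. exact: killing_suml. Qed.

Lemma coef_e a b : root a -> root b -> coef a (e b) = (b == a)%:R.
Proof. by move=> ra rb; exact: (killing_e lb He). Qed.

Lemma coef_zero a z : root a -> root_space br (0 : hR_dual h0) z -> coef a z = 0.
Proof.
move=> ra z0; apply: (root_space_orth lb z0 (rv_mem He (is_rootN lb ra))).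
by have [a0 _] := ra; rewrite add0r oppr_eq0.
Qed.

(** The operators that are diagonal in root coordinates: [ad v], [J], the projection
    onto the tangent space and the inverse of [x |-> [x, v]] on it are all of this
    form. *)
Definition Dg (kappa : hR_dual h0 -> C) z : TC :=
  \sum_(a <- mroots) (kappa a * coef a z) *: e a.

Lemma Dg_linear ka : linear (Dg ka).
Proof.
move=> l z w; rewrite /Dg scaler_sumr -big_split /=; apply: eq_bigr => a _.
by rewrite coefP scalerA -scalerDl mulrDr mulrCA.
Qed.
Lemma Dg0 ka : Dg ka 0 = 0. Proof. exact/linear_on0/Dg_linear. Qed.
Lemma DgD ka z w : Dg ka (z + w) = Dg ka z + Dg ka w.
Proof. by have := Dg_linear ka 1 z w; rewrite !scale1r. Qed.
Lemma DgZ ka l z : Dg ka (l *: z) = l *: Dg ka z.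
Proof. by have := Dg_linear ka l z 0; rewrite !addr0 Dg0 addr0. Qed.
Lemma DgN ka z : Dg ka (- z) = - Dg ka z.
Proof. by rewrite -scaleN1r DgZ scaleN1r. Qed.
Lemma DgB ka z w : Dg ka (z - w) = Dg ka z - Dg ka w.
Proof. by rewrite DgD DgN. Qed.

Lemma eq_Dg ka ka' z : {in mroots, ka =1 ka'} -> Dg ka z = Dg ka' z.
Proof. by move=> kk; apply: eq_big_seq => a am; rewrite kk. Qed.

Lemma Dg_opp ka z : Dg (fun a => - ka a) z = - Dg ka z.
Proof. by rewrite /Dg -sumrN; apply: eq_bigr => a _; rewrite mulNr scaleNr. Qed.

Lemma sum_mroots_delta (F : hR_dual h0 -> TC) (G : hR_dual h0 -> C) b :
  \sum_(a <- mroots) (G a * (b == a)%:R) *: F a = if b \in mroots then G b *: F b else 0.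
Proof.
case: ifPn => bm.
  rewrite (bigD1_seq b) ?mroots_uniq //= eqxx mulr1 big1 ?addr0 // => a ab.
  by rewrite eq_sym (negbTE ab) mulr0 scale0r.
rewrite big1_seq // => a /andP[_ am]; case: eqP => [ba|_]; last by rewrite mulr0 scale0r.
by rewrite ba am in bm.
Qed.

Lemma Dg_e ka b : root b -> Dg ka (e b) = if b \in mroots then ka b *: e b else 0.
Proof.
move=> rb; rewrite -sum_mroots_delta; apply: eq_big_seq => a /mroot_root ra.
by rewrite coef_e.
Qed.

Lemma Dg_mroot ka b : b \in mroots -> Dg ka (e b) = ka b *: e b.
Proof. by move=> bm; rewrite Dg_e ?bm //; exact: mroot_root. Qed.

Lemma Dg_zero ka z : root_space br (0 : hR_dual h0) z -> Dg ka z = 0.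
Proof.
move=> z0; rewrite /Dg big1_seq // => a /andP[_ /mroot_root ra].
by rewrite coef_zero // mulr0 scale0r.
Qed.

Lemma coef_Dg ka b z : b \in mroots -> coef b (Dg ka z) = ka b * coef b z.
Proof.
move=> bm; have rb := mroot_root bm; rewrite /Dg coef_sum (bigD1_seq b) ?mroots_uniq //=.
rewrite coefZ coef_e // eqxx mulr1 big1_seq ?addr0 // => a /andP[ab /mroot_root ra].
by rewrite coefZ coef_e // (negbTE ab) mulr0.
Qed.

Lemma DgDg ka ka' z : Dg ka (Dg ka' z) = Dg (fun a => ka a * ka' a) z.
Proof. by apply: eq_big_seq => a am; rewrite coef_Dg // mulrA. Qed.

Lemma Dg_sum I (r : seq I) (ka : I -> hR_dual h0 -> C) z :
  \sum_(i <- r) Dg (ka i) z = Dg (fun a => \sum_(i <- r) ka i a) z.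
Proof.
rewrite /Dg exchange_big; apply: eq_bigr => a _ /=.
by rewrite -scaler_suml -mulr_suml.
Qed.

Lemma coef_conj a z : root a -> (coef a z)^*%C = (ep a)%:C%C * coef (- a) (cconj z).
Proof.
move=> ra; rewrite /coef -(cconj_killing lb) (cconj_e Htau He (is_rootN lb ra)).
by rewrite (killingZr clb) (epN lb Htau He ra).
Qed.

Lemma cconj_Dg ka z : cconj (Dg ka z) = Dg (fun a => (ka (- a))^*%C) (cconj z).
Proof.
rewrite /Dg cconj_sum -(sum_mrootsN (fun a => cconj _)); apply: eq_big_seq => a am.
have ra := mroot_root am; have rma := is_rootN lb ra.
rewrite cconjZ rmorphM /= (coef_conj _ rma) (cconj_e Htau He rma) !opprK scalerA.
rewrite (epN lb Htau He ra); congr (_ *: _).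
have epC : (ep a)%:C%C * (ep a)%:C%C = 1 :> C by rewrite -rmorphM ep_sqr.
have solve (x y s : C) : s * s = 1 -> x * (s * y) * s = x * y.
  by move=> ss; rewrite (mulrC s y) -!mulrA ss mulr1.
exact: solve.
Qed.

Definition self_conj (ka : hR_dual h0 -> C) := {in mroots, forall a, (ka (- a))^*%C = ka a}.

(** Meaningful when the eigenvalues are [self_conj]: the operator is then real. *)
Definition Dr ka x : T := re_mx (Dg ka (cplx x)).

Lemma cplx_Dr ka x : self_conj ka -> cplx (Dr ka x) = Dg ka (cplx x).
Proof.
move=> kr; apply: cconj_real; rewrite cconj_Dg cconj_cplx; exact: eq_Dg.
Qed.

Let iC (r : R) : C := 'i%C * r%:C%C.
Let iCr (r : R) : (iC r)^*%C = iC (- r).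
Proof. by apply: complex_eq; rewrite /iC ?ReImE /= ?ReImE /=; ring. Qed.
Let iCM (r s : R) : iC r * iC s = (- (r * s))%:C%C.
Proof. by apply: complex_eq; rewrite /iC !ReImE /=; ring. Qed.

(** The eigenvalues on [e a] of [ad v], of [x |-> [x, v]], of the inverse of the
    latter on the tangent space, and of [J]. *)
Definition kad a : C := iC (phiv a).
Definition krho a : C := iC (- phiv a).
Definition kS a : C := iC (phiv a)^-1.
Definition jsgn a : R := ep a * Num.sg (phiv a).
Definition kJ a : C := iC (jsgn a).

Lemma jsgnN a : root a -> jsgn (- a) = - jsgn a.
Proof. by move=> ra; rewrite /jsgn (epN lb Htau He ra) phivalN sgrN mulrN. Qed.

Lemma jsgn_sqr a : a \in mroots -> jsgn a * jsgn a = 1.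
Proof.
move=> am; rewrite /jsgn mulrACA ep_sqr mul1r -expr2 sqr_sg.
by rewrite (mroot_neq0 am).
Qed.

Lemma self_kS : self_conj kS.
Proof. by move=> a _; rewrite /kS iCr phivalN invrN opprK. Qed.
Lemma self_kJ : self_conj kJ.
Proof. by move=> a am; rewrite /kJ iCr jsgnN ?opprK //; exact: mroot_root. Qed.
Lemma self_one : self_conj (fun=> 1).
Proof. by move=> a am; rewrite conjc1. Qed.
Lemma self_mul ka ka' : self_conj ka -> self_conj ka' -> self_conj (fun a => ka a * ka' a).
Proof. by move=> h h' a am; rewrite rmorphM /= h // h'. Qed.

Lemma krhoS a : a \in mroots -> krho a * kS a = 1.
Proof. by move=> am; rewrite iCM mulNr opprK mulfV ?(mroot_neq0 am). Qed.

(** Both sides agree on the zero weight space and on each root line. *)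
Lemma ad_v_Dg z : cbr br (cplx v) z = Dg kad z.
Proof.
apply/eqP; rewrite -subr_eq0; apply/eqP; move: z; apply: rts_ext.
- move=> l z w; rewrite (lbR clb) Dg_linear scalerBr; rewrite opprD addrACA; congr (_ + _).
- by move=> z z0; rewrite (ad_v_zero lb vh0 Hphi z0) Dg_zero // subr0.
- move=> a z ra az.
  rewrite (ad_v_root lb vh0 Hphi az).
  rewrite (root_space_line lb Hkp Hh0 vh0 cent_v He ra az) DgZ Dg_e //.
  case: ifPn => am; first by rewrite !scalerA [_ * kad a]mulrC subrr.
  rewrite scaler0 subr0; have [->|p0] := eqVneq (phiv a) 0; first by rewrite mulr0 scale0r.
  by case/negP: am; apply/mrootsP.
Qed.

Lemma cplx_br_v x : cplx (br x v) = Dg krho (cplx x).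
Proof.
rewrite (lbC lb) raddfN /= -(cbr_cplx lb) ad_v_Dg -scaleN1r -DgZ /Dg.
apply: eq_bigr => a _; rewrite coefZ mulrA; congr (_ * _ *: _).
by apply: complex_eq; rewrite /kad /krho /iC !ReImE /=; ring.
Qed.

Definition tangent_v (w : T) : Prop := exists x, w = br x v.

Lemma tangentP (w : T) : tangent_v w <-> cplx w = Dg (fun=> 1) (cplx w).
Proof.
split=> [[x ->]|w1].
  by rewrite cplx_br_v DgDg; apply: eq_Dg => a _; rewrite mul1r.
exists (Dr kS w); apply: cplx_inj; rewrite cplx_br_v (cplx_Dr _ self_kS) DgDg {1}w1.
by apply: eq_Dg => a am; rewrite krhoS.
Qed.

Lemma tangent_Dr ka (w : T) : self_conj ka -> tangent_v (Dr ka w).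
Proof.
by move=> kr; apply/tangentP; rewrite (cplx_Dr _ kr) DgDg; apply: eq_Dg => a _; rewrite mul1r.
Qed.

Lemma br_Dr_kS (w : T) : tangent_v w -> br (Dr kS w) v = w.
Proof.
move=> /tangentP w1; apply: cplx_inj; rewrite cplx_br_v (cplx_Dr _ self_kS) DgDg [RHS]w1.
by apply: eq_Dg => a am; rewrite krhoS.
Qed.

(** * The almost complex structure and the metric *)

Implicit Types w : T.
Variable P : set (hR_dual h0).
Hypothesis HP : positive_system br P.
Hypothesis HphiP : forall a, P a -> 0 <= dual_form br phi a.

(** [phi] is dominant. *)
Lemma mroot_pos a : a \in mroots -> (0 < phiv a) = `[< P a >].
Proof.
move=> am; have ra := mroot_root am; have [Pr Ptot _ _] := HP.
have pos b : P b -> 0 <= phiv b.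
  by move=> Pb; rewrite -(dual_form_phi lb vh0 Hphi He) ?HphiP //; exact: Pr.
apply/idP/asboolP => [pa|/pos]; last by rewrite lt_def (mroot_neq0 am).
have [//|/pos] := Ptot a ra; rewrite phivalN oppr_ge0 => h.
by have := lt_le_trans pa h; rewrite ltxx.
Qed.

Definition pmroots : seq (hR_dual h0) := [seq a <- mroots | 0 < phiv a].

Lemma pmrootsP a : a \in pmroots <-> a \in mroots /\ 0 < phiv a.
Proof. by rewrite mem_filter andbC; split=> [/andP[]|[-> ->]]. Qed.

Lemma sum_pmroots (V : nmodType) (F : hR_dual h0 -> V) :
  \sum_(a <- mroots) F a = \sum_(a <- pmroots) (F a + F (- a)).
Proof.
rewrite (bigID (fun a => 0 < phiv a)) /= big_split /= big_filter; congr (_ + _).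
rewrite big_filter -[LHS]big_filter -[RHS](big_filter mroots (fun a => 0 < phiv a) (fun a => F (- a))).
rewrite -(big_map (fun a => - a) xpredT F); apply: perm_big.
apply: uniq_perm; rewrite ?(map_inj_uniq oppr_inj) ?filter_uniq ?mroots_uniq // => a.
rewrite mem_filter; apply/andP/mapP => [[na am]|[b]].
  exists (- a); last by rewrite opprK.
  rewrite mem_filter mrootNE am phivalN oppr_gt0 andbT.
  by rewrite lt_def leNgt na andbT eq_sym (mroot_neq0 am).
rewrite mem_filter => /andP[pb bm] ->; split; last by rewrite mrootNE.
by rewrite phivalN oppr_gt0 -leNgt ltW.
Qed.

Variable Jv : T -> T.
Hypothesis Jlin : forall (l : R) w w', tangent_v w -> tangent_v w' ->
  Jv (l *: w + w') = l *: Jv w + Jv w'.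
Hypothesis Jroot : forall a x, P a -> dual_form br phi a != 0 -> m_root br a x ->
  Jv (br x v) = br ((ep a / dual_form br phi a) *: br v x) v.

Let tanDr ka w : self_conj ka -> tangent_v (Dr ka w) := tangent_Dr w.
Let tan0 : tangent_v 0. Proof. by exists 0; rewrite (lb0l lb). Qed.
Let tanD w w' : tangent_v w -> tangent_v w' -> tangent_v (w + w').
Proof. by move=> [x ->] [y ->]; exists (x + y); rewrite (lbDl lb). Qed.
Let J0 : Jv 0 = 0.
Proof. by have := Jlin (-1) tan0 tan0; rewrite scaler0 addr0 scaleN1r addNr. Qed.

Lemma J_sum I (r : seq I) (w : I -> T) : (forall i, tangent_v (w i)) ->
  Jv (\sum_(i <- r) w i) = \sum_(i <- r) Jv (w i).
Proof.
move=> tw; have tsum s : tangent_v (\sum_(i <- s) w i).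
  by apply: big_ind; [exact: tan0|exact: tanD|].
elim: r => [|i r IH]; first by rewrite !big_nil J0.
by rewrite !big_cons -[w i]scale1r Jlin // IH !scale1r.
Qed.

(** A tangent vector is split into its components in the spaces [m_a], on which [J] is
    given. *)
Lemma cplx_J (w : T) : tangent_v w -> cplx (Jv w) = Dg kJ (cplx w).
Proof.
move=> tw; pose ind a b : C := ((b == a) || (b == - a))%:R.
have sind a : self_conj (ind a).
  move=> b bm; rewrite /ind conjc_nat; congr (_%:R).
  by rewrite (inj_eq oppr_inj b a) orbC -(inj_eq oppr_inj b (- a)) opprK.
pose wa a := Dr (ind a) w.
(* The [pmroots] represent the classes of [mroots] up to sign. *)
have indE (F : hR_dual h0 -> C) b : b \in mroots ->
    \sum_(a <- pmroots) F a * ind a b = F (if 0 < phiv b then b else - b).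
  move=> bm; set c := if _ then _ else _.
  have cP : c \in pmroots.
    apply/pmrootsP; rewrite /c; case: ifPn => [pb //|nb].
    rewrite mrootNE bm phivalN oppr_gt0; split=> //.
    by rewrite lt_def leNgt nb andbT eq_sym (mroot_neq0 bm).
  have cb : (b == c) || (b == - c).
    by rewrite /c; case: ifP => _; rewrite ?opprK eqxx ?orbT.
  clearbody c; rewrite (bigD1_seq c) ?filter_uniq ?mroots_uniq //= /ind cb mulr1.
  rewrite big1_seq ?addr0 // => a /andP[ac /pmrootsP[am pa]].
  have [cm pc] := (pmrootsP c).1 cP.
  have [bac|_] := boolP ((b == a) || (b == - a)); last by rewrite mulr0.
  exfalso.
  have {bac} : a = c \/ a = - c.
    move: cb bac => /orP[]/eqP-> /orP[]/eqP h.
    - by left.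
    - by right; rewrite h opprK.
    - by right.
    - by left; rewrite (oppr_inj h).
  case=> h; first by rewrite h eqxx in ac.
  by move: pa; rewrite h phivalN oppr_gt0 ltNge ltW.
have wE : w = \sum_(a <- pmroots) wa a.
  apply: cplx_inj; rewrite raddf_sum (eq_bigr (fun a => Dg (ind a) (cplx w))) => [|a _].
    rewrite Dg_sum [LHS](tangentP w).1 //; apply: eq_Dg => b bm.
    apply: etrans (esym (indE (fun=> 1) b bm)) _.
    by apply: eq_bigr => a _; rewrite mul1r.
  exact: cplx_Dr.
have twa a : tangent_v (wa a) by exact: tanDr.
rewrite {1}wE J_sum // raddf_sum /=.
rewrite (eq_big_seq (fun a => Dg (fun b => (ep a)%:C%C * iC (phiv b / phiv a) * ind a b) (cplx w))).
  rewrite Dg_sum; apply: eq_Dg => b bm.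
  rewrite (indE (fun a => (ep a)%:C%C * iC (phiv b / phiv a))) //.
  have pb := mroot_neq0 bm; rewrite /kJ /jsgn.
  case: ifPn => [p0|n0]; first by rewrite divff // gtr0_sg // mulr1 mulrC /iC mulr1 mulrC.
  rewrite phivalN invrN mulrN divff // (epN lb Htau He (mroot_root bm)).
  have nb : phiv b < 0 by rewrite lt_neqAle pb leNgt.
  by rewrite ltr0_sg // mulrN1 /iC mulrCA -rmorphM mulrN1.
move=> a /pmrootsP[am pa]; have ra := mroot_root am.
have Pa : P a by apply/asboolP; rewrite -mroot_pos.
have dfa := dual_form_phi lb vh0 Hphi He ra.
pose xa := Dr kS (wa a).
have xaE : cplx xa = Dg (fun b => kS b * ind a b) (cplx w).
  by rewrite /xa (cplx_Dr _ self_kS) /wa (cplx_Dr _ (sind a)) DgDg.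
(* [x_a] has components on [e a] and [e (- a)] only. *)
have mxa : m_root br a xa.
  pose D1 := Dg (fun b => kS b * (b == a)%:R) (cplx w).
  pose D2 := Dg (fun b => kS b * (b == - a)%:R) (cplx w).
  have DE b0 : b0 \in mroots -> root_space br b0 (Dg (fun b => kS b * (b == b0)%:R) (cplx w)).
    move=> bm; rewrite /Dg (bigD1_seq b0) ?mroots_uniq //= big1 ?addr0.
      by apply: root_spaceZ => //; exact: (rv_mem He (mroot_root bm)).
    by move=> b nb; rewrite (negbTE nb) mulr0 mul0r scale0r.
  exists D1, D2; split; [exact: DE|by apply: DE; rewrite mrootNE|].
  rewrite xaE /D1 /D2 /Dg -big_split; apply: eq_big_seq => b bm /=.
  rewrite -scalerDl -mulrDl -mulrDr; congr (_ * _ * _ *: _); rewrite /ind.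
  have [->|_] := eqVneq b a; last by rewrite add0r.
  have [h|_] := eqVneq a (- a); last by rewrite addr0.
  by have := pa; rewrite h phivalN oppr_gt0 => /(lt_trans pa); rewrite ltxx.
have -> : wa a = br xa v by rewrite br_Dr_kS.
have dfa0 : dual_form br phi a != 0 by rewrite dfa (mroot_neq0 am).
rewrite (Jroot Pa dfa0 mxa) dfa.
rewrite cplx_br_v cplxZ -(cbr_cplx lb) ad_v_Dg DgZ DgDg xaE DgDg -[LHS]/(_ *: Dg _ _).
rewrite -DgZ /Dg; apply: eq_big_seq => b bm; rewrite coefZ mulrA; congr (_ * _ *: _).
have pb := mroot_neq0 bm.
have pa0 := mroot_neq0 am.
rewrite mulrA -[LHS]mulrA [ind a b * _]mulrC mulrA; congr (_ * _).
rewrite /krho /kad /kS /iC; move: (phiv a) (phiv b) (ep a) pa0 pb => s t r s0 t0.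
by apply: complex_eq; rewrite !ReImE /=; field; rewrite s0 t0.
Qed.

Lemma J_tangent w : tangent_v w -> tangent_v (Jv w).
Proof.
move=> tw; apply/tangentP; rewrite (cplx_J tw) DgDg; apply: eq_Dg => a _.
by rewrite mul1r.
Qed.

Lemma kJ_sqr a : a \in mroots -> kJ a * kJ a = -1.
Proof. by move=> am; rewrite iCM jsgn_sqr // rmorphN. Qed.

Lemma JJ_Dg ka z : Dg kJ (Dg kJ (Dg ka z)) = - Dg ka z.
Proof.
rewrite !DgDg /Dg -sumrN; apply: eq_big_seq => a am.
by rewrite /= (kJ_sqr am) mulN1r mulNr scaleNr.
Qed.

Lemma J_J w : tangent_v w -> Jv (Jv w) = - w.
Proof.
move=> tw; apply: cplx_inj; rewrite (cplx_J (J_tangent tw)) (cplx_J tw).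
by rewrite ((tangentP w).1 tw) JJ_Dg -((tangentP w).1 tw) raddfN.
Qed.

Variable om : T -> T -> R.
Hypothesis Hom : forall x y, tangent_v x -> tangent_v y ->
  om (br x v) (br y v) = killing br v (br x y).

(** The complex bilinear extension of the metric, in root coordinates. *)
Definition gC z z' : C :=
  \sum_(a <- mroots) (jsgn a / phiv a)%:C%C * (coef a z * coef (- a) z').

Lemma killing_ad_v z z' : B (cbr br (cplx v) z) z' =
  \sum_(a <- mroots) kad a * (coef a z * coef (- a) z').
Proof.
rewrite ad_v_Dg /Dg (killing_suml clb); apply: eq_bigr => a _.
by rewrite (killingZl clb) -mulrA (killingC _ (e a)) /coef opprK.
Qed.

Lemma gC_killing z z' : gC z z' = B (cbr br (cplx v) (Dg kS z)) (Dg kS (Dg kJ z')).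
Proof.
rewrite killing_ad_v; apply: eq_big_seq => a am; have man := mrootN am.
rewrite (coef_Dg _ _ am) !(coef_Dg _ _ man) /kS /kJ phivalN invrN.
rewrite (jsgnN (mroot_root am)); have := mroot_neq0 am; rewrite /kad.
move: (phiv a) (jsgn a) (coef a z) (coef _ z') => s t r r' s0.
have re4 (K : comPzRingType) (x y u w q q' : K) :
  x * ((y * q) * (u * (w * q'))) = (x * y) * (u * w) * (q * q') by ring.
rewrite re4 !iCM -rmorphM; congr (_ * _); congr (_%:C)%C.
by field.
Qed.

(** [w = [S w, v]] turns the definition of [om] into a value of the Killing form. *)
Lemma metric_cplx w w' : tangent_v w -> tangent_v w' ->
  (om w (Jv w'))%:C%C = gC (cplx w) (cplx w').
Proof.
move=> tw tw'; have tJ := J_tangent tw'.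
have tS u : tangent_v (Dr kS u) by exact: (tanDr u self_kS).
have h := etrans (esym (f_equal2 om (br_Dr_kS tw) (br_Dr_kS tJ))) (Hom (tS w) (tS (Jv w'))).
have X : cplx (Dr kS w) = Dg kS (cplx w) by exact: (cplx_Dr w self_kS).
have Y : cplx (Dr kS (Jv w')) = Dg kS (Dg kJ (cplx w')).
  exact: (etrans (cplx_Dr _ self_kS) (f_equal (Dg kS) (cplx_J tw'))).
refine (etrans _ (esym (gC_killing _ _))).
refine (etrans _ (f_equal2 (fun z z' => B (cbr br (cplx v) z) z') X Y)).
rewrite (killing_inv clb) (cbr_cplx lb) (killing_cplx lb).
exact: (f_equal (real_complex R) h).
Qed.

Lemma gCl l z z' (w : TC) : gC (l *: z + z') w = l * gC z w + gC z' w.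
Proof.
rewrite /gC mulr_sumr -big_split; apply: eq_bigr => a _ /=.
by rewrite coefP mulrDl mulrDr; congr (_ + _); rewrite -mulrA mulrCA.
Qed.
Lemma gCr l z z' (w : TC) : gC w (l *: z + z') = l * gC w z + gC w z'.
Proof.
rewrite /gC mulr_sumr -big_split; apply: eq_bigr => a _ /=.
rewrite coefP !mulrDr; congr (_ + _).
by rewrite (mulrCA (coef a w) l); exact: mulrCA.
Qed.
Lemma gC0l (w : TC) : gC 0 w = 0.
Proof. by have := gCl (-1) 0 0 w; rewrite scaler0 addr0 mulN1r addNr. Qed.
Lemma gC0r (w : TC) : gC w 0 = 0.
Proof. by have := gCr (-1) 0 0 w; rewrite scaler0 addr0 mulN1r addNr. Qed.
Lemma gCZl l z (w : TC) : gC (l *: z) w = l * gC z w.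
Proof. by have := gCl l z 0 w; rewrite addr0 gC0l addr0. Qed.
Lemma gCZr l z (w : TC) : gC w (l *: z) = l * gC w z.
Proof. by have := gCr l z 0 w; rewrite addr0 gC0r addr0. Qed.

Lemma gC_eN a z : a \in mroots -> gC (e (- a)) z = (jsgn a / phiv a)%:C%C * coef a z.
Proof.
move=> am; have man := mrootN am; have [ra rna] := (mroot_root am, mroot_root man).
rewrite /gC (bigD1_seq (- a)) ?mroots_uniq //= coef_e // eqxx mul1r opprK.
rewrite jsgnN // phivalN invrN mulrNN big1_seq ?addr0 // => b /andP[ba /mroot_root rb].
by rewrite coef_e // eq_sym (negbTE ba) mul0r mulr0.
Qed.

Lemma gC_J z z' : gC (Dg kJ z) (Dg kJ z') = gC z z'.
Proof.
apply: eq_big_seq => a am; have man := mrootN am.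
rewrite (coef_Dg _ _ am) (coef_Dg _ _ man) mulrACA.
by rewrite iCM (jsgnN (mroot_root am)) mulrN opprK (jsgn_sqr am) mul1r.
Qed.

(** * The complexified Nijenhuis tensor *)

Variable Nv : T -> T -> T.
Hypothesis HN : forall x y x' y', br x' v = Jv (br x v) -> br y' v = Jv (br y v) ->
  4 *: Nv (br x v) (br y v) =
    br (br x' y' - br x y) v - Jv (br (br x' y + br x y') v).

Let kSJ a : C := kS a * kJ a.
Let self_kSJ : self_conj kSJ. Proof. exact: self_mul self_kS self_kJ. Qed.

(** The complex bilinear extension of [N], from its formula on fundamental fields:
    [w = [x, v]] for [x = Dg kS w], and [J w = [x', v]] for [x' = Dg kSJ w]. *)
Definition NC z z' : TC := 4^-1 *:
  (Dg krho (cbr br (Dg kSJ z) (Dg kSJ z') - cbr br (Dg kS z) (Dg kS z')) -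
   Dg kJ (Dg krho (cbr br (Dg kSJ z) (Dg kS z') + cbr br (Dg kS z) (Dg kSJ z')))).

Lemma N_cplx w w' : tangent_v w -> tangent_v w' ->
  cplx (Nv w w') = NC (cplx w) (cplx w').
Proof.
have S1 u : cplx (Dr kS u) = Dg kS (cplx u) := cplx_Dr u self_kS.
have S2 u : cplx (Dr kSJ u) = Dg kSJ (cplx u) := cplx_Dr u self_kSJ.
have SJ u : tangent_v u -> br (Dr kSJ u) v = Jv (br (Dr kS u) v).
  move=> tu; apply: cplx_inj; rewrite cplx_br_v S2 DgDg.
  rewrite (br_Dr_kS tu) (cplx_J tu); apply: eq_Dg => a am.
  by rewrite /kSJ mulrA (krhoS am) mul1r.
move: S1 S2 SJ (@br_Dr_kS).
move: (Dr kS) (Dr kSJ) => f1 f2 S1 S2 SJ brf1 tw tw'.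
have h := HN (SJ _ tw) (SJ _ tw').
have h' := etrans (f_equal (fun u => 4 *: u) (esym (f_equal2 Nv (brf1 _ tw) (brf1 _ tw')))) h.
have tbr u : tangent_v (br u v) by exists u.
have four : (4 : R)%:C%C = 4 :> C by exact: (rmorph_nat (real_complex R)).
have := congr1 (@cplx R d) h'; rewrite cplxZ four raddfB /= (cplx_J (tbr _)).
rewrite !cplx_br_v !raddfB !raddfD /= -!(cbr_cplx lb) !S1 !S2 => hc.
have four0 : (4 : C) != 0 by rewrite pnatr_eq0.
by rewrite /NC -hc scalerA mulVf // scale1r.
Qed.

Let linC (f g : TC -> TC) : linear f -> linear g -> linear (fun z => f (g z)).
Proof. by move=> lf lg l z z'; rewrite lg lf. Qed.
Let linD (f g : TC -> TC) : linear f -> linear g -> linear (fun z => f z + g z).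
Proof. by move=> lf lg l z z'; rewrite lf lg scalerDr addrACA. Qed.
Let linZ (r : C) (f : TC -> TC) : linear f -> linear (fun z => r *: f z).
Proof. by move=> lf l z z'; rewrite lf scalerDr !scalerA mulrC. Qed.
Let linB (f g : TC -> TC) : linear f -> linear g -> linear (fun z => f z - g z).
Proof. by move=> lf lg l z z'; rewrite lf lg scalerBr opprD addrACA. Qed.

Lemma gC_Jl z z' : gC (Dg kJ z) z' = - gC z (Dg kJ z').
Proof.
rewrite /gC -sumrN; apply: eq_big_seq => a am; have man := mrootN am.
rewrite (coef_Dg _ _ am) (coef_Dg _ _ man) /kJ (jsgnN (mroot_root am)).
have -> : iC (- jsgn a) = - iC (jsgn a) by rewrite /iC rmorphN mulrN.
move: (iC _) (_%:C)%C (coef a z) (coef _ z') => x g u u'.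
have re (K : comPzRingType) (q q' r r' : K) : q * (q' * r * r') = - (q * (r * (- q' * r'))) by ring.
exact: re.
Qed.

Lemma gC_Dg1 z z' : gC (Dg (fun=> 1) z) z' = gC z z'.
Proof. by apply: eq_big_seq => a am; rewrite coef_Dg // mul1r. Qed.

Lemma gC_e a : a \in mroots -> gC (e a) (e (- a)) = (jsgn a / phiv a)%:C%C.
Proof.
move=> am; have man := mrootN am; have rna := mroot_root man.
rewrite -{1}[a]opprK (gC_eN _ man) coef_e // eqxx mulr1.
by rewrite (jsgnN (mroot_root am)) phivalN invrN mulrNN.
Qed.

Lemma coef_gC a z : a \in mroots -> coef a z = (phiv a * jsgn a)%:C%C * gC (e (- a)) z.
Proof.
move=> am; rewrite gC_eN // mulrA -rmorphM.
by rewrite -mulrA (mulrA (jsgn a)) jsgn_sqr // mul1r divff ?(mroot_neq0 am) // mul1r.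
Qed.

Lemma Dg1E z : Dg (fun=> 1) z =
  \sum_(a <- mroots) ((phiv a * jsgn a)%:C%C * gC (e (- a)) z) *: e a.
Proof. by apply: eq_big_seq => a am; rewrite -coef_gC // mul1r. Qed.

Lemma Dg_pmroots z : Dg (fun=> 1) z =
  \sum_(a <- pmroots) (coef a z *: e a + coef (- a) z *: e (- a)).
Proof.
have h (x : hR_dual h0 -> C) : \sum_(a <- mroots) (1 * x a) *: e a =
    \sum_(a <- pmroots) (x a *: e a + x (- a) *: e (- a)).
  by rewrite sum_pmroots; apply: eq_bigr => a _; rewrite !mul1r.
exact: (h (coef^~ z)).
Qed.

Local Opaque Dg gC.

Lemma NC_linl z' : linear (NC ^~ z').
Proof.
pose S (z : TC) := Dg kS z; pose SJ (z : TC) := Dg kSJ z.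
have lS : linear S by exact: Dg_linear.
have lSJ : linear SJ by exact: Dg_linear.
pose bl (y z : TC) : TC := cbr br z y; have lbl (y : TC) : linear (bl y) by exact: (lbL clb y).
apply: (@linZ 4^-1 (fun z => Dg krho (bl (SJ z') (SJ z) - bl (S z') (S z)) -
   Dg kJ (Dg krho (bl (S z') (SJ z) + bl (SJ z') (S z))))).
apply: (@linB (fun z => Dg krho (bl (SJ z') (SJ z) - bl (S z') (S z)))
   (fun z => Dg kJ (Dg krho (bl (S z') (SJ z) + bl (SJ z') (S z))))).
  apply: (@linC (Dg krho) (fun z => bl (SJ z') (SJ z) - bl (S z') (S z))); first exact: Dg_linear.
  by apply: linB; exact: linC.
apply: (@linC (Dg kJ) (fun z => Dg krho (bl (S z') (SJ z) + bl (SJ z') (S z)))); first exact: Dg_linear.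
apply: (@linC (Dg krho) (fun z => bl (S z') (SJ z) + bl (SJ z') (S z))); first exact: Dg_linear.
by apply: linD; exact: linC.
Qed.

Lemma NC_skew z z' : NC z z' = - NC z' z.
Proof.
rewrite /NC -scalerN; congr (_ *: _).
move: (Dg kSJ z) (Dg kSJ z') (Dg kS z) (Dg kS z') => p1 p2 p3 p4.
rewrite (lbC clb p1 p2) (lbC clb p3 p4) (lbC clb p1 p4) (lbC clb p3 p2).
move: (cbr br p2 p1) (cbr br p4 p3) (cbr br p4 p1) (cbr br p2 p3) => q1 q2 q3 q4.
have -> : - q1 - - q2 = - (q1 - q2) by rewrite opprD.
have -> : - q3 + - q4 = - (q4 + q3) by rewrite opprD addrC.
by rewrite !DgN opprD.
Qed.

Lemma NC_linr z : linear (NC z).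
Proof. by move=> l z1 z2; rewrite !(NC_skew z) (NC_linl z l z1 z2) opprD scalerN. Qed.

(** If [z = [x, v]] and [J z = [x', v]], then [J (J z) = [- x, v]]: passing from [z]
    to [J z] replaces [(x, x')] by [(x', - x)] in the formula for [N]. *)
Lemma NC_J z z' : NC (Dg kJ z) z' = - Dg kJ (NC z z').
Proof.
have SJ1 : Dg kS (Dg kJ z) = Dg kSJ z by rewrite DgDg.
have SJ2 : Dg kSJ (Dg kJ z) = - Dg kS z.
  rewrite DgDg -Dg_opp; apply: eq_Dg => a am.
  by rewrite /kSJ -(mulrA (kS a)) (kJ_sqr am) mulrN1.
rewrite /NC SJ1 SJ2 DgZ -scalerN; congr (_ *: _).
move: (Dg kSJ z) (Dg kSJ z') (Dg kS z) (Dg kS z') => p1 p2 p3 p4.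
rewrite (lbNl clb p3 p2) (lbNl clb p3 p4).
move: (cbr br p3 p2) (cbr br p3 p4) (cbr br p1 p4) (cbr br p1 p2) => q1 q2 q3 q4.
have -> : - q1 - q3 = - (q3 + q1) by rewrite opprD addrC.
rewrite [- q2 + q4]addrC DgN; move: (q3 + q1) (q4 - q2) => {q1 q2 q3 q4} q r.
have := JJ_Dg krho q; move: (Dg krho q) (Dg krho r) => {}q {}r.
by rewrite (DgB kJ) => ->; rewrite opprB -opprD addrC.
Qed.

(** * The Nijenhuis tensor on root vectors *)

Lemma Dg_br ka a b : a \in mroots -> b \in mroots -> Dg ka (cbr br (e a) (e b)) =
  if a + b \in mroots then (ka (a + b) * (Nc a b)%:C%C) *: e (a + b) else 0.
Proof.
move=> /mroot_root ra /mroot_root rb; have [rab|nab] := EM (root (a + b)).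
  rewrite (rv_br He ra rb rab) DgZ Dg_e //; case: ifP => _; last exact: scaler0.
  by rewrite scalerA mulrC.
rewrite ifF; last by apply/negP => /mroot_root.
have abz := root_space_br lb (rv_mem He ra) (rv_mem He rb).
have [ab0|ab0] := eqVneq (a + b) 0; first by apply: Dg_zero; rewrite -ab0.
suff -> : cbr br (e a) (e b) = 0 by exact: Dg0.
by apply: contrapT => z0; apply: nab; split=> //; exists (cbr br (e a) (e b)) => //; apply/eqP.
Qed.

Definition N_coef a b : R := - (phiv (a + b) * Nc a b *
  (1 + jsgn a * jsgn b - jsgn (a + b) * (jsgn a + jsgn b)) / (4 * (phiv a * phiv b))).

Lemma NC_e a b : a \in mroots -> b \in mroots ->
  NC (e a) (e b) = if a + b \in mroots then iC (N_coef a b) *: e (a + b) else 0.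
Proof.
move=> am bm; rewrite /NC !(Dg_mroot _ am) !(Dg_mroot _ bm).
rewrite !(lbZl clb) !(lbZr clb) !scalerA -scalerBl -scalerDl !DgZ (Dg_br _ am bm).
case: ifP => [abm|_]; last by rewrite Dg0 !scaler0 subr0 scaler0.
rewrite DgZ (Dg_mroot _ abm) !scalerA -scalerBl scalerA; congr (_ *: _).
have four : (4 : C) = (4 : R)%:C%C by exact: (esym (rmorph_nat (real_complex R) 4)).
have := mroot_neq0 am; have := mroot_neq0 bm; rewrite /N_coef /krho /kS /kSJ /kJ /kS four.
move: (jsgn (a + b)) (phiv a) (phiv b) (phiv (a + b)) (jsgn a) (jsgn b) (Nc a b) => j'' s t r j j' n t0 s0.
have iCZ (x y : R) : iC x * y%:C%C = iC (x * y) by rewrite /iC -mulrA -rmorphM.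
have ZiC (x y : R) : x%:C%C * iC y = iC (x * y) by rewrite /iC mulrCA -rmorphM.
have iCB (x y : R) : iC x - iC y = iC (x - y) by rewrite /iC -mulrBr -rmorphB.
rewrite !iCM -fmorphV iCZ.
have -> : (- (s^-1 * j))%:C%C * (- (t^-1 * j'))%:C%C - (- (s^-1 * t^-1))%:C%C = ((1 + j * j') / (s * t))%:C%C.
  by rewrite -rmorphM -rmorphB; congr (_%:C)%C; field; rewrite s0 t0.
have -> : (- (s^-1 * j))%:C%C * iC t^-1 + iC s^-1 * (- (t^-1 * j'))%:C%C = iC (- ((j + j') / (s * t))).
  by rewrite ZiC iCZ /iC -mulrDr -rmorphD; congr (_ * _%:C)%C; field; rewrite s0 t0.
rewrite iCM !ZiC iCB ZiC; congr iC; field; rewrite s0 t0 //.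
Qed.

(** The values of [N] are tangent. *)
Lemma Dg1_NC z z' : Dg (fun=> 1) (NC z z') = NC z z'.
Proof.
have D1 ka u : Dg (fun=> 1) (Dg ka u) = Dg ka u.
  by rewrite DgDg; apply: eq_Dg => a _; rewrite mul1r.
refine (etrans (DgZ _ _ _) (f_equal (fun x : TC => 4^-1 *: x) _)).
by refine (etrans (DgB _ _ _) (f_equal2 (fun x y : TC => x - y) (D1 _ _) (D1 _ _))).
Qed.

Local Opaque NC.

Lemma gC_NN z : gC (- z) (- z) = gC z z.
Proof. by rewrite -scaleN1r gCZl gCZr mulN1r mulN1r opprK. Qed.

Lemma gC_NC_Jl z (w : TC) : gC (NC (Dg kJ z) w) (NC (Dg kJ z) w) = gC (NC z w) (NC z w).
Proof.
by refine (etrans (f_equal2 gC (NC_J z w) (NC_J z w)) _); rewrite gC_NN; exact: gC_J.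
Qed.

Lemma gC_NC_Jr z (w : TC) : gC (NC z (Dg kJ w)) (NC z (Dg kJ w)) = gC (NC z w) (NC z w).
Proof.
have h u : gC (NC z u) (NC z u) = gC (NC u z) (NC u z).
  by rewrite (NC_skew z u) gC_NN.
by refine (etrans (h _) (etrans (gC_NC_Jl _ _) (esym (h _)))).
Qed.

Lemma tangent_N w w' : tangent_v w -> tangent_v w' -> tangent_v (Nv w w').
Proof.
by move=> tw tw'; apply/tangentP; rewrite (N_cplx tw tw'); exact: (esym (Dg1_NC _ _)).
Qed.

Lemma metric_N w w' : tangent_v w -> tangent_v w' ->
  (om (Nv w w') (Jv (Nv w w')))%:C%C =
  gC (NC (cplx w) (cplx w')) (NC (cplx w) (cplx w')).
Proof.
move=> tw tw'; have tN := tangent_N tw tw'; have NE := N_cplx tw tw'.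
exact: (etrans (metric_cplx tN tN) (f_equal2 gC NE NE)).
Qed.

Lemma gC_NC_ll (w u : TC) l z1 z2 :
  gC (NC (l *: z1 + z2) w) u = l * gC (NC z1 w) u + gC (NC z2 w) u.
Proof. exact: (etrans (f_equal (gC^~ u) (NC_linl w l z1 z2)) (gCl _ _ _ _)). Qed.
Lemma gC_NC_rr (z u : TC) l z1 z2 :
  gC u (NC z (l *: z1 + z2)) = l * gC u (NC z z1) + gC u (NC z z2).
Proof. exact: (etrans (f_equal (gC u) (NC_linr z l z1 z2)) (gCr _ _ _ _)). Qed.
Lemma gC_NC_lr (z u : TC) l z1 z2 :
  gC (NC z (l *: z1 + z2)) u = l * gC (NC z z1) u + gC (NC z z2) u.
Proof. exact: (etrans (f_equal (gC^~ u) (NC_linr z l z1 z2)) (gCl _ _ _ _)). Qed.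
Lemma gC_NC_rl (w u : TC) l z1 z2 :
  gC u (NC (l *: z1 + z2) w) = l * gC u (NC z1 w) + gC u (NC z2 w).
Proof. exact: (etrans (f_equal (gC u) (NC_linl w l z1 z2)) (gCr _ _ _ _)). Qed.

(** The contribution of the pair of root vectors [e a], [e b] to the norm; the
    condition on the signs is the one under which [N_coef] does not vanish. *)
Definition nterm a b : R :=
  if [&& a + b \in mroots, jsgn a == jsgn b & jsgn (a + b) == - jsgn a]
  then jsgn a * (phiv (a + b) / (phiv a * phiv b)) * Nc a b ^+ 2 else 0.

Lemma jsgnP a : a \in mroots -> jsgn a = 1 \/ jsgn a = -1.
Proof.
move=> /jsgn_sqr /eqP; rewrite -expr2 sqrf_eq1 => /orP[]/eqP; by [left|right].
Qed.

(** The signs [j] are [1] or [-1]: the factor of [N_coef] is [4] or [0]. *)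
Lemma NC_e_norm a b : a \in mroots -> b \in mroots ->
  (phiv a * jsgn a)%:C%C * ((phiv b * jsgn b)%:C%C *
    gC (NC (e a) (e b)) (NC (e (- a)) (e (- b)))) = (nterm a b)%:C%C.
Proof.
move=> am bm; have [man mbn] := (mrootN am, mrootN bm).
have [ra rb] := (mroot_root am, mroot_root bm).
refine (etrans (f_equal2 (fun x y : TC => _ * (_ * gC x y)) (NC_e am bm) (NC_e man mbn)) _).
rewrite /nterm -opprD mrootNE; case: ifPn => abm; last by rewrite gC0l !mulr0.
have rab := mroot_root abm; have [_ _ NN _ _] := rv_Nc He ra rb rab.
have N_coefN : N_coef (- a) (- b) = N_coef a b.
  rewrite /N_coef -opprD !phivalN NN !jsgnN //; congr (- _).
  by rewrite !mulrNN -opprD mulrNN.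
rewrite gCZl gCZr N_coefN (gC_e abm) (mulrA (iC _)) iCM -!rmorphM; congr (_%:C)%C.
have := mroot_neq0 am; have := mroot_neq0 bm; have := mroot_neq0 abm; rewrite /N_coef.
move: (jsgnP am) (jsgnP bm) (jsgnP abm).
move: (jsgn (a + b)) (phiv (a + b)) (phiv a) (phiv b) (jsgn a) (jsgn b) (Nc a b) => j'' r s t j j' n.
have n11 : (1 == -1 :> R) = false by rewrite -subr_eq0 opprK -mulr2n pnatr_eq0.
have n11' : (-1 == 1 :> R) = false by rewrite eq_sym.
move=> [] -> [] -> [] -> r0 t0 s0; rewrite ?opprK ?eqxx ?n11 ?n11' /=; field; by rewrite ?r0 ?s0 ?t0.
Qed.

Local Opaque cplx.
(** * Traces over symplectic orthonormal bases *)

Section SymplecticBasis.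
Variables (n : nat) (f : 'I_n -> T).
Hypothesis ft : forall i, tangent_v (f i).
Hypothesis f_on : forall i j, om (f i) (Jv (f j)) = (i == j)%:R.
Hypothesis fJ0 : forall i j, om (f i) (Jv (Jv (f j))) = 0.
Hypothesis Jf0 : forall i j, om (Jv (f i)) (Jv (f j)) = 0.
Hypothesis fspan : forall w, tangent_v w -> exists s t : 'I_n -> R,
  w = \sum_(i < n) (s i *: f i + t i *: Jv (f i)).

Let F i := cplx (f i).
Let F' i := Dg kJ (F i).
Let one : hR_dual h0 -> C := fun=> 1.

Let F1 i : Dg one (F i) = F i. Proof. exact: (esym ((tangentP (f i)).1 (ft i))). Qed.
Let F'1 i : Dg one (F' i) = F' i.
Proof. by rewrite DgDg; apply: eq_Dg => a _; rewrite mul1r. Qed.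

Let gFF i j : gC (F i) (F j) = (i == j)%:R.
Proof.
refine (etrans (esym (metric_cplx (ft i) (ft j))) _).
by rewrite f_on; exact: (rmorph_nat (real_complex R)).
Qed.
Let gF'F' i j : gC (F' i) (F' j) = (i == j)%:R.
Proof. exact: (etrans (gC_J (F i) (F j)) (gFF i j)). Qed.
Let gFF' i j : gC (F i) (F' j) = 0.
Proof.
refine (etrans (f_equal (gC (F i)) (esym (cplx_J (ft j)))) _).
refine (etrans (esym (metric_cplx (ft i) (J_tangent (ft j)))) _).
by rewrite fJ0.
Qed.
Let gF'F i j : gC (F' i) (F j) = 0.
Proof.
refine (etrans (f_equal (gC^~ (F j)) (esym (cplx_J (ft i)))) _).
refine (etrans (esym (metric_cplx (J_tangent (ft i)) (ft j))) _).
by rewrite Jf0.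
Qed.

(** A complex vector is a combination of two real ones, to which the basis applies. *)
Lemma onb_expand z : Dg one z = onb_proj gC F F' z.
Proof.
have gl z' l z1 z2 := gCl l z1 z2 z'.
have real w : tangent_v w -> cplx w = onb_proj gC F F' (cplx w).
  move=> /fspan[s [t wE]].
  have cwE : cplx w = \sum_i ((s i)%:C%C *: F i + (t i)%:C%C *: F' i).
    rewrite wE raddf_sum; apply: eq_bigr => i _.
    by rewrite raddfD /= !cplxZ (cplx_J (ft i)).
  exact: (onb_proj_span gl gFF gF'F' gFF' gF'F cwE).
have proj1 u : onb_proj gC F F' (Dg one u) = onb_proj gC F F' u.
  by apply: eq_onb_proj => z'; exact: gC_Dg1.
have cx x : Dg one (cplx x) = onb_proj gC F F' (cplx x).
  have xE := cplx_Dr x self_one.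
  refine (etrans (esym xE) (etrans (real _ (tangent_Dr x self_one)) _)).
  exact: (etrans (f_equal (onb_proj gC F F') xE) (proj1 _)).
rewrite [z in LHS]cplxE addrC; refine (etrans (Dg_linear one _ _ _) _).
refine (etrans (f_equal2 (fun x y : TC => 'i%C *: x + y) (cx _) (cx _)) _).
refine (etrans (esym (onb_proj_linear gl F F' _ _ _)) _).
by refine (f_equal (onb_proj gC F F') (etrans (addrC _ _) (esym (cplxE z)))).
Qed.

(** With respect to the metric the basis dual to the [e a] consists of multiples of
    the [e (- a)]. *)
Lemma onb_trace (Q : TC -> TC -> C) :
  (forall z' l z1 z2, Q (l *: z1 + z2) z' = l * Q z1 z' + Q z2 z') ->
  (forall z l z1 z2, Q z (l *: z1 + z2) = l * Q z z1 + Q z z2) ->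
  \sum_i (Q (F i) (F i) + Q (F' i) (F' i)) =
  \sum_(a <- mroots) (phiv a * jsgn a)%:C%C * Q (e a) (e (- a)).
Proof.
apply: (@bilinear_trace _ _ gC _ F F' _ mroots e (fun a => e (- a)) _ (Dg one) Q onb_expand).
- move=> z; exact: (Dg1E z).
- exact: F1.
- exact: F'1.
- by move=> a am; rewrite (Dg_mroot _ (mrootN am)) scale1r.
Qed.

(** By antilinearity the norm of [N] does not change when one of its arguments is
    multiplied by [J], so the double trace is four times the sum over [i] and [j]. *)
Lemma onb_norm_N :
  4 * (\sum_i \sum_j om (Nv (f i) (f j)) (Jv (Nv (f i) (f j)))) =
  \sum_(a <- mroots) \sum_(b <- mroots) nterm a b.
Proof.
apply: complexI.
pose Q z z' := \sum_(b <- mroots) (phiv b * jsgn b)%:C%C * gC (NC z (e b)) (NC z' (e (- b))).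
have trQ z z' : \sum_j (gC (NC z (F j)) (NC z' (F j)) + gC (NC z (F' j)) (NC z' (F' j))) = Q z z'.
  have l1 (w : TC) l z1 z2 := gC_NC_lr z (NC z' w) l z1 z2.
  have l2 (w : TC) l z1 z2 := gC_NC_rr z' (NC z w) l z1 z2.
  exact: (onb_trace (Q := fun w w' : TC => gC (NC z w) (NC z' w')) l1 l2).
have mulCD (r l x y : C) : r * (l * x + y) = l * (r * x) + r * y.
  by rewrite mulrDr mulrCA.
have Ql z' l z1 z2 : Q (l *: z1 + z2) z' = l * Q z1 z' + Q z2 z'.
  rewrite /Q mulr_sumr -big_split; apply: eq_bigr => b _ /=.
  by refine (etrans (f_equal (GRing.mul _) (gC_NC_ll _ _ _ _ _)) _); exact: mulCD.
have Qr z l z1 z2 : Q z (l *: z1 + z2) = l * Q z z1 + Q z z2.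
  rewrite /Q mulr_sumr -big_split; apply: eq_bigr => b _ /=.
  by refine (etrans (f_equal (GRing.mul _) (gC_NC_rl _ _ _ _ _)) _); exact: mulCD.
have QF' i : Q (F' i) (F' i) = Q (F i) (F i).
  refine (etrans (esym (trQ _ _)) (etrans _ (trQ _ _))); apply: eq_bigr => j _.
  exact: (f_equal2 +%R (gC_NC_Jl _ _) (gC_NC_Jl _ _)).
have QF i : Q (F i) (F i) = \sum_j 2 * gC (NC (F i) (F j)) (NC (F i) (F j)).
  refine (etrans (esym (trQ _ _)) _); apply: eq_bigr => j _.
  refine (etrans (f_equal (+%R _) (gC_NC_Jr _ _)) _).
  by rewrite mulr_natl.
have := onb_trace Ql Qr.
rewrite (eq_bigr (fun i => \sum_j 4 * gC (NC (F i) (F j)) (NC (F i) (F j)))) => [h|i _]; last first.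
  rewrite QF' QF -big_split; apply: eq_bigr => j _ /=.
  by rewrite -mulrDl -natrD.
rewrite rmorphM rmorph_nat !rmorph_sum mulr_sumr.
refine (etrans (etrans _ h) _).
  apply: eq_bigr => i _; rewrite rmorph_sum mulr_sumr; apply: eq_bigr => j _.
  exact: (f_equal (GRing.mul 4) (metric_N (ft i) (ft j))).
apply: eq_big_seq => a am; rewrite mulr_sumr rmorph_sum; apply: eq_big_seq => b bm.
exact: NC_e_norm.
Qed.

End SymplecticBasis.

(** * Existence of a symplectic orthonormal basis *)

Lemma jsgn_pos a : a \in pmroots -> jsgn a = ep a.
Proof. by move=> /pmrootsP[_ pa]; rewrite /jsgn gtr0_sg // mulr1. Qed.

Lemma pmroot_neqN a b : a \in pmroots -> b \in pmroots -> (a == - b) = false.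
Proof.
move=> /pmrootsP[_ pa] /pmrootsP[_ pb]; apply/eqP => ab.
by move: pa; rewrite ab phivalN oppr_gt0 => /(lt_trans pb); rewrite ltxx.
Qed.

Lemma gC_pair a b (l r s : C) : a \in pmroots -> b \in pmroots ->
  gC (l *: e (- a) + e a) (r *: e b + s *: e (- b)) =
  (jsgn a / phiv a)%:C%C * (s + l * r) * (b == a)%:R.
Proof.
move=> ap bp; have [[am _] [bm _]] := ((pmrootsP a).1 ap, (pmrootsP b).1 bp).
have [man mbn] := (mrootN am, mrootN bm).
have [[ra rna] [rb rnb]] := ((mroot_root am, mroot_root man), (mroot_root bm, mroot_root mbn)).
have gea z : gC (e a) z = (jsgn a / phiv a)%:C%C * coef (- a) z.
  rewrite -{1}[a]opprK (gC_eN _ man) (jsgnN ra) phivalN invrN mulrNN.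
  by [].
have nab : (b == - a) = false by exact: pmroot_neqN.
have nba : (- b == a) = false by rewrite eqr_oppLR.
rewrite gCl (gC_eN _ am) gea !coefP !coefZ !coef_e // nab nba eqr_opp !mulr0 addr0 add0r.
have re (K : comPzRingType) (g q q' u x : K) :
  q * (g * (q' * x)) + g * (u * x) = g * (u + q * q') * x by ring.
exact: re.
Qed.

(** The squared norm of [ep a *: e (- a) + e a] is [2 / phiv a]. *)
Definition onb_scale a : R := Num.sqrt (phiv a / 2).

Lemma onb_scale_neq0 a : a \in pmroots -> onb_scale a != 0.
Proof.
by move=> /pmrootsP[_ pa]; rewrite gt_eqF // sqrtr_gt0 divr_gt0.
Qed.

Lemma onb_scale_sqr a : a \in pmroots -> onb_scale a * onb_scale a = phiv a / 2.
Proof.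
by move=> /pmrootsP[_ pa]; rewrite -expr2 sqr_sqrtr // ltW // divr_gt0.
Qed.

(** Conjugation exchanges the two terms. *)
Definition onb_cvec a : TC := (onb_scale a)%:C%C *: ((ep a)%:C%C *: e (- a) + e a).
Definition onb_vec a : T := re_mx (onb_cvec a).

Lemma cplx_onb_vec a : a \in mroots -> cplx (onb_vec a) = onb_cvec a.
Proof.
move=> am; have ra := mroot_root am; apply: cconj_real.
rewrite /onb_cvec cconjZ conjc_real; congr (_ *: _).
rewrite cconjD cconjZ conjc_real (cconj_e Htau He (is_rootN lb ra)) (cconj_e Htau He ra).
by rewrite opprK scalerA (epN lb Htau He ra) -rmorphM ep_sqr scale1r addrC.
Qed.

Lemma Dg_onb_cvec ka a : a \in mroots -> Dg ka (onb_cvec a) =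
  (onb_scale a)%:C%C *: (ka a *: e a + ((ep a)%:C%C * ka (- a)) *: e (- a)).
Proof.
move=> am; rewrite /onb_cvec DgZ; congr (_ *: _); rewrite DgD DgZ.
by rewrite (Dg_mroot _ am) (Dg_mroot _ (mrootN am)) scalerA addrC.
Qed.

Lemma tangent_onb_vec a : a \in mroots -> tangent_v (onb_vec a).
Proof.
move=> am; apply/tangentP; rewrite (cplx_onb_vec am) (Dg_onb_cvec _ am).
by rewrite scale1r mulr1 addrC.
Qed.

Lemma gC_onb_cvec ka a b : a \in pmroots -> b \in pmroots ->
  gC (onb_cvec a) (Dg ka (onb_cvec b)) = (ka a + ka (- a)) / 2 * (b == a)%:R.
Proof.
move=> ap bp; have [[am pa] [bm _]] := ((pmrootsP a).1 ap, (pmrootsP b).1 bp).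
rewrite (Dg_onb_cvec _ bm) gCZr gCZl gC_pair // (jsgn_pos ap).
have [->|_] := eqVneq b a; last by rewrite !mulr0.
rewrite !mulr1 -mulrDr [ka (- a) + _]addrC; move: (ka a + _) => x.
rewrite !mulrA -!rmorphM.
have -> : onb_scale a * onb_scale a * (ep a / phiv a) * ep a = 2^-1.
  have := ep_sqr br k a; rewrite (onb_scale_sqr ap); move: (ep a) (phiv a) (lt0r_neq0 pa) => s q q0 ss.
  have -> : q / 2 * (s / q) * s = s * s / 2 by field.
  by rewrite ss mul1r.
by rewrite mulrC fmorphV rmorph_nat.
Qed.

(** The coordinates of a real vector on [e a] and [e (- a)] are conjugate up to
    [ep a]; their real and imaginary parts give the coordinates on [onb_vec a] and
    its image under [J]. *)
Lemma onb_vec_span w : tangent_v w -> exists s t : hR_dual h0 -> R,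
  w = \sum_(a <- pmroots) (s a *: onb_vec a + t a *: Jv (onb_vec a)).
Proof.
move=> tw.
exists (fun a => complex.Re (coef a (cplx w)) / onb_scale a).
exists (fun a => complex.Im (coef a (cplx w)) * jsgn a / onb_scale a).
apply: cplx_inj; rewrite [LHS](tangentP w).1 // Dg_pmroots raddf_sum.
apply: eq_big_seq => a ap; have [am _] := (pmrootsP a).1 ap; have ra := mroot_root am.
rewrite raddfD /= !cplxZ (cplx_J (tangent_onb_vec am)) (cplx_onb_vec am) (Dg_onb_cvec _ am).
have -> : coef (- a) (cplx w) = (ep a)%:C%C * (coef a (cplx w))^*%C.
  rewrite (coef_conj _ ra) mulrA cconj_cplx -rmorphM ep_sqr; exact: (esym (mul1r _)).
have := onb_scale_neq0 ap; have := jsgn_sqr am; have := ep_sqr br k a.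
rewrite /onb_cvec /kJ (jsgnN ra) /iC.
move: (coef a (cplx w)) (onb_scale a) (jsgn a) (ep a) => [x y] s j q qq jj s0.
have comb (K : pzRingType) (V : lmodType K) (r1 r2 r3 r4 r5 r6 : K) (z1 z2 : V) :
    r1 *: (r2 *: (r3 *: z2 + z1)) + r4 *: (r2 *: (r5 *: z1 + r6 *: z2)) =
    (r1 * r2 + r4 * r2 * r5) *: z1 + (r1 * r2 * r3 + r4 * r2 * r6) *: z2.
  by rewrite !scalerDr !scalerA [X in X + _]addrC addrACA -!scalerDl.
refine (etrans _ (esym (comb _ _ _ _ _ _ _ _ _ _))).
have xs : (x / s)%:C%C * s%:C%C = x%:C%C.
  by rewrite -rmorphM divfK.
have ys : (y * j / s)%:C%C * s%:C%C = (y * j)%:C%C.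
  by rewrite -rmorphM divfK.
have yj : y = y * j * j by rewrite -mulrA jj mulr1.
rewrite xs ys; refine (f_equal2 (fun r r' => r *: e a + r' *: e (- a)) _ _).
  by apply: complex_eq; rewrite !ReImE /=; [ring|rewrite [in LHS]yj; ring].
by apply: complex_eq; rewrite !ReImE /=; [ring|rewrite [in LHS]yj; ring].
Qed.

Lemma onb_exists : exists n (f : 'I_n -> T), [/\ forall i, tangent_v (f i),
  forall i j, om (f i) (Jv (f j)) = (i == j)%:R,
  forall i j, om (f i) (Jv (Jv (f j))) = 0 /\ om (Jv (f i)) (Jv (f j)) = 0 &
  forall w, tangent_v w -> exists s t : 'I_n -> R,
    w = \sum_(i < n) (s i *: f i + t i *: Jv (f i))].
Proof.
pose rt (i : 'I_(size pmroots)) := nth 0 pmroots i.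
have rtP i : rt i \in pmroots by rewrite mem_nth.
have rtm i : rt i \in mroots by have [] := (pmrootsP _).1 (rtP i).
have rt_eq i j : (rt i == rt j) = (i == j).
  by rewrite nth_uniq ?filter_uniq ?mroots_uniq.
have ft i := tangent_onb_vec (rtm i).
have Jft i := J_tangent (ft i).
have gJ i j : gC (onb_cvec (rt i)) (Dg kJ (onb_cvec (rt j))) = 0.
  rewrite gC_onb_cvec // /kJ (jsgnN (mroot_root (rtm i))) /iC rmorphN mulrN subrr.
  by rewrite mul0r mul0r.
have fE i := cplx_onb_vec (rtm i).
have JfE i : cplx (Jv (onb_vec (rt i))) = Dg kJ (onb_cvec (rt i)).
  exact: (etrans (cplx_J (ft i)) (f_equal (Dg kJ) (fE i))).
exists (size pmroots), (fun i => onb_vec (rt i)); split.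
- exact: ft.
- move=> i j; apply: complexI.
  refine (etrans (metric_cplx (ft i) (ft j)) (etrans (f_equal2 gC (fE i) (fE j)) _)).
  have := gC_onb_cvec (fun=> 1) (rtP i) (rtP j); rewrite Dg_onb_cvec //.
  have -> : (onb_scale (rt j))%:C%C *: (1 *: e (rt j) +
      ((ep (rt j))%:C%C * 1) *: e (- rt j)) = onb_cvec (rt j).
    by rewrite scale1r mulr1 addrC.
  rewrite rt_eq eq_sym => ->; rewrite -mulr2n divff ?pnatr_eq0 // mul1r.
  by rewrite rmorph_nat.
- move=> i j; split; apply: complexI.
    refine (etrans (metric_cplx (ft i) (Jft j)) _).
    exact: (etrans (f_equal2 gC (fE i) (JfE j)) (gJ i j)).
  refine (etrans (metric_cplx (Jft i) (ft j)) _).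
  refine (etrans (f_equal2 gC (JfE i) (fE j)) _).
  by rewrite gC_Jl gJ oppr0.
- move=> w /onb_vec_span[s [t wE]].
  exists (fun i => s (rt i)), (fun i => t (rt i)).
  by rewrite {1}wE (big_nth 0) big_mkord.
Qed.

(** * The sum over pairs of roots *)

Lemma ntermNN a b : a \in mroots -> b \in mroots -> nterm (- a) (- b) = nterm a b.
Proof.
move=> am bm; have [ra rb] := (mroot_root am, mroot_root bm).
rewrite /nterm -opprD mrootNE; case: (boolP (a + b \in mroots)) => //= abm.
have rab := mroot_root abm; have [_ _ NN _ _] := rv_Nc He ra rb rab.
rewrite (jsgnN ra) (jsgnN rb) (jsgnN rab) !eqr_opp NN sqrrN !phivalN mulrNN.
by rewrite [(- phiv _) * _]mulNr mulrNN.
Qed.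

Local Notation ip := (@dual_form R d br h0).

Let ipE a : root a -> ip phi a = phiv a.
Proof. by move=> ra; exact: (dual_form_phi lb vh0 Hphi He ra). Qed.

Definition noncompact_term a b : R :=
  ip phi (a + b) / (ip phi a * ip phi b) * Nc a b ^+ 2.

Definition compact_term a b : R :=
  (1 + sgn_root P (a - b)) * (ip phi (a - b) / (ip phi a * ip phi b)) *
  Nc a (- b) ^+ 2.

Lemma noncompact_termE a b : root a -> root b ->
  noncompact_term a b = phiv (a + b) / (phiv a * phiv b) * Nc a b ^+ 2.
Proof.
move=> ra rb; rewrite /noncompact_term; have [rab|nrab] := EM (root (a + b)); last first.
  by rewrite (rv_Nc0 He ra rb nrab) expr0n !mulr0.
have := ipE ra; have := ipE rb; have := ipE rab.
by move: (ip phi _) (ip phi a) (ip phi b) => x y z -> -> ->.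
Qed.

Lemma compact_termE a b : root a -> root b -> compact_term a b =
  (1 + sgn_root P (a - b)) * (phiv (a - b) / (phiv a * phiv b)) * Nc a (- b) ^+ 2.
Proof.
move=> ra rb; rewrite /compact_term; have [rab|nrab] := EM (root (a - b)); last first.
  by rewrite (rv_Nc0 He ra (is_rootN lb rb) nrab) expr0n !mulr0.
have := ipE ra; have := ipE rb; have := ipE rab.
by move: (ip phi _) (ip phi a) (ip phi b) => x y z -> -> ->.
Qed.

(** Either [a + b] is not a root and the structure constant vanishes, or [phi] is
    orthogonal to it. *)
Lemma mroots_sum0 a b : root a -> root b -> a + b \notin mroots ->
  phiv (a + b) * Nc a b ^+ 2 = 0.
Proof.
move=> ra rb abm.
have [rab|nrab] := EM (root (a + b)); last first.
  by rewrite (rv_Nc0 He ra rb nrab) expr0n mulr0.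
have [->|p0] := eqVneq (phiv (a + b)) 0; first by rewrite mul0r.
by case/negP: abm; apply/mrootsP.
Qed.

Let n11 : (1 == -1 :> R) = false.
Proof. by rewrite -subr_eq0 opprK -mulr2n pnatr_eq0. Qed.
Let n11' : (-1 == 1 :> R) = false. Proof. by rewrite eq_sym n11. Qed.

(** For positive roots the sign [j] is [eps]. If [eps_a = eps_b], then
    [eps_{a+b} = -1], and this has to be the opposite of [eps_a]. *)
Lemma nterm_pos a b : a \in pmroots -> b \in pmroots ->
  nterm a b = if (ep a == 1) && (ep b == 1) then noncompact_term a b else 0.
Proof.
move=> ap bp; have [[am pa] [bm pb]] := ((pmrootsP a).1 ap, (pmrootsP b).1 bp).
have [ra rb] := (mroot_root am, mroot_root bm).
rewrite noncompact_termE // /nterm; have [abm|abm] := boolP (a + b \in mroots); last first.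
  have := mroots_sum0 ra rb abm; move: (phiv _) (phiv a) (phiv b) => x y z xN.
  by rewrite /= mulrAC xN mul0r if_same.
have rab := mroot_root abm.
rewrite (jsgn_pos ap) (jsgn_pos bp) /jsgn (epD lb Htau He ra rb rab) phivalD.
move: (ep a) (ep b) (epP br k a) (epP br k b) pa pb.
move: (phiv a) (phiv b) => s t j j' hj hj' s0 t0.
rewrite gtr0_sg ?addr_gt0 // mulr1.
by case: hj => ->; case: hj' => ->;
  rewrite ?mulr1 ?mulrN1 ?opprK ?eqxx ?n11 ?n11' //= mul1r.
Qed.

(** Here [j_{-a} = j_b] means that one of [a], [b] is compact and the other is not, so
    [b - a] is non-compact, and its sign [j] is that of [(phi, b - a)]. *)
Lemma nterm_mix a b : a \in pmroots -> b \in pmroots ->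
  nterm (- a) b = if (ep a == -1) && (ep b == 1) then compact_term a b / 2
    else if (ep b == -1) && (ep a == 1) then compact_term b a / 2 else 0.
Proof.
move=> ap bp; have [[am pa] [bm pb]] := ((pmrootsP a).1 ap, (pmrootsP b).1 bp).
have [man mbn] := (mrootN am, mrootN bm).
have [ra rb] := (mroot_root am, mroot_root bm).
have [rna rnb] := (mroot_root man, mroot_root mbn).
have baE : (b - a \in mroots) = (a - b \in mroots) by rewrite -mrootNE opprB.
rewrite !compact_termE // /nterm (addrC (- a)).
have [abm|abm] := boolP (a - b \in mroots); last first.
  have h1 := mroots_sum0 ra rnb abm.
  have h2 := mroots_sum0 rb rna; rewrite baE in h2; have {}h2 := h2 abm.
  rewrite baE (negbTE abm) /=; move: h1 h2.
  move: (phiv (a - b)) (phiv (b - a)) (phiv a) (phiv b) (sgn_root _ _) (sgn_root _ _) => x y z t u u' h1 h2.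
  have re (q r m l : R) : r * m = 0 -> q * (r / l) * m = 0.
    move=> rm; have -> : q * (r / l) * m = q / l * (r * m) by ring.
    by rewrite rm mulr0.
  by rewrite (re _ _ _ _ h1) (re _ _ _ _ h2) !mul0r !if_same.
have bam : b - a \in mroots by rewrite baE.
have rab := mroot_root abm; have rba := mroot_root bam.
have [_ N1 N2 _ _] := rv_Nc He rb rna rba.
have [_ N3 N4 _ _] := rv_Nc He ra rnb rab.
rewrite (opprK a) in N2; rewrite (opprK b) in N4.
have sqN : Nc b (- a) ^+ 2 = Nc a (- b) ^+ 2 by rewrite -[in RHS]sqrrN -N3 N2 sqrrN.
have sqN' : Nc (- a) b ^+ 2 = Nc a (- b) ^+ 2 by rewrite N4 sqrrN.
have sgnE c : c \in mroots -> sgn_root P c = Num.sg (phiv c).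
  move=> cm; rewrite /sgn_root -(mroot_pos cm); have [p0|] := ltP 0 (phiv c).
    by rewrite gtr0_sg.
  by rewrite le_eqVlt (negbTE (mroot_neq0 cm)) /= => p0; rewrite ltr0_sg.
rewrite bam /= (jsgnN ra) (jsgn_pos ap) (jsgn_pos bp) (sgnE _ abm) (sgnE _ bam) sqN sqN'.
rewrite /jsgn (epD lb Htau He rb rna rba) (epN lb Htau He ra).
have ab := mroot_neq0 abm; move: ab.
rewrite !phivalD !phivalN.
move: (Nc a (- b) ^+ 2) (ep a) (ep b) (epP br k a) (epP br k b) pa pb.
move: (phiv a) (phiv b) => s t n2 j j' hj hj' s0 t0; rewrite subr_eq0.
have [sn tn] := (lt0r_neq0 s0, lt0r_neq0 t0).
case: (ltgtP s t) => // st _.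
  have d1 : t - s > 0 by rewrite subr_gt0. have d2 : s - t < 0 by rewrite subr_lt0.
  rewrite (gtr0_sg d1) (ltr0_sg d2).
  by case: hj => ->; case: hj' => ->;
  rewrite ?mulr1 ?mulrN1 ?opprK ?eqxx ?n11 ?n11' ?eqxx //=; field; rewrite ?sn ?tn.
have d1 : t - s < 0 by rewrite subr_lt0. have d2 : s - t > 0 by rewrite subr_gt0.
rewrite (ltr0_sg d1) (gtr0_sg d2).
by case: hj => ->; case: hj' => ->;
  rewrite ?mulr1 ?mulrN1 ?opprK ?eqxx ?n11 ?n11' ?eqxx //=; field; rewrite ?sn ?tn.
Qed.

Lemma sum_filter2 (Q Q' : pred (hR_dual h0)) (F : hR_dual h0 -> hR_dual h0 -> R) :
  \sum_(a <- [seq a <- pmroots | Q a]) \sum_(b <- [seq b <- pmroots | Q' b]) F a b =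
  \sum_(a <- pmroots) \sum_(b <- pmroots) (if Q a && Q' b then F a b else 0).
Proof.
rewrite big_filter big_mkcond; apply: eq_bigr => a _.
rewrite big_filter big_mkcond; case: (Q a) => //=.
by rewrite big1.
Qed.

(** The symmetry [(a, b) |-> (- a, - b)] reduces the sum to twice the one over the
    pairs [(a, b)] and [(- a, b)] with [a] and [b] positive. Among the latter, each
    pair of a compact and a non-compact root occurs in both orders, with half of its
    term each time. *)
Lemma sum_nterm : \sum_(a <- mroots) \sum_(b <- mroots) nterm a b =
  2 * (\sum_(a <- [seq a <- pmroots | ep a == 1])
         \sum_(b <- [seq b <- pmroots | ep b == 1]) noncompact_term a b +
       \sum_(a <- [seq a <- pmroots | ep a == -1])
         \sum_(b <- [seq b <- pmroots | ep b == 1]) compact_term a b).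
Proof.
have -> : \sum_(a <- mroots) \sum_(b <- mroots) nterm a b =
    2 * \sum_(a <- pmroots) \sum_(b <- pmroots) (nterm a b + nterm (- a) b).
  rewrite sum_pmroots mulr_sumr; apply: eq_big_seq => a /pmrootsP[am _].
  have -> : \sum_(b <- mroots) nterm (- a) b = \sum_(b <- mroots) nterm a b.
    rewrite -sum_mrootsN; apply: eq_big_seq => b bm; exact: ntermNN.
  rewrite -mulr2n mulr_natl sum_pmroots; congr (_ *+ 2); apply: eq_big_seq => b /pmrootsP[bm _].
  by congr (_ + _); rewrite -(ntermNN am (mrootN bm)) opprK.
rewrite !sum_filter2; congr (_ * _).
under eq_bigr do rewrite big_split.
rewrite big_split; congr (_ + _).
  by apply: eq_big_seq => a ap; apply: eq_big_seq => b bp; exact: nterm_pos.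
pose h a b : R := if (ep a == -1) && (ep b == 1) then compact_term a b / 2 else 0.
have hE a b : a \in pmroots -> b \in pmroots -> nterm (- a) b = h a b + h b a.
  move=> ap bp; rewrite (nterm_mix ap bp) /h.
  case: ifP => [/andP[/eqP-> /eqP->]|_]; last by rewrite add0r.
  by rewrite n11 addr0.
have -> : \sum_(a <- pmroots) \sum_(b <- pmroots) nterm (- a) b =
    \sum_(a <- pmroots) \sum_(b <- pmroots) (h a b + h b a).
  by apply: eq_big_seq => a ap; apply: eq_big_seq => b bp; exact: hE.
under eq_bigr do rewrite big_split.
rewrite big_split /= [X in _ + X]exchange_big -big_split; apply: eq_bigr => a _ /=.
rewrite -big_split; apply: eq_bigr => b _ /=; rewrite /h; case: ifP => _; last exact: addr0.
exact: (esym (splitr _)).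
Qed.

Let Dc := [set a | [/\ P a, compact_root br k a & ip phi a != 0]].
Let Dn := [set a | [/\ P a, noncompact_root br p a & ip phi a != 0]].

Let pmroots_ip a : a \in pmroots <-> P a /\ ip phi a != 0.
Proof.
have [Pr _ _ _] := HP.
split=> [/pmrootsP[am pa]|[Pa]].
  split; first by apply/asboolP; rewrite -mroot_pos.
  by rewrite (ipE (mroot_root am)); exact: mroot_neq0.
rewrite (ipE (Pr _ Pa)) => p0; have am : a \in mroots by apply/mrootsP; split=> //; exact: Pr.
by apply/pmrootsP; split=> //; rewrite mroot_pos //; apply/asboolP.
Qed.

Lemma noncompact_seq : Dn = [set` [seq a <- pmroots | ep a == 1]].
Proof.
have [Pr _ _ _] := HP.
apply/seteqP; split=> a; rewrite /= mem_filter.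
  move=> [Pa nca ip0]; apply/andP; split; last by apply/pmroots_ip.
  by apply/eqP/(noncompact_rootP lb Hkp Hh0 vh0 cent_v He (Pr _ Pa)).
move=> /andP[/eqP ea /pmroots_ip[Pa ip0]]; split=> //.
exact/(noncompact_rootP lb Hkp Hh0 vh0 cent_v He (Pr _ Pa)).
Qed.

Lemma compact_seq : Dc = [set` [seq a <- pmroots | ep a == -1]].
Proof.
have [Pr _ _ _] := HP.
apply/seteqP; split=> a; rewrite /= mem_filter.
  move=> [Pa nca ip0]; apply/andP; split; last by apply/pmroots_ip.
  by apply/eqP/(compact_rootP k (Pr _ Pa)).
move=> /andP[/eqP ea /pmroots_ip[Pa ip0]]; split=> //.
exact/(compact_rootP k (Pr _ Pa)).
Qed.

Lemma sum_nterm_sets : \sum_(a <- mroots) \sum_(b <- mroots) nterm a b =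
  2 * (\sum_(a \in Dn) \sum_(b \in Dn)
          ip phi (a + b) / (ip phi a * ip phi b) * Nc a b ^+ 2 +
       \sum_(a \in Dc) \sum_(b \in Dn)
          (1 + sgn_root P (a - b)) *
          (ip phi (a - b) / (ip phi a * ip phi b)) * Nc a (- b) ^+ 2).
Proof.
rewrite sum_nterm noncompact_seq compact_seq.
have u1 (Q : pred (hR_dual h0)) : uniq [seq a <- pmroots | Q a].
  by rewrite !filter_uniq ?mroots_uniq.
have conv2 (Q Q' : pred (hR_dual h0)) (F : hR_dual h0 -> hR_dual h0 -> R) :
  \sum_(a <- [seq a <- pmroots | Q a]) \sum_(b <- [seq b <- pmroots | Q' b]) F a b =
  \sum_(a \in [set` [seq a <- pmroots | Q a]]) \sum_(b \in [set` [seq b <- pmroots | Q' b]]) F a b.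
  rewrite fsbig_seq //; apply: eq_fsbigr => a _; exact: fsbig_seq.
by rewrite !conv2.
Qed.

(** * The squared norm *)

Lemma metric_J w w' : tangent_v w -> tangent_v w' ->
  om (Jv w) (Jv (Jv w')) = om w (Jv w').
Proof.
move=> tw tw'; apply: complexI.
refine (etrans (metric_cplx (J_tangent tw) (J_tangent tw')) _).
refine (etrans (f_equal2 gC (cplx_J tw) (cplx_J tw')) _).
exact: (etrans (gC_J _ _) (esym (metric_cplx tw tw'))).
Qed.

Lemma sqnorm_at_base : has_sqnorm [set br x v | x in setT] om Jv Nv
  (\sum_(a \in Dn) \sum_(b \in Dn)
      ip phi (a + b) / (ip phi a * ip phi b) * Nc a b ^+ 2 +
   \sum_(a \in Dc) \sum_(b \in Dn)
      (1 + sgn_root P (a - b)) *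
      (ip phi (a - b) / (ip phi a * ip phi b)) * Nc a (- b) ^+ 2).
Proof.
have tE w : [set br x v | x in setT] w <-> tangent_v w.
  by split=> [[x _ <-]|[x ->]]; exists x.
split.
  have [n [f [ft f1 f0 fs]]] := onb_exists; exists n, f; split=> [i|i j|i j|w /tE].
  - by split; apply/tE; [exact: ft|exact: J_tangent].
  - by split; [exact: f1|exact: (etrans (metric_J (ft i) (ft j)) (f1 i j))].
  - exact: f0.
  - exact: fs.
move=> n f [tf f1 f0 fs].
have ft i : tangent_v (f i) by apply/tE; have [] := tf i.
have := onb_norm_N ft (fun i j => (f1 i j).1) (fun i j => (f0 i j).1)
  (fun i j => (f0 i j).2) (fun w tw => fs w ((tE w).2 tw)).
rewrite sum_nterm_sets; move: (\sum_i _) (_ + _) => s r h.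
have two0 : (2 : R) != 0 by rewrite pnatr_eq0.
by apply: (mulfI two0); rewrite -h mulrA -natrM.
Qed.

End RootCoordinates.

Theorem theorem6p2 (R : realType) (G : TopGroup.type) (d : nat)
    (A : set (chart R G d)) (HG : lie_group A)
    (HGnc : ~ compact [set: G])
    (c : chart R G d) (Ac : A c) (c1 : chart_dom c 1%g)
    (E : 'rV[R]_d -> G) (HE : is_exponential c E)
    (Hss : semisimple (lie_br c))
    (v : 'rV[R]_d) (HV : compact (stabilizer c v))
    (k p : {vspace 'rV[R]_d}) (Hkp : cartan_decomposition (lie_br c) k p)
    (Hvk : forall x, v_alg c E v x -> x \in k)
    (h0 : {vspace 'rV[R]_d}) (Hh0 : maximal_abelian_in (lie_br c) k h0)
    (Hvh0 : v \in h0)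
    (phi : hR_dual h0) (Hphi : cplx v = 'i%C *: hvec (lie_br c) phi)
    (P : set (hR_dual h0)) (HP : positive_system (lie_br c) P)
    (HphiP : forall a, P a -> 0 <= dual_form (lie_br c) phi a)
    (tau tau0 : 'rV[R[i]]_d -> 'rV[R[i]]_d)
    (Htau : conjugation_fixing [set z | im_mx z = 0] tau)
    (Htau0 : conjugation_fixing [set z | re_mx z \in k /\ im_mx z \in p] tau0)
    (e : hR_dual h0 -> 'rV[R[i]]_d) (Nc : hR_dual h0 -> hR_dual h0 -> R)
    (He : root_vectors (lie_br c) k tau tau0 e Nc)
    (omega : 'rV[R]_d -> 'rV[R]_d -> 'rV[R]_d -> R)
    (Homega : is_KKS c E v omega)
    (J : 'rV[R]_d -> 'rV[R]_d -> 'rV[R]_d)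
    (HJ : is_canonical_acs c v k phi P J)
    (N : 'rV[R]_d -> 'rV[R]_d -> 'rV[R]_d -> 'rV[R]_d)
    (HN : is_nijenhuis c A v J N) :
  let ip := @dual_form R d (lie_br c) h0 in
  let Dc := [set a | [/\ P a, compact_root (lie_br c) k a & ip phi a != 0]] in
  let Dn := [set a | [/\ P a, noncompact_root (lie_br c) p a & ip phi a != 0]] in
  forall q, orbit_of c v q ->
    nijenhuis_sqnorm c omega J N q
      (\sum_(a \in Dn) \sum_(b \in Dn)
          ip phi (a + b) / (ip phi a * ip phi b) * Nc a b ^+ 2 +
       \sum_(a \in Dc) \sum_(b \in Dn)
          (1 + sgn_root P (a - b)) *
          (ip phi (a - b) / (ip phi a * ip phi b)) * Nc a (- b) ^+ 2).
Proof.
move=> ip Dc Dn q [g _ <-].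
have lb := lie_br_lie HG Ac c1 HE.
have [Jlin Jroot Jinv] := HJ.
have AdL g' := Ad_linear HG Ac c1 g'.
have cent_v x : lie_br c x v = 0 -> x \in k.
  by move=> xv; apply: Hvk; exact/(v_algP HG Ac c1 HE).
have [rts [urts rtsP rts_ext]] := roots_finite lb Hkp Hh0.
have tE w : orbit_tangent c v w <-> tangent_v (lie_br c) v w.
  by split=> [[x _ xw]|[x xw]]; exists x.
have Jlin' (l : R) w w' : tangent_v (lie_br c) v w -> tangent_v (lie_br c) v w' ->
    J v (l *: w + w') = l *: J v w + J v w'.
  by move=> /tE tw /tE tw'; exact: Jlin.
have tJ w : orbit_tangent c v w -> orbit_tangent c v (J v w).
  move=> /tE tw; apply/tE.
  exact: (J_tangent lb Hkp Hh0 Hvh0 cent_v Hphi Htau He urts rtsP rts_ext HP HphiP Jlin' Jroot tw).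
have JJ w : orbit_tangent c v w -> J v (J v w) = - w.
  move=> /tE tw.
  exact: (J_J lb Hkp Hh0 Hvh0 cent_v Hphi Htau He urts rtsP rts_ext HP HphiP Jlin' Jroot tw).
have m_tan x : tangent_v (lie_br c) v x -> m_space c E v x.
  move=> [u ->] y /(v_algP HG Ac c1 HE) yv.
  by rewrite (killing_inv lb) (lbC lb v) yv oppr0 (killing0r lb).
have Adbr := Ad_br HG Ac c1; have Adm := AdM HG Ac c1.
have adK := AdK HG Ac c1; have adVK := AdVK HG Ac c1.
have Jinv' := J_equivariant Adm adK adVK Adbr Jinv.
have Jlin'' := J_linear lb AdL adK adVK Adbr Jlin Jinv.
have JJ' := J_squared AdL adK adVK Adbr Jinv JJ tJ.
have N_fund r x y x' y' : orbit_of c v r ->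
    lie_br c x' r = J r (lie_br c x r) -> lie_br c y' r = J r (lie_br c y r) ->
    4 *: N r (lie_br c x r) (lie_br c y r) =
    lie_br c (lie_br c x' y' - lie_br c x y) r -
    J r (lie_br c (lie_br c x' y + lie_br c x y') r).
  exact: (nijenhuis_fund HG Ac c1 HE Jinv' Jlin'' JJ' HN).
have Hom x y : tangent_v (lie_br c) v x -> tangent_v (lie_br c) v y ->
    omega v (lie_br c x v) (lie_br c y v) = killing (lie_br c) v (lie_br c x y).
  by move=> /m_tan mx /m_tan my; exact: Homega.1.
have vv : orbit_of c v v by exists 1%g => //; exact: (Ad1 c1).
have base := sqnorm_at_base lb Hkp Hh0 Hvh0 cent_v Hphi Htau He urts rtsP rts_ext HP
  HphiP Jlin' Jroot Hom (fun x y x' y' => N_fund v x y x' y' vv).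
exact: (has_sqnorm_Ad lb AdL Adm adK adVK Adbr Jinv tJ N_fund Homega.2 g base).
Qed.
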